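(* Let $H$ be a Wigner-type matrix satisfying (A), (B), (C), let $E_0\in\mathfrak S$, let $\varepsilon_0>0$ be a fixed small constant, and let $c_0>0$ be a sufficiently small $N$-independent constant. Let $z,\zeta\in\mathbb D_{E_0,c_0}\setminus\mathbb R$. Then the eigenvalue $\beta(z,\zeta)$ of $B(z,\zeta)$ with the smallest modulus satisfies $$\beta(z,\zeta)=-\frac{\sigma}{\langle\mathbf f^2\rangle}\big(\xi(z)+\xi(\zeta)\big)-\frac{\psi}{\langle\mathbf f^2\rangle}\big(\xi(z)^2+\xi(z)\xi(\zeta)+\xi(\zeta)^2\big)-\frac{\sigma^2}{\langle\mathbf f^2\rangle^2}\xi(z)\xi(\zeta)+\mathcal O\big(|z-E_0|+|\zeta-E_0|\big),$$ where $\xi(z):=\xi(E_0,z)$ and $\sigma,\psi,\mathbf f$ are evaluated at $E_0$. The implicit constant depends only on the constants in (A), (B), (C).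
   Context: Wigner-type matrices: $H=(H_{jk})_{j,k=1}^N$ is an $N\times N$ random matrix with $H=H^*$ (real symmetric, or complex Hermitian with $\mathrm{Re}\,H_{jk},\mathrm{Im}\,H_{jk}$ independent and $\mathbb E[H_{jk}^2]=0$ for $j\neq k$), independent entries up to symmetry, $\mathbb E[H_{jk}]=0$, $S_{jk}:=\mathbb E|H_{jk}|^2$. Assumptions (constants positive, independent of $N$): (A) $c_{inf}/N\le S_{jk}\le C_{sup}/N$; (B) for every $p\in\mathbb N$, $\mathbb E|\sqrt NH_{jk}|^p\le C_p$; (C) the unique solution $\mathbf m(z)=(m_j(z))_{j=1}^N$ of $-1/m_j(z)=z+\sum_kS_{jk}m_k(z)$, $\mathrm{Im}\,m_j(z)\,\mathrm{Im}\,z>0$, satisfies $|m_j(z)|\le C_{\mathrm m}$. The solution extends continuously from the upper half-plane $\mathbb H$ to $\overline{\mathbb H}$. Notation: $\langle\mathbf x,\mathbf y\rangle=N^{-1}\sum_j\overline{x_j}y_j$, $\langle\mathbf x\rangle=N^{-1}\sum_jx_j$; products and functions of vectors are entrywise, and vectors also denote diagonal matrices. $\rho(z):=\pi^{-1}\langle\mathrm{Im}\,\mathbf m(z)\rangle$ for $z\in\overline{\mathbb H}$; $\mathfrak S:=\{E\in\mathrm{supp}\,\rho|_{\mathbb R}:\rho(E)=0\}$; $\mathbb D_{E_0,c_0}:=\{z\in\mathbb C:|z-E_0|\le c_0N^{-\varepsilon_0/3}\}$. Stability operator: $B(z,\zeta):=1-\mathbf m(z)\mathbf m(\zeta)S$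 acting on $\mathbb C^N$. Objects at $E_0$: $\mathbf m_0:=\mathbf m(E_0)$, which is real; $F:=|\mathbf m_0|S|\mathbf m_0|$; $\mathbf f:=\lim_{\eta\to+0}\rho(E_0+i\eta)^{-1}\,\mathrm{Im}\,\mathbf m(E_0+i\eta)/|\mathbf m(E_0+i\eta)|$ (the limit exists); $\mathbf v:=\mathbf f/\langle\mathbf f^2\rangle^{1/2}$, which is the normalized positive eigenvector of $F$ for its largest eigenvalue $1$; $\mathbf v\mathbf v^*$ denotes $\mathbf x\mapsto\mathbf v\langle\mathbf v,\mathbf x\rangle$; $\mathbf p:=\mathrm{sign}(\mathbf m_0)$; $\sigma:=\langle\mathbf p\mathbf f^2,\mathbf f\rangle$; $\psi:=\langle\mathbf p\mathbf f^2,\frac{1+F}{1-F}(1-\mathbf v\mathbf v^* )[\mathbf p\mathbf f^2]\rangle$, where $(1-F)^{-1}$ is the inverse on the orthogonal complement of $\mathbf v$. The right and left eigenvectors of $B(E_0,E_0)$ for its eigenvalue $0$ are $\mathbf b:=|\mathbf m_0|\mathbf f$ and $\mathbf b^\ell:=|\mathbf m_0|^{-1}\mathbf f$, and $\xi(E_0,z):=\dfrac{\langle\mathbf b^\ell,\mathbf m(z)-\mathbf m_0\rangle}{\langle\mathbf b^\ell,\mathbf b\rangle}$. *)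

(* Defs.v *)
From HB Require Import structures.
From mathcomp Require Import all_boot all_order all_algebra.
From mathcomp Require Import complex.
From mathcomp Require Import all_classical all_reals all_analysis.

Set Implicit Arguments.
Unset Strict Implicit.
Unset Printing Implicit Defensive.

Import Order.TTheory GRing.Theory Num.Theory.
Import numFieldNormedType.Exports.
Export Normc.

Local Open Scope classical_set_scope.
Local Open Scope ring_scope.
Local Open Scope complex_scope.

Local Notation Re := complex.Re.
Local Notation Im := complex.Im.

(* Complex numbers are [R[i]], with [Re], [Im], [normc]
   taking values in [R].  The alias [R[i]^o] of
   [R[i]] carries the topology of the norm. *)

Section Probability.
Context {R : realType} {d : measure_display} {T : measurableType d}.
Variable P : probability T R.

Definition complex_rv (X : T -> R[i]) : Prop :=
  measurable_fun setT (fun w => Re (X w)) /\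
  measurable_fun setT (fun w => Im (X w)).

(* Meaningful for integrable [X], since ['E_P] is an extended-real integral;
   every use below is accompanied by moment bounds of all orders. *)
Definition zero_mean (X : T -> R[i]) : Prop :=
  'E_P[fun w => Re (X w)]%E = 0%E /\ 'E_P[fun w => Im (X w)]%E = 0%E.

Definition independent2 (X Y : T -> R) : Prop :=
  forall A B : set R, measurable A -> measurable B ->
  P ((X @^-1` A) `&` (Y @^-1` B)) = (P (X @^-1` A) * P (Y @^-1` B))%E.

(* The complex plane carries its Borel sets through z |-> (Re z, Im z).  As
   [A i] may be the whole plane, the product rule over the full index set
   contains the product rules over all its subsets. *)
Definition mutually_independent (I : finType) (D : pred I)
    (X : I -> T -> R[i]) : Prop :=
  forall A : I -> set (R * R)%type, (forall i, measurable (A i)) ->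
  P (\bigcap_(i in [set i | D i]) [set w | A i (Re (X i w), Im (X i w))]) =
  (\prod_(i | D i) P [set w | A i (Re (X i w), Im (X i w))])%E.

Record wigner_type (N : nat) (H : T -> 'M[R[i]]_N) : Prop := {
  wigner_rv : forall j k, complex_rv (fun w => H w j k) ;
  wigner_hermitian : forall w, H w \is hermsymmx ;
  wigner_independent :
    mutually_independent (fun jk : 'I_N * 'I_N => (jk.1 <= jk.2)%N)
      (fun jk w => H w jk.1 jk.2) ;
  wigner_centered : forall j k, zero_mean (fun w => H w j k) ;
  wigner_symmetry_class :
    (forall w j k, Im (H w j k) = 0) \/
    ((forall j k, independent2 (fun w => Re (H w j k))
                               (fun w => Im (H w j k))) /\
     (forall j k, j != k -> zero_mean (fun w => H w j k ^+ 2))) }.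

Definition variance_mx (N : nat) (H : T -> 'M[R[i]]_N) : 'M[R]_N :=
  \matrix_(j, k) fine 'E_P[(fun w => normc (H w j k) ^+ 2)%R]%E.

Definition assumptionA (cinf Csup : R) (N : nat) (H : T -> 'M[R[i]]_N) : Prop :=
  forall j k, cinf / N%:R <= variance_mx H j k <= Csup / N%:R.

Definition assumptionB (Cmom : nat -> R) (N : nat) (H : T -> 'M[R[i]]_N) : Prop :=
  forall (p : nat) j k,
  ('E_P[(fun w => (Num.sqrt N%:R * normc (H w j k)) ^+ p)%R] <= (Cmom p)%:E)%E.

End Probability.

Section QuadraticVectorEquation.
Context {R : realType} {N : nat}.
Implicit Types (S : 'M[R]_N) (m : R[i] -> 'cV[R[i]]_N).

(* [m] is the solution off the real axis, and on the real axis it is the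
   boundary value of the solution in the upper half-plane. *)
Record qve_solution S m : Prop := {
  qve_eq : forall z, Im z != 0 ->
    forall j, - (m z j 0)^-1 = z + \sum_k (S j k)%:C * m z k 0 ;
  qve_sign : forall z, Im z != 0 -> forall j, 0 < Im (m z j 0) * Im z ;
  qve_boundary : forall j,
    {within [set z : R[i]^o | 0 <= Im z],
      continuous (fun z : R[i]^o => m z j 0 : R[i]^o)} }.

Definition assumptionC (Cm : R) m : Prop :=
  forall z, Im z != 0 -> forall j, normc (m z j 0) <= Cm.

Definition avg (K : fieldType) (x : 'cV[K]_N) : K := N%:R^-1 * \sum_j x j 0.

(* <x, y> for real vectors, and for complex ones. *)
Definition dot (x y : 'cV[R]_N) : R := avg (\col_j (x j 0 * y j 0)).
Definition cdot (x y : 'cV[R[i]]_N) : R[i] := avg (\col_j (conjc (x j 0) * y j 0)).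

Definition cvec (x : 'cV[R]_N) : 'cV[R[i]]_N := map_mx (fun a : R => a%:C) x.

Definition rho m (z : R[i]) : R := pi^-1 * avg (\col_j Im (m z j 0)).

Definition frakS m : set R :=
  closure [set E : R | rho m E%:C != 0] `&` [set E : R | rho m E%:C = 0].

Definition stability_op S m (z zeta : R[i]) : 'M[R[i]]_N :=
  1%:M - diag_mx (m z)^T *m diag_mx (m zeta)^T *m map_mx (fun a : R => a%:C) S.

(* [eigenvalue] is about row vectors, hence the transposition: the operator
   acts on column vectors. *)
Definition smallest_eigenvalue (A : 'M[R[i]]_N) (beta : R[i]) : Prop :=
  eigenvalue A^T beta /\
  forall lambda, eigenvalue A^T lambda -> normc beta <= normc lambda.

(* [m E0] is real for [E0] in [frakS m], so its real part is [m E0] itself. *)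
Definition m0 m (E0 : R) : 'cV[R]_N := \col_j Re (m E0%:C j 0).
Definition abs_m0 m (E0 : R) : 'cV[R]_N := \col_j `|m0 m E0 j 0|.
Definition pvec m (E0 : R) : 'cV[R]_N := \col_j Num.sg (m0 m E0 j 0).

Definition Fop S m (E0 : R) : 'M[R]_N :=
  diag_mx (abs_m0 m E0)^T *m S *m diag_mx (abs_m0 m E0)^T.

Definition fvec m (E0 : R) : 'cV[R]_N :=
  \col_j lim ((rho m (E0 +i* eta))^-1 *
    (Im (m (E0 +i* eta) j 0) / normc (m (E0 +i* eta) j 0)) @[eta --> 0^'+]).

Definition vvec m (E0 : R) : 'cV[R]_N :=
  (Num.sqrt (dot (fvec m E0) (fvec m E0)))^-1 *: fvec m E0.

(* The inverse on the orthogonal complement of [v]: the [y] orthogonal to [v]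
   with [A y = x] (unique in the cases of interest, junk value 0 otherwise). *)
Definition inverse_on_perp (A : 'M[R]_N) (v x : 'cV[R]_N) : 'cV[R]_N :=
  xget 0 [set y | dot v y = 0 /\ A *m y = x].

Definition pf2 m (E0 : R) : 'cV[R]_N :=
  \col_j (pvec m E0 j 0 * fvec m E0 j 0 ^+ 2).

Definition sigma m (E0 : R) : R := dot (pf2 m E0) (fvec m E0).

Definition psi S m (E0 : R) : R :=
  let F := Fop S m E0 in
  let v := vvec m E0 in
  let x := pf2 m E0 - dot v (pf2 m E0) *: v in
  dot (pf2 m E0) ((1%:M + F) *m inverse_on_perp (1%:M - F) v x).

Definition bvec m (E0 : R) : 'cV[R]_N :=
  \col_j (abs_m0 m E0 j 0 * fvec m E0 j 0).
Definition blvec m (E0 : R) : 'cV[R]_N :=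
  \col_j ((abs_m0 m E0 j 0)^-1 * fvec m E0 j 0).

Definition xi m (E0 : R) (z : R[i]) : R[i] :=
  cdot (cvec (blvec m E0)) (m z - cvec (m0 m E0)) /
  cdot (cvec (blvec m E0)) (cvec (bvec m E0)).

(* The set D_(E0,c0) minus the real axis. *)
Definition disk_off_real (eps0 c0 E0 : R) : set R[i] :=
  [set z | normc (z - E0%:C) <= c0 * N%:R `^ (- (eps0 / 3)) /\ Im z != 0].

Definition beta_expansion S m (E0 : R) (z zeta : R[i]) : R[i] :=
  let f2 := dot (fvec m E0) (fvec m E0) in
  let s := sigma m E0 in
  let x := xi m E0 z in
  let y := xi m E0 zeta in
  - (s / f2)%:C * (x + y)
  - (psi S m E0 / f2)%:C * (x ^+ 2 + x * y + y ^+ 2)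
  - (s ^+ 2 / f2 ^+ 2)%:C * (x * y).

End QuadraticVectorEquation.

Arguments disk_off_real {R} N eps0 c0 E0.

(* Main.v *)
(* Only the deterministic content is needed: the variance matrix S is symmetric
   with entries of order 1/N.  For two points z, z' the difference of solutions
   solves (1 - m(z) m(z') S)(m(z) - m(z')) = m(z) m(z') (z - z').  The kernel
   |m m'|^(1/2) S |m m'|^(1/2) has norm at most 1 - c Im z' / rho(z') with a
   spectral gap, and the phase of m(z) m(z') is at distance at least c rho(z')
   from 0 and 2 pi, whence
     |m(z) - m(z')| <= C |z - z'| / (rho(z')^2 + Im z' / rho(z')).
   Since (rho^2 + y / rho)^3 >= y^2, passing from z and from E0 to the point
   z' = z + i |z - E0| gives |m(z) - m(E0)|^3 <= C |z - E0| uniformly in N.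

   Write m(z) = |m0| (p + h), and m(zeta) = |m0| (p + k).  Then
   (1 - F) h = p h F h + O(z - E0), so h = xi f + xi^2 q + O(z - E0) where q
   inverts 1 - F on the part of p f^2 orthogonal to f.  After conjugation by
   |m0| the stability operator is 1 - (1 + tau) F with
   tau = p h + p k + h k; an eigenvalue near 0 has an eigenvector f + y with
   y = (xi + xi') q up to second order, and projecting onto f gives the
   expansion.  An eigenvalue near 0 exists: along t -> 1 - (1 + t tau) F the
   eigenvalue starting from 0 cannot leave a small disk. *)
Require Import Defs.
From mathcomp Require Import all_boot all_order all_algebra.
From mathcomp Require Import perm complex ring lra.
From mathcomp Require Import all_classical all_reals all_analysis.

Import Order.TTheory GRing.Theory Num.Theory.
Import numFieldNormedType.Exports.
Local Open Scope classical_set_scope.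
Local Open Scope ring_scope.
Local Open Scope complex_scope.

Set Implicit Arguments.
Unset Strict Implicit.
Unset Printing Implicit Defensive.

(** * Quadratic forms of symmetric positive kernels *)

Section RealForms.
Context {R : realType} {N : nat}.
Implicit Types (A F : 'M[R]_N) (x y g X : 'I_N -> R).

(** All constants are fixed before [N], so each estimate has to be entrywise and lossless in the
    dimension. Spectral information enters only through a positive subsolution, [A g <= kappa * g]:
    substituting [x = g X] bounds the forms of [kappa - A] and [kappa + A] below by weighted sums of
    squares, and entries of order 1/N make the resulting gaps uniform. The vector [f] is defined
    only as a limit at [E0], where the normalizing density vanishes. Since [E0] is in the closure of
    the set of positive density, exact eigenvectors at nearby real points supply its existence, its
    bounds and [F f = f]. The two spectral parameters may lie in different half-planes. Conjugation
    reduces the Hoelder bound to the upper one; afterwards only the algebraic equation for the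
    relative shift is used, and it is the same on both sides. Orders are counted in a single scale
    [e], with [e^3] proportional to |z - E0| + |zeta - E0|, so that the cubic remainder is the error
    term. The expansion is proved for every eigenvalue below a fixed threshold; minimality of beta
    is used only to place it below that threshold. *)

Definition apply_mx A x (j : 'I_N) : R := \sum_k A j k * x k.

Definition qform A x : R := \sum_j x j * (x j - apply_mx A x j).

Lemma apply_mxB A x y j :
  apply_mx A (fun k => x k - y k) j = apply_mx A x j - apply_mx A y j.
Proof. by rewrite /apply_mx -sumrB; apply: eq_bigr => k _; rewrite mulrBr. Qed.

Lemma apply_mxZ A (c : R) x j :
  apply_mx A (fun k => c * x k) j = c * apply_mx A x j.
Proof. by rewrite /apply_mx mulr_sumr; apply: eq_bigr => k _; rewrite mulrCA. Qed.

Lemma apply_mx_sym A x y : (forall j k, A j k = A k j) ->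
  \sum_j x j * apply_mx A y j = \sum_j apply_mx A x j * y j.
Proof.
move=> symA; rewrite /apply_mx.
under eq_bigr do rewrite mulr_sumr.
rewrite exchange_big; apply: eq_bigr => k _ /=.
rewrite mulr_suml; apply: eq_bigr => j _.
by rewrite (symA j k) mulrCA mulrA.
Qed.

(** The constant-kernel analogue of [dirichlet_form]. Both signs are needed: [e = 1] gives
    Cauchy-Schwarz, [e = -1] the distance of the spectrum from -1. *)
Lemma sum_sqr_sub (e : R) X : e ^+ 2 = 1 ->
  \sum_j \sum_k (X j - e * X k) ^+ 2 =
  2 * (N%:R * (\sum_j X j ^+ 2) - e * (\sum_j X j) ^+ 2).
Proof.
move=> e2.
have -> : \sum_j \sum_k (X j - e * X k) ^+ 2 =
   \sum_j \sum_(k < N) X j ^+ 2 + \sum_(j < N) \sum_k X k ^+ 2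
   - 2 * e * \sum_j \sum_k X j * X k.
  rewrite mulr_sumr -big_split -sumrB /=; apply: eq_bigr => j _.
  rewrite mulr_sumr -big_split -sumrB /=; apply: eq_bigr => k _.
  by transitivity (X j ^+ 2 + e ^+ 2 * X k ^+ 2 - 2 * e * (X j * X k));
    [ring | rewrite e2; ring].
have -> : \sum_j \sum_(k < N) X j ^+ 2 = N%:R * \sum_j X j ^+ 2.
  rewrite mulr_sumr; apply: eq_bigr => j _.
  by rewrite sumr_const card_ord mulr_natl.
have -> : \sum_(j < N) \sum_k X k ^+ 2 = N%:R * \sum_j X j ^+ 2.
  by rewrite sumr_const card_ord mulr_natl.
have -> : \sum_j \sum_k X j * X k = (\sum_j X j) ^+ 2.
  by rewrite expr2 mulr_suml; apply: eq_bigr => j _; rewrite mulr_sumr.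
ring.
Qed.

Lemma sqr_sum_le X : (\sum_j X j) ^+ 2 <= N%:R * \sum_j X j ^+ 2.
Proof.
have := @sum_sqr_sub 1 X (expr1n _ _).
have : 0 <= \sum_j \sum_k (X j - 1 * X k) ^+ 2.
  by apply: sumr_ge0 => j _; apply: sumr_ge0 => k _; rewrite sqr_ge0.
lra.
Qed.

(** Ground state transform: expanding the square, symmetry of [A] identifies the two diagonal terms.
    The sign [e] treats [1 - A] and [1 + A] together. *)
Lemma dirichlet_form A g X (e : R) : (forall j k, A j k = A k j) -> e ^+ 2 = 1 ->
  \sum_j \sum_k A j k * (g j * g k) * (X j - e * X k) ^+ 2 =
  2 * (\sum_j g j * X j ^+ 2 * apply_mx A g j
       - e * \sum_j g j * X j * apply_mx A (fun k => g k * X k) j).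
Proof.
move=> symA e2.
pose T1 := \sum_j \sum_k A j k * (g j * g k) * X j ^+ 2.
pose T2 := \sum_j \sum_k A j k * (g j * g k) * X k ^+ 2.
pose T3 := \sum_j \sum_k A j k * (g j * g k) * (X j * X k).
have -> : \sum_j \sum_k A j k * (g j * g k) * (X j - e * X k) ^+ 2 =
   T1 + T2 - 2 * e * T3.
  rewrite /T1 /T2 /T3 mulr_sumr -big_split -sumrB /=; apply: eq_bigr => j _.
  rewrite mulr_sumr -big_split -sumrB /=; apply: eq_bigr => k _.
  transitivity (A j k * (g j * g k) *
      (X j ^+ 2 + e ^+ 2 * X k ^+ 2 - 2 * e * (X j * X k))); [ring|].
  by rewrite e2; ring.
have -> : T2 = T1.
  rewrite /T2 exchange_big; apply: eq_bigr => j _; apply: eq_bigr => k _ /=.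
  by rewrite symA (mulrC (g k)).
have -> : T1 = \sum_j g j * X j ^+ 2 * apply_mx A g j.
  apply: eq_bigr => j _; rewrite /apply_mx mulr_sumr; apply: eq_bigr => k _; ring.
have -> : T3 = \sum_j g j * X j * apply_mx A (fun k => g k * X k) j.
  apply: eq_bigr => j _; rewrite /apply_mx mulr_sumr; apply: eq_bigr => k _; ring.
ring.
Qed.

Section Kernel.
Variables (a lo hi kappa : R) (A : 'M[R]_N) (g : 'I_N -> R).
Hypotheses (a_gt0 : 0 < a) (lo_gt0 : 0 < lo) (N_gt0 : (0 < N)%N).
Hypothesis symA : forall j k, A j k = A k j.
Hypothesis A_ge : forall j k, a / N%:R <= A j k.
Hypothesis g_bnd : forall j, lo <= g j <= hi.
Hypothesis Ag_le : forall j, apply_mx A g j <= kappa * g j.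

Let g_gt0 j : 0 < g j. Proof. by have /andP[h _] := g_bnd j; apply: lt_le_trans h. Qed.

Let A_ge0 j k : 0 <= A j k.
Proof. by apply: le_trans (A_ge j k); rewrite divr_ge0 ?ler0n // ltW. Qed.

Lemma form_lower_bound (e : R) x : e ^+ 2 = 1 ->
  \sum_j \sum_k A j k * (g j * g k) * (x j / g j - e * (x k / g k)) ^+ 2
  <= 2 * (kappa * (\sum_j x j ^+ 2) - e * \sum_j x j * apply_mx A x j).
Proof.
move=> e2; rewrite (@dirichlet_form A g (fun j => x j / g j) e) // ler_pM2l //.
have gE j : g j * (x j / g j) = x j by field; rewrite gt_eqF.
have -> : (fun k => g k * (x k / g k)) = x by apply/funext => j; exact: gE.
under [X in e * X]eq_bigr do rewrite gE.
rewrite lerD2r mulr_sumr; apply: ler_sum => j _.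
have h : 0 <= (x j / g j) ^+ 2 := sqr_ge0 _.
have -> : kappa * x j ^+ 2 = g j * (x j / g j) ^+ 2 * (kappa * g j).
  by field; rewrite gt_eqF.
by apply: ler_wpM2l => //; rewrite mulr_ge0 // ltW.
Qed.

(** A positive subsolution of a nonnegative symmetric kernel bounds the top of the spectrum, because
    the Dirichlet form with [e = 1] is nonnegative. *)
Lemma qform_ge x : (1 - kappa) * (\sum_j x j ^+ 2) <= qform A x.
Proof.
have := @form_lower_bound 1 x (expr1n _ _).
have : 0 <= \sum_j \sum_k A j k * (g j * g k) * (x j / g j - 1 * (x k / g k)) ^+ 2.
  apply: sumr_ge0 => j _; apply: sumr_ge0 => k _.
  by rewrite mulr_ge0 ?sqr_ge0 // mulr_ge0 // mulr_ge0 // ltW.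
have -> : qform A x = \sum_j x j ^+ 2 - \sum_j x j * apply_mx A x j.
  by rewrite -sumrB; apply: eq_bigr => j _; rewrite mulrBr expr2.
lra.
Qed.

(** With [e = -1] the kernel may be replaced by its constant lower bound [a * lo ^+ 2 / N]. Then
    [sum_sqr_sub] leaves N times the sum of squares plus a square, and the first term alone gives a
    gap at -1 free of [N]. *)
Lemma lower_edge x : kappa <= 1 ->
  a * lo ^+ 2 / hi ^+ 2 * (\sum_j x j ^+ 2)
  <= \sum_j x j ^+ 2 + \sum_j x j * apply_mx A x j.
Proof.
move=> kappa_le1.
have e2 : (-1) ^+ 2 = 1 :> R by rewrite sqrrN expr1n.
have := @form_lower_bound (-1) x e2.
have nN : 0 < N%:R :> R by rewrite ltr0n.
have lb : a / N%:R * lo ^+ 2 * (\sum_j \sum_k (x j / g j - (-1) * (x k / g k)) ^+ 2)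
    <= \sum_j \sum_k A j k * (g j * g k) * (x j / g j - (-1) * (x k / g k)) ^+ 2.
  rewrite mulr_sumr; apply: ler_sum => j _; rewrite mulr_sumr; apply: ler_sum => k _.
  apply: ler_wpM2r; first exact: sqr_ge0.
  apply: ler_pM; rewrite ?divr_ge0 ?sqr_ge0 ?ler0n // ?(ltW a_gt0) //.
  have /andP[gj _] := g_bnd j; have /andP[gk _] := g_bnd k.
  by rewrite expr2; apply: ler_pM => //; apply: ltW.
move: lb; rewrite (@sum_sqr_sub (-1) (fun j => x j / g j) e2).
have ge : hi ^- 2 * (\sum_j x j ^+ 2) <= \sum_j (x j / g j) ^+ 2.
  rewrite mulr_sumr; apply: ler_sum => j _; rewrite expr_div_n mulrC.
  apply: ler_wpM2l; first exact: sqr_ge0.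
  have /andP[_ gj] := g_bnd j.
  have hi_gt0 : 0 < hi := lt_le_trans (g_gt0 j) gj.
  by rewrite lef_pV2 ?posrE ?exprn_gt0 // ler_sqr ?nnegrE // ltW.
have Sx : 0 <= \sum_j x j ^+ 2 by apply: sumr_ge0 => j _; rewrite sqr_ge0.
move: (\sum_j x j * _) (\sum_j \sum_k _) => V W.
move: ge; set X2 := \sum_j (x j / g j) ^+ 2; set X1 := \sum_j (x j / g j) => ge.
have -> : a / N%:R * lo ^+ 2 * (2 * (N%:R * X2 - -1 * X1 ^+ 2)) =
  2 * (a * lo ^+ 2 * X2) + 2 * (a * lo ^+ 2 / N%:R * X1 ^+ 2).
  by field; rewrite gt_eqF.
have h1 : 0 <= a * lo ^+ 2 / N%:R * X1 ^+ 2.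
  by rewrite mulr_ge0 ?sqr_ge0 // divr_ge0 ?ler0n // mulr_ge0 ?sqr_ge0 // ltW.
have h2 : a * lo ^+ 2 * (hi ^- 2 * (\sum_j x j ^+ 2)) <= a * lo ^+ 2 * X2.
  by apply: ler_wpM2l => //; rewrite mulr_ge0 ?sqr_ge0 // ltW.
have h3 : kappa * (\sum_j x j ^+ 2) <= \sum_j x j ^+ 2 by rewrite ler_piMl.
rewrite -(mulrA (a * lo ^+ 2)).
lra.
Qed.

(* With [Q = 1 - A >= 0], the bound [<Qx, Q Qx> <= (2 - g0) <Qx, Qx>] from
   the lower spectral edge and positivity of [Q] at [x - Qx / (2 - g0)] give
   [|Qx|^2 <= (2 - g0) <x, Qx>] without a spectral theorem. *)
Lemma qform_le_sqr_drop (g0 : R) x : kappa <= 1 -> 0 < g0 -> g0 <= 1 ->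
  g0 <= a * lo ^+ 2 / hi ^+ 2 ->
  g0 * qform A x <= \sum_j x j ^+ 2 - \sum_j (apply_mx A x j) ^+ 2.
Proof.
move=> kappa_le1 g0_gt0 g0_le1 g0_le.
pose y j := x j - apply_mx A x j.
have qE z : qform A z = \sum_j z j ^+ 2 - \sum_j z j * apply_mx A z j.
  by rewrite -sumrB; apply: eq_bigr => j _; rewrite mulrBr expr2.
have Sy : 0 <= \sum_j y j ^+ 2 by apply: sumr_ge0 => j _; rewrite sqr_ge0.
have M_gt0 : 0 < 2 - g0 by lra.
have qy : qform A y <= (2 - g0) * \sum_j y j ^+ 2.
  have h := lower_edge y kappa_le1; rewrite qE.
  have : g0 * (\sum_j y j ^+ 2) <= a * lo ^+ 2 / hi ^+ 2 * (\sum_j y j ^+ 2).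
    exact: ler_wpM2r.
  lra.
pose t := (2 - g0)^-1.
have q0 : 0 <= qform A (fun j => x j - t * y j).
  apply: le_trans (qform_ge _); rewrite mulr_ge0 ?subr_ge0 //.
  by apply: sumr_ge0 => j _; rewrite sqr_ge0.
have qexp : qform A (fun j => x j - t * y j) =
    qform A x - 2 * t * (\sum_j y j ^+ 2) + t ^+ 2 * qform A y.
  have e1 : \sum_j x j * apply_mx A y j = \sum_j apply_mx A x j * y j.
    exact: apply_mx_sym.
  have -> : qform A (fun j => x j - t * y j) =
      qform A x + t * (\sum_j x j * apply_mx A y j) - t * (\sum_j x j * y j)
      - t * (\sum_j y j ^+ 2) + t ^+ 2 * qform A y.
    rewrite /qform !mulr_sumr -!(big_split, sumrB) /=.
    by apply: eq_bigr => j _; rewrite apply_mxB apply_mxZ /y; ring.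
  rewrite e1.
  have -> : \sum_j y j ^+ 2 = \sum_j x j * y j - \sum_j apply_mx A x j * y j.
    by rewrite -sumrB; apply: eq_bigr => j _; rewrite /y; ring.
  ring.
have sqy : \sum_j y j ^+ 2 <= (2 - g0) * qform A x.
  move: q0; rewrite qexp => q0.
  have : t ^+ 2 * qform A y <= t * \sum_j y j ^+ 2.
    apply: (le_trans (ler_wpM2l (sqr_ge0 t) qy)).
    by rewrite mulrA /t expr2 mulfVK // gt_eqF.
  move=> h; have : t * (\sum_j y j ^+ 2) <= qform A x by lra.
  by rewrite /t ler_pdivrMl.
have -> : \sum_j x j ^+ 2 - \sum_j (apply_mx A x j) ^+ 2 =
   2 * qform A x - \sum_j y j ^+ 2.
  rewrite /qform mulr_sumr -!sumrB; apply: eq_bigr => j _; rewrite /y; ring.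
lra.
Qed.

(** A Poincare inequality. The comparison kernel is the product [g j ^+ 2 * g k ^+ 2], because its
    cross term is then the square of [\sum_j g j * x j], which vanishes. *)
Lemma perp_qform_ge x : kappa <= 1 -> \sum_j g j * x j = 0 ->
  a * lo ^+ 2 / hi ^+ 2 * (\sum_j x j ^+ 2) <= qform A x.
Proof.
move=> kappa_le1 gx0.
have nN : 0 < N%:R :> R by rewrite ltr0n.
have hi_gt0 : 0 < hi.
  by have /andP[_] := g_bnd (Ordinal N_gt0); apply: lt_le_trans.
have := @form_lower_bound 1 x (expr1n _ _).
pose G j := g j ^+ 2.
have lb : a / N%:R * hi ^- 2 *
     (\sum_j \sum_k G j * G k * (x j / g j - 1 * (x k / g k)) ^+ 2)
    <= \sum_j \sum_k A j k * (g j * g k) * (x j / g j - 1 * (x k / g k)) ^+ 2.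
  rewrite mulr_sumr; apply: ler_sum => j _; rewrite mulr_sumr; apply: ler_sum => k _.
  rewrite mulrA; apply: ler_wpM2r; first exact: sqr_ge0.
  rewrite -mulrA; apply: ler_pM => //.
  - by rewrite divr_ge0 ?ler0n // ltW.
  - by rewrite mulr_ge0 ?invr_ge0 ?sqr_ge0 // mulr_ge0 // sqr_ge0.
  have /andP[_ gj] := g_bnd j; have /andP[_ gk] := g_bnd k.
  rewrite mulrC ler_pdivrMr ?exprn_gt0 // /G.
  have -> : g j ^+ 2 * g k ^+ 2 = (g j * g k) * (g j * g k) by ring.
  apply: ler_wpM2l; first by rewrite mulr_ge0 ?ltW.
  by rewrite expr2; apply: ler_pM => //; apply: ltW.
move: lb.
have -> : \sum_j \sum_k G j * G k * (x j / g j - 1 * (x k / g k)) ^+ 2 =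
   2 * ((\sum_j G j) * (\sum_j x j ^+ 2)).
  transitivity ((\sum_j \sum_k x j ^+ 2 * G k) + (\sum_j \sum_k G j * x k ^+ 2)
     - 2 * \sum_j \sum_k (g j * x j) * (g k * x k)).
    rewrite mulr_sumr -big_split -sumrB /=; apply: eq_bigr => j _.
    rewrite mulr_sumr -big_split -sumrB /=; apply: eq_bigr => k _.
    by rewrite /G; field; rewrite (gt_eqF (g_gt0 j)) (gt_eqF (g_gt0 k)).
  have -> : \sum_j \sum_k g j * x j * (g k * x k) = 0.
    by rewrite big1 // => j _; rewrite -mulr_sumr gx0 mulr0.
  have -> : \sum_j \sum_k x j ^+ 2 * G k = (\sum_j x j ^+ 2) * \sum_j G j.
    by rewrite mulr_suml; apply: eq_bigr => j _; rewrite mulr_sumr.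
  have -> : \sum_j \sum_k G j * x k ^+ 2 = (\sum_j G j) * \sum_j x j ^+ 2.
    by rewrite mulr_suml; apply: eq_bigr => j _; rewrite mulr_sumr.
  ring.
have SG : N%:R * lo ^+ 2 <= \sum_j G j.
  have -> : N%:R * lo ^+ 2 = \sum_(j < N) lo ^+ 2.
    by rewrite sumr_const card_ord mulr_natl.
  apply: ler_sum => j _; have /andP[gj _] := g_bnd j.
  by rewrite /G ler_sqr // nnegrE ltW.
have Sx : 0 <= \sum_j x j ^+ 2 by apply: sumr_ge0 => j _; rewrite sqr_ge0.
have -> : qform A x = \sum_j x j ^+ 2 - \sum_j x j * apply_mx A x j.
  by rewrite -sumrB; apply: eq_bigr => j _; rewrite mulrBr expr2.
have h1 : a * lo ^+ 2 / hi ^+ 2 * (\sum_j x j ^+ 2) <=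
   a / N%:R * hi ^- 2 * ((\sum_j G j) * (\sum_j x j ^+ 2)).
  rewrite mulrA; apply: ler_wpM2r => //.
  have -> : a * lo ^+ 2 / hi ^+ 2 = a / N%:R * hi ^- 2 * (N%:R * lo ^+ 2).
    by field; rewrite !gt_eqF.
  by apply: ler_wpM2l => //; rewrite mulr_ge0 ?invr_ge0 ?sqr_ge0 // divr_ge0 ?ler0n // ltW.
have h2 : kappa * (\sum_j x j ^+ 2) <= \sum_j x j ^+ 2 by rewrite ler_piMl.
move: (\sum_j \sum_k _) => W.
lra.
Qed.

(** Passage from mean square to supremum without loss in [N]: the gap and Cauchy-Schwarz bound the
    mean of |x|, and [x = (x - A x) + A x] with entries of [A] at most [b / N] turns this into a
    bound for each entry. *)
Lemma perp_sup_bound (b r : R) x : kappa <= 1 ->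
  (forall j k, A j k <= b / N%:R) ->
  \sum_j g j * x j = 0 ->
  (forall j, `|x j - apply_mx A x j| <= r) ->
  forall j, `|x j| <= (1 + b / (a * lo ^+ 2 / hi ^+ 2)) * r.
Proof.
move=> kappa_le1 A_le gx0 x_le j.
have nN : 0 < N%:R :> R by rewrite ltr0n.
have hi_gt0 : 0 < hi.
  by have /andP[_] := g_bnd (Ordinal N_gt0); apply: lt_le_trans.
set ga := a * lo ^+ 2 / hi ^+ 2.
have ga_gt0 : 0 < ga by rewrite /ga divr_gt0 ?mulr_gt0 ?exprn_gt0.
have r_ge0 : 0 <= r by apply: le_trans (x_le j).
set s := \sum_j `|x j|.
have s_ge0 : 0 <= s by apply: sumr_ge0 => k _.
have h1 : ga * (\sum_j x j ^+ 2) <= r * s.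
  apply: (le_trans (perp_qform_ge kappa_le1 gx0)).
  rewrite /qform /s mulr_sumr; apply: ler_sum => k _.
  by apply: (le_trans (ler_norm _)); rewrite normrM mulrC; apply: ler_wpM2r.
have h2 : s ^+ 2 <= N%:R * \sum_j x j ^+ 2.
  apply: (le_trans (sqr_sum_le _)); rewrite ler_pM2l //.
  by apply: ler_sum => k _; rewrite real_normK ?num_real.
have s_le : ga * s <= N%:R * r.
  have [->|s0] := eqVneq s 0; first by rewrite mulr0 mulr_ge0 // ltW.
  have sp : 0 < s by rewrite lt_def s0.
  rewrite -(ler_pM2r sp) -mulrA -expr2.
  apply: (le_trans (ler_wpM2l (ltW ga_gt0) h2)).
  by rewrite mulrCA -(mulrA N%:R); apply: ler_wpM2l => //; rewrite ltW.
have -> : x j = (x j - apply_mx A x j) + apply_mx A x j by rewrite subrK.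
apply: (le_trans (ler_normD _ _)); rewrite mulrDl mul1r; apply: lerD => //.
have b_ge0 : 0 <= b / N%:R by apply: le_trans (A_le j j).
apply: (@le_trans _ _ (b / N%:R * s)).
  rewrite /apply_mx /s mulr_sumr; apply: (le_trans (ler_norm_sum _ _ _)).
  apply: ler_sum => k _; rewrite normrM ger0_norm //.
  exact: ler_wpM2r.
have -> : b / ga * r = b / N%:R * (N%:R * r / ga) by field; rewrite !gt_eqF.
by apply: ler_wpM2l => //; rewrite ler_pdivlMr // mulrC.
Qed.

End Kernel.
End RealForms.

(** * Modulus, real and imaginary parts of complex numbers *)

Section Normc.
Context {R : realType}.
Implicit Types x y : R[i].

Lemma normc_sqr x : normc x ^+ 2 = complex.Re x ^+ 2 + complex.Im x ^+ 2.
Proof. by case: x => a b; rewrite /= sqr_sqrtr // addr_ge0 ?sqr_ge0. Qed.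

Lemma normc_ge0 x : 0 <= normc x.
Proof. by case: x => a b; rewrite /= sqrtr_ge0. Qed.

Lemma normc_le_sqr x (r : R) : 0 <= r ->
  complex.Re x ^+ 2 + complex.Im x ^+ 2 <= r ^+ 2 -> normc x <= r.
Proof.
by move=> r0; rewrite -normc_sqr => h; rewrite -(@ler_pXn2r _ 2) ?nnegrE ?normc_ge0.
Qed.

Lemma normcD x y : normc (x + y) <= normc x + normc y.
Proof. exact: le_normcD. Qed.

Lemma normcB x y : normc (x - y) <= normc x + normc y.
Proof. by apply: (le_trans (normcD _ _)); rewrite normcN. Qed.

Lemma normc_triangle x y z : normc (x - z) <= normc (x - y) + normc (y - z).
Proof. by rewrite -[x - z](subrKA y); exact: normcD. Qed.

Lemma normc_real (a : R) : normc a%:C = `|a|.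
Proof. by rewrite /= expr0n /= addr0 sqrtr_sqr. Qed.

Lemma normc_conj x : normc (conjc x) = normc x.
Proof. by case: x => a b; rewrite /= sqrrN. Qed.

Lemma normc_Re x : `|complex.Re x| <= normc x.
Proof.
rewrite -(@ler_pXn2r _ 2) ?nnegrE ?normc_ge0 //.
by rewrite normc_sqr real_normK ?num_real // lerDl sqr_ge0.
Qed.

Lemma normc_Im x : `|complex.Im x| <= normc x.
Proof.
rewrite -(@ler_pXn2r _ 2) ?nnegrE ?normc_ge0 //.
by rewrite normc_sqr real_normK ?num_real // lerDr sqr_ge0.
Qed.

Lemma normc_le_ReIm x : normc x <= `|complex.Re x| + `|complex.Im x|.
Proof.
apply: normc_le_sqr; first by rewrite addr_ge0.
rewrite -[complex.Re x ^+ 2]real_normK ?num_real //.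
rewrite -[complex.Im x ^+ 2]real_normK ?num_real //.
have := normr_ge0 (complex.Re x); have := normr_ge0 (complex.Im x); nra.
Qed.

Lemma normc_sum (I : Type) (s : seq I) (P : pred I) (F : I -> R[i]) :
  normc (\sum_(i <- s | P i) F i) <= \sum_(i <- s | P i) normc (F i).
Proof.
elim/big_ind2: _ => [|x a y b xa yb|//]; first by rewrite normc0.
by apply: (le_trans (normcD _ _)); exact: lerD.
Qed.

Lemma normc_gt0 x : (0 < normc x) = (x != 0).
Proof.
rewrite lt_def normc_ge0 andbT; congr negb.
by apply/eqP/eqP => [/eq0_normc//|->]; rewrite normc0.
Qed.

Lemma normcX x n : normc (x ^+ n) = normc x ^+ n.
Proof. by elim: n => [|n IH]; rewrite ?normc1 // !exprS normcM IH. Qed.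

Lemma cReD x y : complex.Re (x + y) = complex.Re x + complex.Re y.
Proof. by case: x y => a b [c d]. Qed.
Lemma cImD x y : complex.Im (x + y) = complex.Im x + complex.Im y.
Proof. by case: x y => a b [c d]. Qed.
Lemma cReN x : complex.Re (- x) = - complex.Re x.
Proof. by case: x => a b. Qed.
Lemma cImN x : complex.Im (- x) = - complex.Im x.
Proof. by case: x => a b. Qed.
Lemma cReM x y : complex.Re (x * y) =
  complex.Re x * complex.Re y - complex.Im x * complex.Im y.
Proof. by case: x y => a b [c d]. Qed.
Lemma cImM x y : complex.Im (x * y) =
  complex.Re x * complex.Im y + complex.Im x * complex.Re y.
Proof. by case: x y => a b [c d]. Qed.

Lemma Re_sum (I : Type) (s : seq I) (P : pred I) (F : I -> R[i]) :
  complex.Re (\sum_(i <- s | P i) F i) = \sum_(i <- s | P i) complex.Re (F i).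
Proof. by elim/big_ind2: _ => // x a y b <- <-; rewrite cReD. Qed.
Lemma Im_sum (I : Type) (s : seq I) (P : pred I) (F : I -> R[i]) :
  complex.Im (\sum_(i <- s | P i) F i) = \sum_(i <- s | P i) complex.Im (F i).
Proof. by elim/big_ind2: _ => // x a y b <- <-; rewrite cImD. Qed.

End Normc.

(** * Inverting a unimodular diagonal minus a positive kernel *)

Section Rotation.
Context {R : realType} {N : nat}.
Implicit Types (A F : 'M[R]_N).

Definition apply_cmx A (w : 'I_N -> R[i]) (j : 'I_N) : R[i] :=
  \sum_k (A j k)%:C * w k.

Lemma Re_apply_cmx A w j :
  complex.Re (apply_cmx A w j) = apply_mx A (fun k => complex.Re (w k)) j.
Proof. by rewrite Re_sum; apply: eq_bigr => k _; rewrite cReM /= mul0r subr0. Qed.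

Lemma Im_apply_cmx A w j :
  complex.Im (apply_cmx A w j) = apply_mx A (fun k => complex.Im (w k)) j.
Proof. by rewrite Im_sum; apply: eq_bigr => k _; rewrite cImM /= mul0r addr0. Qed.

Variables (a lo hi kappa : R) (A : 'M[R]_N) (g : 'I_N -> R).
Hypotheses (a_gt0 : 0 < a) (lo_gt0 : 0 < lo) (N_gt0 : (0 < N)%N).
Hypothesis symA : forall j k, A j k = A k j.
Hypothesis A_ge : forall j k, a / N%:R <= A j k.
Hypothesis g_bnd : forall j, lo <= g j <= hi.
Hypothesis Ag_le : forall j, apply_mx A g j <= kappa * g j.

(* Testing [U w - A w = r] against [w] gives [<w, (1 - A) w>] as the sum of
   [<w, (1 - Re U) w>] and an [O(|w||r|)] term, while [|Aw| = |Uw - r|] bounds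
   [|w|^2 - |Aw|^2], hence [<w, (1 - A) w>] itself, by [O(|w||r|)]. *)
Lemma rotation_bound (g0 dl R0 : R) (U w r : 'I_N -> R[i]) : kappa <= 1 ->
  0 < g0 -> g0 <= 1 -> g0 <= a * lo ^+ 2 / hi ^+ 2 -> 0 <= dl ->
  (forall j, normc (U j) = 1) -> (forall j, complex.Re (U j) <= 1 - dl) ->
  (forall j, U j * w j - apply_cmx A w j = r j) ->
  (forall j, normc (r j) <= R0) ->
  (dl + (1 - kappa)) * (\sum_j normc (w j)) <= (4 / g0 + 1) * (N%:R * R0).
Proof.
move=> kappa_le1 g0_gt0 g0_le1 g0_le dl_ge0 U1 ReU eqw r_le.
have nN : 0 < N%:R :> R by rewrite ltr0n.
have R0_ge0 : 0 <= R0 by apply: le_trans (r_le (Ordinal N_gt0)); exact: normc_ge0.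
pose x j := complex.Re (w j); pose y j := complex.Im (w j).
pose s := \sum_j normc (w j); pose s2 := \sum_j normc (w j) ^+ 2.
have s_ge0 : 0 <= s by apply: sumr_ge0 => j _; exact: normc_ge0.
have s2E : s2 = \sum_j x j ^+ 2 + \sum_j y j ^+ 2.
  by rewrite -big_split; apply: eq_bigr => j _; rewrite normc_sqr.
pose q := qform A x + qform A y.
have Aw j : apply_cmx A w j = U j * w j - r j by rewrite -eqw; ring.
have drop : g0 * q <= 2 * (R0 * s).
  have h z := qform_le_sqr_drop a_gt0 lo_gt0 N_gt0 symA A_ge g_bnd Ag_le
                z kappa_le1 g0_gt0 g0_le1 g0_le.
  have := lerD (h x) (h y); rewrite -mulrDr -/q => {}h.
  apply: (le_trans h).
  rewrite -!sumrB -big_split /s !mulr_sumr; apply: ler_sum => j _ /=.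
  have e2 : normc (apply_cmx A w j) ^+ 2 = apply_mx A x j ^+ 2 + apply_mx A y j ^+ 2.
    by rewrite normc_sqr Re_apply_cmx Im_apply_cmx.
  have e1 : normc (w j) ^+ 2 = x j ^+ 2 + y j ^+ 2 by rewrite normc_sqr.
  have t1 : normc (w j) <= normc (apply_cmx A w j) + normc (r j).
    have -> : normc (w j) = normc (apply_cmx A w j + r j).
      by rewrite Aw subrK normcM U1 mul1r.
    exact: normcD.
  have := normc_ge0 (w j); have := normc_ge0 (apply_cmx A w j).
  have := le_trans t1 (lerD (lexx _) (r_le j)).
  have -> : x j ^+ 2 - apply_mx A x j ^+ 2 + (y j ^+ 2 - apply_mx A y j ^+ 2) =
     (normc (w j) - normc (apply_cmx A w j)) * (normc (w j) + normc (apply_cmx A w j)).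
    by transitivity (normc (w j) ^+ 2 - normc (apply_cmx A w j) ^+ 2);
      [rewrite e1 e2|]; ring.
  (* The target is (W - V)(W + V) <= 2 R0 W. The left side is nonpositive if W <= V; otherwise W - V
     <= R0 and W + V <= 2 W. *)
  move: (normc (w j)) (normc (apply_cmx A w j)) => W V t V_ge0 W_ge0.
  have [WV|VW] := lerP W V; first by nra.
  by nra.
have lowq : dl * s2 <= q + R0 * s.
  rewrite /q /qform /s /s2 !mulr_sumr -!big_split /=; apply: ler_sum => j _.
  have e1 : normc (w j) ^+ 2 = x j ^+ 2 + y j ^+ 2 by rewrite normc_sqr.
  have := Aw j => /(congr1 (@complex.Re R)); rewrite Re_apply_cmx cReD cReN cReM.
  have := Aw j => /(congr1 (@complex.Im R)); rewrite Im_apply_cmx cImD cImN cImM.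
  rewrite -/(x j) -/(y j) => -> ->.
  have := normc_Re (conjc (w j) * r j); rewrite normcM normc_conj => h.
  have : complex.Re (conjc (w j) * r j) =
     x j * complex.Re (r j) + y j * complex.Im (r j).
    by rewrite /x /y; case: (w j) (r j) => ? ? [? ?] /=; ring.
  move=> hE; rewrite hE in h.
  have b1 : normc (w j) * normc (r j) <= R0 * normc (w j).
    by rewrite mulrC; apply: ler_wpM2r => //; exact: normc_ge0.
  have b2 : dl * normc (w j) ^+ 2 <= (1 - complex.Re (U j)) * normc (w j) ^+ 2.
    by apply: ler_wpM2r; [exact: sqr_ge0 | have := ReU j; lra].
  move: h; rewrite ler_norml => /andP[h _].
  move: b2; rewrite {2}e1.
  lra.
have lowk : (1 - kappa) * s2 <= q.
  rewrite s2E mulrDr; apply: lerD;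
  exact: (qform_ge a_gt0 lo_gt0 symA A_ge g_bnd Ag_le).
have qR : q <= 2 / g0 * (R0 * s) by rewrite mulrAC ler_pdivlMr // mulrC.
(* Adding [lowq] and [lowk] costs 2 q, whence 4 / g0; Cauchy-Schwarz and division by [s] then give
   the bound on the sum of moduli. *)
have tot : (dl + (1 - kappa)) * s2 <= (4 / g0 + 1) * (R0 * s) by lra.
have ss : s ^+ 2 <= N%:R * s2 by exact: sqr_sum_le.
have [s0|s0] := eqVneq s 0.
  rewrite -/s s0 mulr0 !mulr_ge0 ?ler0n // addr_ge0 // divr_ge0 // ltW //.
have sp : 0 < s by rewrite lt_def s0.
rewrite -/s -(ler_pM2r sp).
have c_ge0 : 0 <= dl + (1 - kappa) by lra.
have := ler_wpM2l c_ge0 ss.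
have := ler_wpM2l (ltW nN) tot.
lra.
Qed.

End Rotation.
(** * Two-point stability of the quadratic vector equation *)

Section QveAt.
Context {R : realType} {N : nat}.
Variables (D : R) (S : 'M[R]_N).
Hypotheses (D_ge1 : 1 <= D) (N_gt0 : (0 < N)%N).
Hypothesis symS : forall j k, S j k = S k j.
Hypothesis S_bnd : forall j k, D^-1 / N%:R <= S j k <= D / N%:R.

Let D_gt0 : 0 < D. Proof. exact: lt_le_trans D_ge1. Qed.
Let nN : 0 < N%:R :> R. Proof. by rewrite ltr0n. Qed.

Let S_ge0 j k : 0 <= S j k.
Proof.
by have /andP[h _] := S_bnd j k; apply: le_trans h; rewrite divr_ge0 ?invr_ge0 ?ler0n // ltW.
Qed.

(** Signs are weak so that the notion is closed under limits: it also covers boundary values on the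
    real axis, and conjugates of values from the lower half-plane. *)
Record qve_at (z : R[i]) (x : 'I_N -> R[i]) : Prop := {
  qve_at_eq : forall j, x j * (z + apply_cmx S x j) = -1 ;
  qve_at_bnd : forall j, D^-1 <= normc (x j) <= D ;
  qve_at_Im : forall j, 0 <= complex.Im (x j) ;
  qve_at_z : 0 <= complex.Im z }.

Definition mS (x : 'I_N -> R[i]) : 'M[R]_N :=
  \matrix_(j, k) (normc (x j) * S j k * normc (x k)).

(** Stands in for the density; by [qve_Im_bounds] it is comparable to each Im x_j. *)
Definition size_at (z : R[i]) (x : 'I_N -> R[i]) : R :=
  complex.Im z + N%:R^-1 * \sum_j complex.Im (x j).

(** The sine of the argument of [x j], rescaled to order one; it is the subsolution for the kernel
    [mS x]. *)
Definition phase z (x : 'I_N -> R[i]) (j : 'I_N) : R :=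
  complex.Im (x j) / (normc (x j) * size_at z x).

Section OnePoint.
Variables (z : R[i]) (x : 'I_N -> R[i]).
Hypothesis qx : qve_at z x.

Lemma qve_normc_gt0 j : 0 < normc (x j).
Proof. by have /andP[h _] := qve_at_bnd qx j; apply: lt_le_trans h; rewrite invr_gt0. Qed.

Lemma qve_Im j : complex.Im (x j) = normc (x j) ^+ 2 *
  (complex.Im z + \sum_k S j k * complex.Im (x k)).
Proof.
have := qve_at_eq qx j; rewrite -/(apply_mx S _ j) -Im_apply_cmx -cImD normc_sqr.
case: (x j) (z + _) => a b [c d] [h1 h2] /=.
transitivity (b * (a * c - b * d + 1) + b * (b * d) - a * b * c); first by ring.
have -> : a * b * c = a * (a * d + b * c) - a * (a * d) by ring.
by rewrite h1 h2 /=; ring.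
Qed.

Let avg_ge0 : 0 <= N%:R^-1 * \sum_j complex.Im (x j).
Proof.
rewrite mulr_ge0 ?invr_ge0 ?ler0n //; apply: sumr_ge0 => j _; exact: (qve_at_Im qx).
Qed.

Lemma size_at_ge_Im : complex.Im z <= size_at z x.
Proof. by rewrite lerDl. Qed.

(** [S] is entrywise comparable to averaging, so [S] applied to Im x is nearly constant. Of the
    factor [D ^+ 3], two powers come from |x|^2 and one from [S]. *)
Lemma qve_Im_bounds j :
  size_at z x / D ^+ 3 <= complex.Im (x j) <= D ^+ 3 * size_at z x.
Proof.
have SI_ge : D^-1 * (N%:R^-1 * \sum_k complex.Im (x k)) <= \sum_k S j k * complex.Im (x k).
  rewrite mulrA mulr_sumr; apply: ler_sum => k _; apply: ler_wpM2r.
    exact: (qve_at_Im qx).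
  by have /andP[] := S_bnd j k.
have SI_le : \sum_k S j k * complex.Im (x k) <= D * (N%:R^-1 * \sum_k complex.Im (x k)).
  rewrite mulrA mulr_sumr; apply: ler_sum => k _; apply: ler_wpM2r.
    exact: (qve_at_Im qx).
  by have /andP[] := S_bnd j k.
have /andP[xl xh] := qve_at_bnd qx j.
have Dinv : 0 < D^-1 by rewrite invr_gt0.
have Dinv1 : D^-1 <= 1 by rewrite invf_le1.
have Di0 : 0 <= D^-1 := ltW Dinv.
have z0 := qve_at_z qx; have a0 := avg_ge0.
have sq_ge : D^-1 ^+ 2 <= normc (x j) ^+ 2 by rewrite ler_sqr ?nnegrE ?normc_ge0 // ltW.
have sq_le : normc (x j) ^+ 2 <= D ^+ 2 by rewrite ler_sqr ?nnegrE ?normc_ge0 // ltW.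
rewrite qve_Im /size_at; move: SI_ge SI_le a0.
move: (_ * \sum_k complex.Im (x k)) (\sum_k S j k * _) => a SI SI_ge SI_le a0.
have SI0 : 0 <= SI by apply: le_trans SI_ge; exact: mulr_ge0.
apply/andP; split.
  have -> : (complex.Im z + a) / D ^+ 3 = D^-1 ^+ 2 * (D^-1 * complex.Im z + D^-1 * a).
    by field; rewrite gt_eqF.
  apply: ler_pM => //; first by rewrite sqr_ge0.
    by rewrite addr_ge0 // mulr_ge0.
  by apply: lerD => //; rewrite ler_piMl.
have -> : D ^+ 3 * (complex.Im z + a) = D ^+ 2 * (D * complex.Im z + D * a) by ring.
apply: ler_pM; rewrite ?sqr_ge0 ?addr_ge0 //.
by apply: lerD => //; rewrite ler_peMl.
Qed.

Lemma size_at_le : size_at z x <= D ^+ 4.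
Proof.
have /andP[h _] := qve_Im_bounds (Ordinal N_gt0).
move: h; rewrite ler_pdivrMr ?exprn_gt0 // => h; apply: (le_trans h).
rewrite (exprS D 3); apply: ler_wpM2r; first by rewrite exprn_ge0 // ltW.
have /andP[_ h2] := qve_at_bnd qx (Ordinal N_gt0).
by apply: le_trans h2; apply: le_trans (normc_Im _); exact: ler_norm.
Qed.

Hypothesis s_gt0 : 0 < size_at z x.

Lemma phase_bounds j : (D ^+ 4)^-1 <= phase z x j <= D ^+ 4.
Proof.
have /andP[Il Ih] := qve_Im_bounds j.
have /andP[xl xh] := qve_at_bnd qx j.
have x0 := qve_normc_gt0 j.
have ps : 0 < normc (x j) * size_at z x by rewrite mulr_gt0.
rewrite /phase ler_pdivlMr // ler_pdivrMr //; apply/andP; split.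
  apply: le_trans Il; rewrite mulrA; rewrite mulrC; apply: ler_wpM2l; first exact: ltW.
  have -> : (D ^+ 4)^-1 = D^-1 * (D ^+ 3)^-1 by field; rewrite gt_eqF.
  rewrite mulrAC; apply: ler_piMl; first by rewrite invr_ge0 exprn_ge0 // ltW.
  by rewrite ler_pdivrMl // mulr1.
apply: (le_trans Ih); rewrite mulrA; apply: ler_wpM2r; first exact: ltW.
rewrite (exprSr D 3) -mulrA; apply: ler_peMr; first by rewrite exprn_ge0 // ltW.
by rewrite -ler_pdivrMl ?mulr1.
Qed.

(** The imaginary part of the equation, [qve_Im], divided by |x_j| and the size: the defect from
    being an eigenvector is proportional to Im z. *)
Lemma mS_phase j : apply_mx (mS x) (phase z x) j =
  phase z x j - complex.Im z * normc (x j) / size_at z x.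
Proof.
have x0 k := gt_eqF (qve_normc_gt0 k).
have s0 := gt_eqF s_gt0.
have -> : apply_mx (mS x) (phase z x) j =
   normc (x j) / size_at z x * \sum_k S j k * complex.Im (x k).
  rewrite /apply_mx mulr_sumr; apply: eq_bigr => k _; rewrite mxE /phase.
  by field; rewrite s0 x0.
rewrite {1}/phase qve_Im; field; by rewrite s0 x0.
Qed.

Lemma mS_phase_le j : apply_mx (mS x) (phase z x) j <=
  (1 - complex.Im z / (D ^+ 5 * size_at z x)) * phase z x j.
Proof.
rewrite mS_phase mulrBl mul1r lerD2l lerN2.
have -> : complex.Im z / (D ^+ 5 * size_at z x) * phase z x j =
   complex.Im z / size_at z x * (phase z x j / D ^+ 5).
  by field; rewrite !gt_eqF.
have -> : complex.Im z * normc (x j) / size_at z x = complex.Im z / size_at z x * normc (x j).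
  by rewrite mulrAC.
apply: ler_wpM2l.
  by rewrite divr_ge0 ?(ltW s_gt0) //; exact: qve_at_z qx.
have /andP[_ h] := phase_bounds j.
have /andP[h2 _] := qve_at_bnd qx j.
apply: le_trans h2; rewrite ler_pdivrMr ?exprn_gt0 //.
by rewrite (exprS _ 4) mulrA mulVf ?mul1r // gt_eqF.
Qed.

End OnePoint.

(** The first summand comes from z - z' appearing directly in the equation for the difference, the
    second from [rotation_bound] with [g0 = D ^- 19]. *)
Definition two_point_const : R := 2 * D ^+ 10 + 2 * D ^+ 13 * (4 * D ^+ 19 + 1).

Section TwoPoints.
Variables (z z' : R[i]) (x x' : 'I_N -> R[i]) (g : 'I_N -> R).
Hypotheses (qx : qve_at z x) (qx' : qve_at z' x').
Hypothesis g_bnd : forall j, (D ^+ 4)^-1 <= g j <= D ^+ 4.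
Hypothesis mSg : forall j, apply_mx (mS x) g j <= g j.
Hypothesis s'_gt0 : 0 < size_at z' x'.

Let s' := size_at z' x'.
Let eta' := complex.Im z'.
Let g' := phase z' x'.
Let rt j := Num.sqrt (normc (x j)) * Num.sqrt (normc (x' j)).
Let gt j := Num.sqrt (g j) * Num.sqrt (g' j).
Let A : 'M[R]_N := \matrix_(j, k) (rt j * S j k * rt k).
Let theta := eta' / (D ^+ 5 * s').

Let D4 : 0 < (D ^+ 4)^-1. Proof. by rewrite invr_gt0 exprn_gt0. Qed.
Let g_gt0 j : 0 < g j.
Proof. by have /andP[h _] := g_bnd j; apply: lt_le_trans h. Qed.
Let g'_bnd j : (D ^+ 4)^-1 <= g' j <= D ^+ 4.
Proof. exact: phase_bounds. Qed.
Let g'_gt0 j : 0 < g' j.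
Proof. by have /andP[h _] := g'_bnd j; apply: lt_le_trans h. Qed.

Let sqrt_prod_bounds (l h u v : R) : 0 < l -> l <= u <= h -> l <= v <= h ->
  l <= Num.sqrt u * Num.sqrt v <= h.
Proof.
move=> l0 /andP[lu uh] /andP[lv vh].
have u0 := lt_le_trans l0 lu; have v0 := lt_le_trans l0 lv.
have h0 := lt_le_trans u0 uh.
have -> : l = Num.sqrt l * Num.sqrt l by rewrite -expr2 sqr_sqrtr // ltW.
have -> : h = Num.sqrt h * Num.sqrt h by rewrite -expr2 sqr_sqrtr // ltW.
by rewrite !ler_pM ?sqrtr_ge0 ?ler_psqrt ?nnegrE // ltW.
Qed.

Let gt_bnd j : (D ^+ 4)^-1 <= gt j <= D ^+ 4.
Proof. exact: sqrt_prod_bounds. Qed.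

Let rt_bnd j : D^-1 <= rt j <= D.
Proof.
by apply: sqrt_prod_bounds; rewrite ?invr_gt0 //; [case: qx | case: qx'] => ? h *; exact: h.
Qed.

Let rt_gt0 j : 0 < rt j.
Proof. by have /andP[h _] := rt_bnd j; apply: lt_le_trans h; rewrite invr_gt0. Qed.

Let symA j k : A j k = A k j.
Proof. by rewrite !mxE symS; ring. Qed.

Let A_ge j k : (D ^+ 3)^-1 / N%:R <= A j k.
Proof.
rewrite mxE.
have -> : (D ^+ 3)^-1 / N%:R = D^-1 * (D^-1 / N%:R) * D^-1 by field; rewrite !gt_eqF.
have /andP[h1 _] := rt_bnd j; have /andP[h2 _] := rt_bnd k.
have /andP[h3 _] := S_bnd j k.
have Di : 0 <= D^-1 by rewrite invr_ge0 ltW.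
by rewrite !ler_pM // ?mulr_ge0 // ?invr_ge0 ?ler0n.
Qed.

Let theta_ge0 : 0 <= theta.
Proof. by rewrite divr_ge0 ?(qve_at_z qx') // mulr_ge0 ?exprn_ge0 // ltW. Qed.

(* [sqrt (g g')] is a subsolution for the geometric mean of the kernels
   [|x| S |x|] and [|x'| S |x'|], by AM-GM weighted with [sqrt (g' j / g j)]. *)
Let Agt j : apply_mx A gt j <= (1 - theta / 2) * gt j.
Proof.
have gt0 : 0 < gt j by rewrite mulr_gt0 // sqrtr_gt0.
have sq (u : R) : 0 < u -> Num.sqrt u ^+ 2 = u by move=> h; rewrite sqr_sqrtr // ltW.
have h1 : 2 * gt j * apply_mx A gt j <=
   g' j * apply_mx (mS x) g j + g j * apply_mx (mS x') g' j.
  rewrite /apply_mx !mulr_sumr -big_split; apply: ler_sum => k _ /=.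
  rewrite !mxE -subr_ge0.
  have -> : g' j * (normc (x j) * S j k * normc (x k) * g k) +
      g j * (normc (x' j) * S j k * normc (x' k) * g' k) -
      2 * gt j * (rt j * S j k * rt k * gt k) =
      S j k * (Num.sqrt (g' j) * Num.sqrt (normc (x j)) * Num.sqrt (normc (x k)) * Num.sqrt (g k)
       - Num.sqrt (g j) * Num.sqrt (normc (x' j)) * Num.sqrt (normc (x' k)) * Num.sqrt (g' k)) ^+ 2.
    rewrite -{1}(sq _ (g'_gt0 j)) -{1}(sq _ (g_gt0 j)) -{1}(sq _ (g'_gt0 k)) -{1}(sq _ (g_gt0 k)).
    rewrite -{1}(sq _ (qve_normc_gt0 qx j)) -{1}(sq _ (qve_normc_gt0 qx k)).
    rewrite -{1}(sq _ (qve_normc_gt0 qx' j)) -{1}(sq _ (qve_normc_gt0 qx' k)).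
    rewrite /gt /rt; ring.
  by rewrite mulr_ge0 ?sqr_ge0.
have h2 : apply_mx (mS x') g' j <= (1 - theta) * g' j by exact: mS_phase_le.
have h3 : g' j * apply_mx (mS x) g j <= g' j * g j by apply: ler_wpM2l => //; exact: ltW.
have h4 : g j * apply_mx (mS x') g' j <= g j * ((1 - theta) * g' j).
  by apply: ler_wpM2l => //; exact: ltW.
have e : g' j * g j = gt j ^+ 2 by rewrite /gt exprMn !sq // mulrC.
have gt20 : 0 < 2 * gt j by lra.
rewrite -(@ler_pM2l _ (2 * gt j)) //.
apply: (le_trans h1); apply: (le_trans (lerD h3 h4)).
have -> : g j * ((1 - theta) * g' j) = (1 - theta) * (g' j * g j) by ring.
by rewrite e; lra.
Qed.

(** Dividing the difference equation by the phase and by the square root of |x x'| makes the kernel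
    real, positive and symmetric and moves the phase to the diagonal, which is the form that
    [rotation_bound] treats. *)
Let U j : R[i] := ((normc (x j) * normc (x' j))^-1)%:C * conjc (x j * x' j).
Let d j := x j - x' j.
Let w j : R[i] := ((rt j)^-1)%:C * d j.

Let dE j : d j = x j * x' j * ((z - z') + apply_cmx S d j).
Proof.
have h1 := qve_at_eq qx j; have h2 := qve_at_eq qx' j.
have -> : apply_cmx S d j = apply_cmx S x j - apply_cmx S x' j.
  by rewrite /apply_cmx -sumrB; apply: eq_bigr => k _; rewrite mulrBr.
transitivity (x' j * (x j * (z + apply_cmx S x j)) - x j * (x' j * (z' + apply_cmx S x' j))).
  by rewrite h1 h2 /d; ring.
ring.
Qed.

Let rt2 j : rt j ^+ 2 = normc (x j) * normc (x' j).
Proof. by rewrite exprMn !sqr_sqrtr ?normc_ge0. Qed.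

Let mul_conj (u : R[i]) : conjc u * u = (normc u ^+ 2)%:C.
Proof.
rewrite normc_sqr; case: u => a b; apply/eqP; rewrite eq_complex /=.
by apply/andP; split; apply/eqP; ring.
Qed.

Let wE j : U j * w j - apply_cmx A w j = (rt j)%:C * (z - z').
Proof.
have -> : apply_cmx A w j = (rt j)%:C * apply_cmx S d j.
  rewrite /apply_cmx mulr_sumr; apply: eq_bigr => k _; rewrite mxE /w.
  have -> : (rt j * S j k * rt k)%:C * (((rt k)^-1)%:C * d k) =
      (rt j * S j k * (rt k / rt k))%:C * d k by rewrite !rmorphM /=; ring.
  by rewrite mulfV ?gt_eqF // mulr1 rmorphM /= mulrA.
rewrite /U /w dE.
have -> : ((normc (x j) * normc (x' j))^-1)%:C * ((x j * x' j)^*)%C *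
   ((rt j)^-1%:C * (x j * x' j * (z - z' + apply_cmx S d j))) =
   ((normc (x j) * normc (x' j))^-1)%:C * (rt j)^-1%:C * (((x j * x' j)^*)%C * (x j * x' j)) *
    (z - z' + apply_cmx S d j) by ring.
rewrite mul_conj normcM -!rmorphM /=.
have -> : (normc (x j) * normc (x' j))^-1 / rt j * (normc (x j) * normc (x' j)) ^+ 2 = rt j.
  by rewrite -rt2; field; rewrite gt_eqF.
ring.
Qed.

Let U1 j : normc (U j) = 1.
Proof.
rewrite /U normcM normc_real normc_conj normcM ger0_norm ?mulVf //.
  by rewrite mulf_neq0 // gt_eqF // (qve_normc_gt0 qx, qve_normc_gt0 qx').
by rewrite invr_ge0 mulr_ge0 ?normc_ge0.
Qed.

Let ReU j : complex.Re (U j) <= 1 - s' ^+ 2 / (2 * D ^+ 8).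
Proof.
have p : 0 < normc (x j) * normc (x' j) by rewrite mulr_gt0 ?(qve_normc_gt0 qx) ?(qve_normc_gt0 qx').
have -> : complex.Re (U j) = (normc (x j) * normc (x' j))^-1 * complex.Re (x j * x' j).
  by rewrite /U; case: (x j * x' j) => a b /=; ring.
have I : s' ^+ 2 / (2 * D ^+ 8) <= (complex.Im (x' j) / normc (x' j)) ^+ 2 / 2.
  have -> : complex.Im (x' j) / normc (x' j) = g' j * s'.
    by rewrite /g' /phase /s'; field; rewrite !gt_eqF // (qve_normc_gt0 qx').
  have -> : s' ^+ 2 / (2 * D ^+ 8) = ((D ^+ 4)^-1 * s') ^+ 2 / 2 by field; rewrite gt_eqF.
  apply: ler_wpM2r; first by rewrite invr_ge0.
  have a1 : 0 <= (D ^+ 4)^-1 * s' := mulr_ge0 (ltW D4) (ltW s'_gt0).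
  have a2 : 0 <= g' j * s' := mulr_ge0 (ltW (g'_gt0 j)) (ltW s'_gt0).
  rewrite ler_sqr //.
  by apply: ler_wpM2r; [exact: ltW | have /andP[] := g'_bnd j].
apply: (@le_trans _ _ (1 - (complex.Im (x' j) / normc (x' j)) ^+ 2 / 2)); last by rewrite lerD2l lerN2.
rewrite ler_pdivrMl // cReM.
have := normc_sqr (x' j); have := normc_ge0 (x j).
have := qve_at_Im qx j; have := qve_at_Im qx' j.
have := normc_Re (x j); have p' := qve_normc_gt0 qx' j.
have e : (complex.Im (x' j) / normc (x' j)) ^+ 2 = complex.Im (x' j) ^+ 2 / normc (x' j) ^+ 2.
  by rewrite expr_div_n.
rewrite e; move: p'; move: (normc (x j)) (normc (x' j)) (complex.Re (x j)) (complex.Im (x j)) => X X' a b.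
move: (complex.Re (x' j)) (complex.Im (x' j)) => a' b' X'0 aX b'0 b0 X0 eX.
have bb : 0 <= b * b' by rewrite mulr_ge0.
have -> : X * X' * (1 - b' ^+ 2 / X' ^+ 2 / 2) = X * ((X' ^+ 2 + a' ^+ 2) / (2 * X')).
  have -> : a' ^+ 2 = X' ^+ 2 - b' ^+ 2 by rewrite eX; ring.
  by field; rewrite gt_eqF.
have h : `|a'| <= (X' ^+ 2 + a' ^+ 2) / (2 * X').
  rewrite ler_pdivlMr ?mulr_gt0 //.
  have := sqr_ge0 (X' - `|a'|); rewrite -[a' ^+ 2]real_normK ?num_real //; lra.
have h2 : a * a' <= X * `|a'|.
  by apply: (le_trans (ler_norm _)); rewrite normrM; apply: ler_wpM2r.
have := ler_wpM2l X0 h; lra.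
Qed.

Let T := s' ^+ 2 + eta' / s'.

Let T_le : T <= 2 * D ^+ 8.
Proof.
have s0 : 0 < s' by [].
have h1 : s' ^+ 2 <= D ^+ 8.
  have -> : D ^+ 8 = (D ^+ 4) ^+ 2 by rewrite -exprM.
  rewrite ler_sqr ?nnegrE ?exprn_ge0 ?(ltW s0) ?(ltW D_gt0) //.
  exact: (size_at_le qx').
have h2 : eta' / s' <= 1 by rewrite ler_pdivrMr // mul1r; exact: (size_at_ge_Im qx').
have h3 : 1 <= D ^+ 8 by rewrite exprn_ege1.
by rewrite /T; lra.
Qed.

(** The points enter asymmetrically. At [x] only a subsolution with factor 1 is required, so [x] may
    be the value at [E0], where [size_at] is 0. The whole gain comes from [x']: s'^2 through the
    phase, eta' / s' through the norm of the kernel. *)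
Lemma two_point_bound j :
  (s' ^+ 2 + eta' / s') * normc (x j - x' j) <= two_point_const * normc (z - z').
Proof.
rewrite -/T.
have s0 : 0 < s' by [].
pose dl := s' ^+ 2 / (2 * D ^+ 8).
have D8 : 0 < D ^+ 8 by rewrite exprn_gt0.
have dl_ge0 : 0 <= dl by rewrite divr_ge0 ?sqr_ge0 // mulr_ge0 // ltW.
have T_ge0 : 0 <= T by rewrite /T addr_ge0 ?sqr_ge0 // divr_ge0 ?(qve_at_z qx') // ltW.
pose g0 := (D ^+ 19)^-1.
have D19 : 0 < D ^+ 19 by rewrite exprn_gt0.
have g0_gt0 : 0 < g0 by rewrite invr_gt0.
have g0_le1 : g0 <= 1 by rewrite invf_le1 // exprn_ege1.
have g0E : g0 <= (D ^+ 3)^-1 * (D ^+ 4)^-1 ^+ 2 / (D ^+ 4) ^+ 2.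
  by rewrite le_eqVlt; apply/orP; left; apply/eqP; rewrite /g0; field; rewrite gt_eqF.
have kappa1 : 1 - theta / 2 <= 1 by move: theta_ge0; lra.
have D3 : 0 < (D ^+ 3)^-1 by rewrite invr_gt0 exprn_gt0.
have wr k : normc ((rt k)%:C * (z - z')) <= D * normc (z - z').
  rewrite normcM normc_real ger0_norm ?(ltW (rt_gt0 k)) //.
  by apply: ler_wpM2r; [exact: normc_ge0 | have /andP[] := rt_bnd k].
have := rotation_bound D3 D4 N_gt0 symA A_ge gt_bnd Agt kappa1 g0_gt0 g0_le1 g0E dl_ge0
  U1 ReU wE wr.
set sw := \sum_k normc (w k) => hw.
have sw_ge0 : 0 <= sw by apply: sumr_ge0 => k _; exact: normc_ge0.
have T_small : T / (2 * D ^+ 8) <= dl + (1 - (1 - theta / 2)).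
  have -> : dl + (1 - (1 - theta / 2)) = dl + theta / 2 by ring.
  rewrite /T mulrDl lerD2l.
  have -> : theta / 2 = eta' / s' * (2 * D ^+ 5)^-1 by rewrite /theta; field; rewrite !gt_eqF.
  apply: ler_wpM2l; first by rewrite divr_ge0 ?(qve_at_z qx') // ltW.
  rewrite lef_pV2 ?posrE ?mulr_gt0 ?exprn_gt0 // ler_pM2l //.
  by rewrite ler_weXn2l.
have hT : T * sw <= 2 * D ^+ 8 * ((4 * D ^+ 19 + 1) * (N%:R * (D * normc (z - z')))).
  have := le_trans (ler_wpM2r sw_ge0 T_small) hw.
  rewrite mulrAC ler_pdivrMr ?mulr_gt0 // mulrC /g0 invrK.
  by move=> h; apply: (le_trans h); rewrite le_eqVlt; apply/orP; left; apply/eqP; ring.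
(* [rotation_bound] controls only a sum over indices; reinserting it into the equation for [d]
   recovers a single entry. *)
have dj : normc (d j) <= D ^+ 2 * normc (z - z') + D ^+ 4 / N%:R * sw.
  rewrite dE normcM.
  have hx : normc (x j * x' j) <= D ^+ 2.
    rewrite normcM expr2; apply: ler_pM; rewrite ?normc_ge0 //.
      by have /andP[] := qve_at_bnd qx j.
    by have /andP[] := qve_at_bnd qx' j.
  have hS : normc (apply_cmx S d j) <= D ^+ 2 / N%:R * sw.
    apply: (le_trans (normc_sum _ _ _)); rewrite mulr_sumr; apply: ler_sum => k _.
    have -> : d k = (rt k)%:C * w k.
      by rewrite /w mulrA -rmorphM /= mulfV ?mul1r // gt_eqF.
    rewrite normcM normc_real (ger0_norm (S_ge0 j k)) normcM normc_real.
    rewrite (ger0_norm (ltW (rt_gt0 k))) mulrA.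
    apply: ler_wpM2r; first exact: normc_ge0.
    have -> : D ^+ 2 / N%:R = D / N%:R * D by ring.
    have /andP[_ h1] := S_bnd j k; have /andP[_ h2] := rt_bnd k.
    by apply: ler_pM => //; exact: ltW.
  apply: (@le_trans _ _ (D ^+ 2 * (normc (z - z') + D ^+ 2 / N%:R * sw))).
    apply: ler_pM; rewrite ?normc_ge0 //.
    by apply: (le_trans (normcD _ _)); rewrite lerD2l.
  by rewrite le_eqVlt; apply/orP; left; apply/eqP; ring.
apply: (le_trans (ler_wpM2l T_ge0 dj)).
have h1 : T * (D ^+ 2 * normc (z - z')) <= 2 * D ^+ 8 * (D ^+ 2 * normc (z - z')).
  by apply: ler_wpM2r => //; rewrite mulr_ge0 ?normc_ge0 // exprn_ge0 // ltW.
have h2 : T * (D ^+ 4 / N%:R * sw) <=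
   D ^+ 4 / N%:R * (2 * D ^+ 8 * ((4 * D ^+ 19 + 1) * (N%:R * (D * normc (z - z'))))).
  rewrite mulrCA; apply: ler_wpM2l => //.
  by rewrite divr_ge0 ?ler0n // exprn_ge0 // ltW.
rewrite mulrDr; apply: (le_trans (lerD h1 h2)).
rewrite le_eqVlt; apply/orP; left; apply/eqP; rewrite /two_point_const.
by field; rewrite gt_eqF.
Qed.

(* [(t + e)^3 >= t e^2] with [t = s'^2] and [e = eta' / s']. *)
Lemma two_point_cubic j : normc (x j - x' j) ^+ 3 * complex.Im z' ^+ 2 <=
  two_point_const ^+ 3 * normc (z - z') ^+ 3.
Proof.
have h := two_point_bound j.
have s0 : 0 < s' by [].
have e0 : 0 <= eta' / s' by rewrite divr_ge0 ?(qve_at_z qx') // ltW.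
have T_ge0 : 0 <= s' ^+ 2 + eta' / s' by rewrite addr_ge0 ?sqr_ge0.
have T3 : eta' ^+ 2 <= (s' ^+ 2 + eta' / s') ^+ 3.
  have -> : eta' ^+ 2 = s' ^+ 2 * (eta' / s') ^+ 2 by field; rewrite gt_eqF.
  have : 0 <= s' ^+ 2 by exact: sqr_ge0.
  move: e0; move: (eta' / s') (s' ^+ 2) => e t e0 t0.
  have e2 : 0 <= e ^+ 2 := sqr_ge0 _; have e3 : 0 <= e ^+ 3 by exact: exprn_ge0.
  have t3 : 0 <= t ^+ 3 by exact: exprn_ge0.
  have te2 : 0 <= t * e ^+ 2 by rewrite mulr_ge0.
  have t2e : 0 <= t ^+ 2 * e by rewrite mulr_ge0 // sqr_ge0.
  have -> : (t + e) ^+ 3 = t ^+ 3 + 3 * (t ^+ 2 * e) + 3 * (t * e ^+ 2) + e ^+ 3 by ring.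
  lra.
rewrite -exprMn mulrC.
apply: (@le_trans _ _ (((s' ^+ 2 + eta' / s') * normc (x j - x' j)) ^+ 3)).
  by rewrite exprMn; apply: ler_wpM2r => //; rewrite exprn_ge0 // normc_ge0.
rewrite ler_pXn2r // nnegrE; first by rewrite mulr_ge0 // normc_ge0.
by apply: le_trans h; rewrite mulr_ge0 // normc_ge0.
Qed.

End TwoPoints.
End QveAt.
(** * Stability of the positive eigenvector and the 1/3-Hoelder bound *)

Section Eigenvector.
Context {R : realType} {N : nat}.
Variables (D : R) (S : 'M[R]_N).
Hypotheses (D_ge1 : 1 <= D) (N_gt0 : (0 < N)%N).
Hypothesis symS : forall j k, S j k = S k j.
Hypothesis S_bnd : forall j k, D^-1 / N%:R <= S j k <= D / N%:R.

Let D_gt0 : 0 < D. Proof. exact: lt_le_trans D_ge1. Qed.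
Let nN : 0 < N%:R :> R. Proof. by rewrite ltr0n. Qed.

Lemma mS_sym (x : 'I_N -> R[i]) j k : mS S x j k = mS S x k j.
Proof. by rewrite !mxE symS; ring. Qed.

Lemma mS_bounds (x : 'I_N -> R[i]) : (forall j, D^-1 <= normc (x j) <= D) ->
  forall j k, (D ^+ 3)^-1 / N%:R <= mS S x j k <= D ^+ 3 / N%:R.
Proof.
move=> xb j k; rewrite mxE.
have /andP[h1 h1'] := xb j; have /andP[h2 h2'] := xb k.
have /andP[h3 h3'] := S_bnd j k.
have Di : 0 <= D^-1 by rewrite invr_ge0 ltW.
have Dn : 0 <= D^-1 / N%:R by rewrite divr_ge0 // ler0n.
have S0 : 0 <= S j k := le_trans Dn h3.
have -> : (D ^+ 3)^-1 / N%:R = D^-1 * (D^-1 / N%:R) * D^-1 by field; rewrite !gt_eqF.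
have -> : D ^+ 3 / N%:R = D * (D / N%:R) * D by field; rewrite !gt_eqF.
by rewrite !ler_pM ?mulr_ge0 ?normc_ge0.
Qed.

Lemma norm_sum_le (F : 'I_N -> R) (r : R) : (forall j, `|F j| <= r) ->
  `|\sum_j F j| <= N%:R * r.
Proof.
move=> h; apply: (le_trans (ler_norm_sum _ _ _)).
have -> : N%:R * r = \sum_(j < N) r by rewrite sumr_const card_ord mulr_natl.
exact: ler_sum.
Qed.

Lemma normc_dist (u v : R[i]) : `|normc u - normc v| <= normc (u - v).
Proof.
rewrite ler_norml; apply/andP; split.
  rewrite lerNl opprB lerBlDr -[normc (u - v)]normcN opprB.
  by rewrite -[in leLHS](subrK u v); exact: normcD.
by rewrite lerBlDr -[in leLHS](subrK v u); exact: normcD.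
Qed.

Lemma mS_diff_bound (hi eps : R) (x y : 'I_N -> R[i]) (G : 'I_N -> R) :
  (forall j, D^-1 <= normc (x j) <= D) -> (forall j, D^-1 <= normc (y j) <= D) ->
  (forall j, normc (y j - x j) <= eps) -> (forall j, `|G j| <= hi) ->
  forall j, `|apply_mx (mS S x) G j - apply_mx (mS S y) G j| <= 2 * D ^+ 2 * hi * eps.
Proof.
move=> x_bnd y_bnd xy G_bnd j.
have nxy i := le_trans (normc_dist (y i) (x i)) (xy i).
rewrite /apply_mx -sumrB.
have -> : 2 * D ^+ 2 * hi * eps = N%:R * (D / N%:R * (2 * D * eps) * hi).
  by field; rewrite gt_eqF.
apply: norm_sum_le => k; rewrite -mulrBl normrM !mxE.
apply: ler_pM => //.
have -> : normc (x j) * S j k * normc (x k) - normc (y j) * S j k * normc (y k) =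
  - (S j k * ((normc (y j) - normc (x j)) * normc (y k) + normc (x j) * (normc (y k) - normc (x k)))).
  by ring.
have Dn : 0 <= D^-1 / N%:R by rewrite divr_ge0 ?invr_ge0 ?ler0n // ltW.
have /andP[h3 h3'] := S_bnd j k.
have S0 : 0 <= S j k := le_trans Dn h3.
rewrite normrN normrM (ger0_norm S0); apply: ler_pM => //.
apply: (le_trans (ler_normD _ _)); rewrite !normrM !(ger0_norm (normc_ge0 _)).
have -> : 2 * D * eps = eps * D + D * eps by ring.
have /andP[_ h1] := x_bnd j; have /andP[_ h2] := y_bnd k.
by apply: lerD; apply: ler_pM; rewrite ?normc_ge0.
Qed.

Section Close.
Variables (lo hi eps mu c : R) (x y : 'I_N -> R[i]) (g G : 'I_N -> R).
Hypotheses (lo_gt0 : 0 < lo) (mu_ge0 : 0 <= mu).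
Hypothesis x_bnd : forall j, D^-1 <= normc (x j) <= D.
Hypothesis y_bnd : forall j, D^-1 <= normc (y j) <= D.
Hypothesis xy : forall j, normc (y j - x j) <= eps.
Hypothesis g_bnd : forall j, lo <= g j <= hi.
Hypothesis G_bnd : forall j, `|G j| <= hi.
Hypothesis mSg : forall j, apply_mx (mS S x) g j = g j.
Hypothesis mSG : forall j, apply_mx (mS S y) G j = G j - mu * normc (y j).
Hypothesis g_avg : \sum_j normc (x j) * g j = c.
Hypothesis G_avg : \sum_j normc (y j) * G j = c.

Definition defect_const : R := 2 * D ^+ 4 * hi ^+ 2 / lo + 2 * D ^+ 2 * hi.
Definition perp_const : R := 1 + D ^+ 3 / ((D ^+ 3)^-1 * lo ^+ 2 / hi ^+ 2).
(** The first summand bounds the error in the coefficient along [g], the second the component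
    orthogonal to [g]. *)
Definition close_const : R :=
  D / lo * (hi + D * (perp_const * defect_const)) * hi + perp_const * defect_const.

Let hi_gt0 : 0 < hi.
Proof. by have /andP[p q] := g_bnd (Ordinal N_gt0); exact: lt_le_trans lo_gt0 (le_trans p q). Qed.
Let g_gt0 j : 0 < g j.
Proof. by have /andP[h _] := g_bnd j; apply: lt_le_trans h. Qed.

Let nxy j : `|normc (y j) - normc (x j)| <= eps.
Proof. exact: le_trans (normc_dist _ _) (xy j). Qed.

Let E j := apply_mx (mS S x) G j - apply_mx (mS S y) G j.

Let E_le j : `|E j| <= 2 * D ^+ 2 * hi * eps.
Proof. exact: mS_diff_bound. Qed.

Let al := (\sum_j g j * G j) / (\sum_j g j * g j).
Let v j := G j - al * g j.

Let gg_gt0 : 0 < \sum_j g j * g j.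
Proof.
rewrite (bigD1 (Ordinal N_gt0)) //= ltr_wpDr ?mulr_gt0 //.
by apply: sumr_ge0 => j _; rewrite mulr_ge0 // ltW.
Qed.

Let gv : \sum_j g j * v j = 0.
Proof.
have -> : \sum_j g j * v j = \sum_j g j * G j - al * \sum_j g j * g j.
  by rewrite mulr_sumr -sumrB; apply: eq_bigr => j _; rewrite /v; ring.
by rewrite /al divfK ?subrr // gt_eqF.
Qed.

Let vE j : v j - apply_mx (mS S x) v j = mu * normc (y j) - E j.
Proof.
rewrite /v apply_mxB apply_mxZ mSg.
have : apply_mx (mS S y) G j = G j - mu * normc (y j) by [].
by rewrite /E => ->; ring.
Qed.

(** [mu] is not assumed small. Pairing the equation for [v] with [g] annihilates its left side and
    equates [mu] times a positive mean with the mean of [g E], which is of order [eps]. *)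
Let mu_le : mu <= 2 * D ^+ 3 * hi ^+ 2 / lo * eps.
Proof.
have h0 : \sum_j g j * (v j - apply_mx (mS S x) v j) = 0.
  under eq_bigr do rewrite mulrBr.
  rewrite sumrB gv apply_mx_sym; last exact: mS_sym.
  by under eq_bigr do rewrite mSg; rewrite gv subrr.
have h1 : mu * (\sum_j g j * normc (y j)) = \sum_j g j * E j.
  apply: subr0_eq; rewrite mulr_sumr -sumrB -[RHS]h0.
  by apply: eq_bigr => j _; rewrite vE; ring.
have h2 : N%:R * (lo / D) <= \sum_j g j * normc (y j).
  have -> : N%:R * (lo / D) = \sum_(j < N) lo / D by rewrite sumr_const card_ord mulr_natl.
  apply: ler_sum => j _; have /andP[a1 _] := g_bnd j; have /andP[a2 _] := y_bnd j.
  by apply: ler_pM => //; rewrite ?invr_ge0 ltW.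
have h3 : \sum_j g j * E j <= N%:R * (hi * (2 * D ^+ 2 * hi * eps)).
  apply: (le_trans (ler_norm _)); apply: norm_sum_le => j; rewrite normrM.
  apply: ler_pM => //; rewrite ger0_norm ?(ltW (g_gt0 j)) //.
  by have /andP[] := g_bnd j.
have h4 := le_trans (ler_wpM2l mu_ge0 h2); rewrite h1 in h4; have {}h4 := h4 _ h3.
have -> : 2 * D ^+ 3 * hi ^+ 2 / lo * eps =
    (N%:R * (hi * (2 * D ^+ 2 * hi * eps))) / (N%:R * (lo / D)).
  by field; rewrite !gt_eqF.
by rewrite ler_pdivlMr // mulr_gt0 // divr_gt0.
Qed.

Let v_le j : `|v j| <= perp_const * (defect_const * eps).
Proof.
have D3 : 0 < (D ^+ 3)^-1 by rewrite invr_gt0 exprn_gt0.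
apply: (@perp_sup_bound _ _ _ lo hi 1 (mS S x) g D3 lo_gt0 N_gt0) => //.
- exact: mS_sym.
- by move=> i k; have /andP[] := mS_bounds x_bnd i k.
- by move=> i; rewrite mSg mul1r.
- by move=> i k; have /andP[] := mS_bounds x_bnd i k.
move=> i; rewrite vE; apply: (le_trans (ler_normB _ _)).
have -> : defect_const * eps = 2 * D ^+ 3 * hi ^+ 2 / lo * eps * D + 2 * D ^+ 2 * hi * eps.
  by rewrite /defect_const; field; rewrite gt_eqF.
apply: lerD => //; rewrite normrM (ger0_norm mu_ge0) (ger0_norm (normc_ge0 _)).
by apply: ler_pM => //; [exact: normc_ge0 | have /andP[] := y_bnd i].
Qed.

(** Decompose [G = al g + v]: the gap makes [v] of order [eps], and the common normalization [c]
    forces [al - 1] to be of that order too. *)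
Lemma eigenvector_close j : `|G j - g j| <= close_const * eps.
Proof.
set ce := perp_const * (defect_const * eps).
have al_le : `|al - 1| <= D / lo * (hi * eps + D * ce).
  have h1 : (al - 1) * (\sum_j normc (y j) * g j) =
     \sum_j ((normc (x j) - normc (y j)) * g j - normc (y j) * v j).
    have -> : \sum_j ((normc (x j) - normc (y j)) * g j - normc (y j) * v j) =
       \sum_j normc (x j) * g j - \sum_j normc (y j) * G j
       + (al - 1) * \sum_j normc (y j) * g j.
      by rewrite mulr_sumr -sumrB -big_split; apply: eq_bigr => i _ /=; rewrite /v; ring.
    by rewrite g_avg G_avg subrr add0r.
  have h2 : N%:R * (lo / D) <= \sum_j normc (y j) * g j.
    have -> : N%:R * (lo / D) = \sum_(j < N) lo / D by rewrite sumr_const card_ord mulr_natl.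
    apply: ler_sum => i _; rewrite mulrC.
    have /andP[a1 _] := g_bnd i; have /andP[a2 _] := y_bnd i.
    by rewrite [leRHS]mulrC mulrC; apply: ler_pM => //; rewrite ?invr_ge0 ltW.
  have h3 : `|(al - 1) * (\sum_j normc (y j) * g j)| <= N%:R * (hi * eps + D * ce).
    rewrite h1; apply: norm_sum_le => i.
    apply: (le_trans (ler_normB _ _)); rewrite !normrM; apply: lerD.
      rewrite mulrC; apply: ler_pM => //; last by rewrite distrC.
      by rewrite ger0_norm ?(ltW (g_gt0 i)) //; have /andP[] := g_bnd i.
    rewrite (ger0_norm (normc_ge0 _)); apply: ler_pM; rewrite ?normc_ge0 //.
    by have /andP[] := y_bnd i.
  move: h3; rewrite normrM => h3.
  have h4 : `|al - 1| * (N%:R * (lo / D)) <= N%:R * (hi * eps + D * ce).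
    apply: le_trans h3; apply: ler_wpM2l => //.
    by apply: (le_trans h2); exact: ler_norm.
  have -> : D / lo * (hi * eps + D * ce) = (N%:R * (hi * eps + D * ce)) / (N%:R * (lo / D)).
    by field; rewrite !gt_eqF.
  by rewrite ler_pdivlMr // mulr_gt0 // divr_gt0.
have -> : G j - g j = (al - 1) * g j + v j by rewrite /v; ring.
apply: (le_trans (ler_normD _ _)).
have -> : close_const * eps = D / lo * (hi * eps + D * ce) * hi + ce.
  by rewrite /close_const /ce; ring.
apply: lerD => //; rewrite normrM; apply: ler_pM => //.
by rewrite ger0_norm ?(ltW (g_gt0 j)) //; have /andP[] := g_bnd j.
Qed.

End Close.

Definition Imean (x : 'I_N -> R[i]) : R := N%:R^-1 * \sum_j complex.Im (x j).
(** [phase] divided by the mean of Im x alone, so that the weighted sum in [gvec_avg] is exactly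
    [N]. Up to the factor pi this is the quantity whose limit is [fvec]. *)
Definition gvec (x : 'I_N -> R[i]) (j : 'I_N) : R :=
  complex.Im (x j) / (normc (x j) * Imean x).

Section Gvec.
Variables (z : R[i]) (x : 'I_N -> R[i]).
Hypothesis qx : qve_at D S z x.
Let Ibar := Imean x.
Hypothesis I_gt0 : 0 < Ibar.

Let s_gt0 : 0 < size_at z x.
Proof. by apply: (lt_le_trans I_gt0); rewrite lerDr (qve_at_z qx). Qed.

Lemma size_at_le_Imean : size_at z x <= D ^+ 3 * Imean x.
Proof.
rewrite -ler_pdivrMl ?exprn_gt0 // mulrC /Imean -ler_pdivrMl ?invr_gt0 // invrK.
have -> : N%:R * (size_at z x / D ^+ 3) = \sum_(j < N) size_at z x / D ^+ 3.
  by rewrite sumr_const card_ord mulr_natl.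
by apply: ler_sum => j _; have /andP[] := qve_Im_bounds D_ge1 S_bnd qx j.
Qed.

Let gvecE j : gvec x j = phase z x j * (size_at z x / Ibar).
Proof.
by rewrite /gvec /phase -/Ibar; field; rewrite !gt_eqF // (qve_normc_gt0 D_ge1 qx).
Qed.

Lemma gvec_bounds j : (D ^+ 4)^-1 <= gvec x j <= D ^+ 7.
Proof.
have /andP[h1 h2] := phase_bounds D_ge1 S_bnd qx s_gt0 j.
have h3 : 1 <= size_at z x / Ibar.
  by rewrite ler_pdivlMr // mul1r lerDr (qve_at_z qx).
have h4 : size_at z x / Ibar <= D ^+ 3.
  by rewrite ler_pdivrMr //; exact: size_at_le_Imean.
have h0 : 0 <= (D ^+ 4)^-1 by rewrite invr_ge0 exprn_ge0 // ltW.
rewrite gvecE; apply/andP; split.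
  by apply: (le_trans h1); apply: ler_peMr => //; exact: le_trans h1.
have -> : D ^+ 7 = D ^+ 4 * D ^+ 3 by rewrite -exprD.
by apply: ler_pM => //; [exact: le_trans h1 | exact: le_trans h3].
Qed.

Lemma gvec_bounds_real j : complex.Im z = 0 -> (D ^+ 4)^-1 <= gvec x j <= D ^+ 4.
Proof.
move=> z0; have := phase_bounds D_ge1 S_bnd qx s_gt0 j.
by rewrite gvecE /size_at z0 add0r mulfV ?mulr1 // gt_eqF.
Qed.

Lemma mS_gvec j : apply_mx (mS S x) (gvec x) j =
  gvec x j - complex.Im z / Imean x * normc (x j).
Proof.
have -> : apply_mx (mS S x) (gvec x) j =
   (size_at z x / Ibar) * apply_mx (mS S x) (phase z x) j.
  by rewrite -apply_mxZ; apply: eq_bigr => k _; rewrite gvecE [X in _ * X]mulrC.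
rewrite (mS_phase D_ge1 qx s_gt0) gvecE -/Ibar.
by field; rewrite !gt_eqF.
Qed.

Lemma gvec_avg : \sum_j normc (x j) * gvec x j = N%:R.
Proof.
have -> : \sum_j normc (x j) * gvec x j = (\sum_j complex.Im (x j)) / Ibar.
  rewrite mulr_suml; apply: eq_bigr => j _; rewrite /gvec -/Ibar.
  by field; rewrite !gt_eqF // (qve_normc_gt0 D_ge1 qx).
have e : \sum_j complex.Im (x j) = N%:R * Ibar.
  by rewrite /Ibar /Imean mulrA mulfV ?mul1r // gt_eqF.
by rewrite e mulfK // gt_eqF.
Qed.

End Gvec.

(** Gives access to the real axis, where [qve_solution] provides continuity but no equation. *)
Lemma qve_at_closed z x :
  (forall e : R, 0 < e -> exists z' x', [/\ qve_at D S z' x',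
      normc (z - z') <= e & forall j, normc (x j - x' j) <= e]) ->
  qve_at D S z x.
Proof.
move=> H.
have le_eps (u v C : R) : (forall e, 0 < e -> e <= 1 -> u <= v + C * e) -> u <= v.
  move=> h; apply/ler_addgt0Pr => e e0.
  pose C' := `|C| + 1; have C'0 : 0 < C' by rewrite ltr_pwDr.
  pose e1 := Num.min 1 (e / C').
  have e10 : 0 < e1 by rewrite lt_min ltr01 divr_gt0.
  have := h e1 e10; rewrite ge_min lexx => /(_ isT) h1.
  apply: (le_trans h1); rewrite lerD2l.
  apply: (@le_trans _ _ (C' * e1)).
    by apply: ler_wpM2r; [exact: ltW | rewrite /C'; apply: (le_trans (ler_norm _)); rewrite lerDl].
  by rewrite -ler_pdivlMl // mulrC ge_min lexx orbT.
split.
- move=> j; apply/eqP; rewrite -addr_eq0; apply/eqP/eq0_normc/eqP.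
  rewrite eq_le normc_ge0 andbT.
  apply: (le_eps _ _ (normc z + 1 + D * D + normc (x j) * (1 + D))) => e e0 e1.
  have [z' [x' [q' hz hx]]] := H e e0.
  have Dn : 0 <= D^-1 / N%:R by rewrite divr_ge0 ?invr_ge0 ?ler0n // ltW.
  have ap (w : 'I_N -> R[i]) (r : R) : (forall k, normc (w k) <= r) ->
      normc (apply_cmx S w j) <= D * r.
    move=> hw; apply: (le_trans (normc_sum _ _ _)).
    have -> : D * r = \sum_(k < N) D / N%:R * r.
      by rewrite sumr_const card_ord -mulr_natl; field; rewrite gt_eqF.
    apply: ler_sum => k _; have /andP[s1 s2] := S_bnd j k.
    have s0 := le_trans Dn s1.
    by rewrite normcM normc_real ger0_norm //; apply: ler_pM; rewrite ?normc_ge0.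
  (* The 1 is traded for [- x' j * (z' + apply_cmx S x' j)], so that each term carries a small
     difference. *)
  have -> : x j * (z + apply_cmx S x j) + 1 =
     (x j - x' j) * (z' + apply_cmx S x' j) +
     x j * ((z - z') + apply_cmx S (fun k => x k - x' k) j).
    have -> : apply_cmx S (fun k => x k - x' k) j = apply_cmx S x j - apply_cmx S x' j.
      by rewrite /apply_cmx -sumrB; apply: eq_bigr => k _; rewrite mulrBr.
    transitivity (x j * (z + apply_cmx S x j) - x' j * (z' + apply_cmx S x' j)); last by ring.
    by rewrite (qve_at_eq q') opprK.
  rewrite add0r.
  have -> : (normc z + 1 + D * D + normc (x j) * (1 + D)) * e =
     e * (normc z + 1 + D * D) + normc (x j) * (e + D * e) by ring.
  apply: (le_trans (normcD _ _)); rewrite !normcM; apply: lerD.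
    apply: ler_pM; rewrite ?normc_ge0 //; apply: (le_trans (normcD _ _)); apply: lerD.
      have -> : z' = z - (z - z') by ring.
      by apply: (le_trans (normcB _ _)); rewrite lerD2l (le_trans hz).
    by apply: ap => k; have /andP[] := qve_at_bnd q' k.
  apply: ler_pM; rewrite ?normc_ge0 //; apply: (le_trans (normcD _ _)).
  by apply: lerD => //; exact: ap.
- move=> j; apply/andP; split.
    apply: (le_eps _ _ 1) => e e0 _; have [z' [x' [q' hz hx]]] := H e e0.
    have /andP[h _] := qve_at_bnd q' j; apply: (le_trans h).
    have -> : x' j = x j - (x j - x' j) by ring.
    by apply: (le_trans (normcB _ _)); rewrite mul1r lerD2l.
  apply: (le_eps _ _ 1) => e e0 _; have [z' [x' [q' hz hx]]] := H e e0.
  have /andP[_ h] := qve_at_bnd q' j.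
  have -> : x j = x' j + (x j - x' j) by ring.
  by apply: (le_trans (normcD _ _)); rewrite mul1r lerD.
- move=> j; apply: (le_eps _ _ 1) => e e0 _; have [z' [x' [q' hz hx]]] := H e e0.
  apply: (le_trans (qve_at_Im q' j)).
  have := le_trans (ler_norm _) (le_trans (normc_Im _) (hx j)).
  have := normc_Im (x j - x' j); rewrite cImD cImN => h.
  by have := le_trans h (hx j); rewrite ler_norml => /andP[+ _]; lra.
apply: (le_eps _ _ 1) => e e0 _; have [z' [x' [q' hz hx]]] := H e e0.
apply: (le_trans (qve_at_z q')).
have := normc_Im (z - z'); rewrite cImD cImN => h.
by have := le_trans h hz; rewrite ler_norml => /andP[+ _]; lra.
Qed.

(* The point [w] lies high above the real axis compared with its distance to
   [z] and to [E0], so that [two_point_cubic] applies to both pairs. *)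
Lemma holder_third (z w : R[i]) (E0 t : R) (x y x0 : 'I_N -> R[i]) (g : 'I_N -> R) :
  0 < t -> normc (z - E0%:C) = t -> w = z + (0 +i* t) -> 0 < complex.Im z ->
  qve_at D S z x -> qve_at D S w y -> qve_at D S E0%:C x0 ->
  (forall j, (D ^+ 4)^-1 <= g j <= D ^+ 4) ->
  (forall j, apply_mx (mS S x0) g j <= g j) ->
  forall j, normc (x j - x0 j) ^+ 3 <= 36 * two_point_const D ^+ 3 * t.
Proof.
move=> t_gt0 zt wE z_gt0 qx qy q0 g_bnd mSg j.
have w_ge : t <= complex.Im w by rewrite wE cImD /= lerDr ltW.
have avg_ge0 u v : qve_at D S u v -> complex.Im u <= size_at u v.
  by move=> q; exact: size_at_ge_Im q.
have sz : 0 < size_at z x by apply: lt_le_trans (avg_ge0 _ _ qx).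
have sw : 0 < size_at w y by apply: lt_le_trans (avg_ge0 _ _ qy); exact: lt_le_trans w_ge.
have C3 : 0 <= two_point_const D ^+ 3.
  by rewrite exprn_ge0 // /two_point_const !(addr_ge0, mulr_ge0) // ?exprn_ge0 // ltW.
have w2 : t ^+ 2 <= complex.Im w ^+ 2.
  by rewrite ler_sqr // nnegrE ltW // (lt_le_trans t_gt0).
have t2 : 0 < t ^+ 2 by rewrite exprn_gt0.
have nit : normc (0 +i* t) = t by rewrite /= expr0n /= add0r sqrtr_sqr gtr0_norm.
have key u v h r : qve_at D S u v -> (forall j, (D ^+ 4)^-1 <= h j <= D ^+ 4) ->
   (forall j, apply_mx (mS S v) h j <= h j) -> normc (u - w) <= r * t -> 0 <= r ->
   normc (v j - y j) ^+ 3 <= r ^+ 3 * two_point_const D ^+ 3 * t.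
  move=> qv hb hm huw r0.
  have := two_point_cubic D_ge1 N_gt0 symS S_bnd qv qy hb hm sw j => h1.
  rewrite -(ler_pM2r t2); apply: (@le_trans _ _ (normc (v j - y j) ^+ 3 * complex.Im w ^+ 2)).
    by apply: ler_wpM2l => //; rewrite exprn_ge0 ?normc_ge0.
  apply: (le_trans h1).
  have -> : r ^+ 3 * two_point_const D ^+ 3 * t * t ^+ 2 = two_point_const D ^+ 3 * (r * t) ^+ 3.
    by ring.
  apply: ler_wpM2l => //; rewrite ler_pXn2r // nnegrE ?normc_ge0 //.
  by rewrite mulr_ge0 // ltW.
have b1 : normc (x j - y j) ^+ 3 <= 1 ^+ 3 * two_point_const D ^+ 3 * t.
  apply: (key z x (phase z x)) => //.
  - exact: (phase_bounds D_ge1 S_bnd qx).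
  - move=> k; apply: (le_trans (mS_phase_le D_ge1 S_bnd qx sz k)).
    have /andP[p _] := phase_bounds D_ge1 S_bnd qx sz k.
    apply: ler_piMl; first by apply: le_trans p; rewrite invr_ge0 exprn_ge0 // ltW.
    rewrite gerBl; apply: divr_ge0; first exact: ltW.
    by apply: mulr_ge0; [apply: exprn_ge0|]; exact: ltW.
  - by rewrite wE opprD addrA subrr add0r normcN nit mul1r.
have b2 : normc (x0 j - y j) ^+ 3 <= 2 ^+ 3 * two_point_const D ^+ 3 * t.
  apply: (key E0%:C x0 g) => //.
  have -> : E0%:C - w = - ((z - E0%:C) + (0 +i* t)) by rewrite wE; ring.
  by rewrite normcN; apply: (le_trans (normcD _ _)); rewrite zt nit; lra.
have b3 : normc (x j - x0 j) <= normc (x j - y j) + normc (x0 j - y j).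
  by apply: (le_trans (normc_triangle _ (y j) _)); rewrite lerD2l -normcN opprB.
(* The 36 is 4 (1^3 + 2^3): [w] is at distance [t] from [z] and at most [2 t] from [E0]. *)
have cube (a b : R) : 0 <= a -> 0 <= b -> (a + b) ^+ 3 <= 4 * (a ^+ 3 + b ^+ 3).
  move=> a0 b0; rewrite -subr_ge0.
  have -> : 4 * (a ^+ 3 + b ^+ 3) - (a + b) ^+ 3 = 3 * ((a + b) * (a - b) ^+ 2) by ring.
  by rewrite mulr_ge0 // mulr_ge0 ?sqr_ge0 // addr_ge0.
apply: (@le_trans _ _ ((normc (x j - y j) + normc (x0 j - y j)) ^+ 3)).
  by rewrite ler_pXn2r // nnegrE ?addr_ge0 ?normc_ge0.
apply: (le_trans (cube _ _ (normc_ge0 _) (normc_ge0 _))).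
lra.
Qed.

End Eigenvector.
(** * Expansion of the small eigenvalue *)

Section BigO.
Context {R : realType}.
Implicit Types (c e : R) (x y : R[i]) (n : nat).

(** An explicit constant replaces an asymptotic relation since bounds must be uniform in [N]. Proofs
    below mostly leave [c] to unification, under quantifiers that make it depend only on parameters
    fixed before [N]. *)
Definition bigOn e c n x : Prop := normc x <= c * e ^+ n.

Lemma bigOnD e c c' n x y :
  bigOn e c n x -> bigOn e c' n y -> bigOn e (c + c') n (x + y).
Proof.
by move=> hx hy; rewrite /bigOn mulrDl; apply: (le_trans (normcD _ _)); exact: lerD.
Qed.

Lemma bigOnN e c n x : bigOn e c n x -> bigOn e c n (- x).
Proof. by rewrite /bigOn normcN. Qed.

Lemma bigOnB e c c' n x y :
  bigOn e c n x -> bigOn e c' n y -> bigOn e (c + c') n (x - y).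
Proof. by move=> hx hy; exact: bigOnD (bigOnN hy). Qed.

Lemma bigOnM e c c' n n' x y :
  bigOn e c n x -> bigOn e c' n' y -> bigOn e (c * c') (n + n') (x * y).
Proof.
move=> hx hy; rewrite /bigOn normcM exprD mulrACA.
by apply: ler_pM; rewrite ?normc_ge0.
Qed.

Lemma bigOnW e c n m x : 0 < e -> e <= 1 -> (n <= m)%N ->
  bigOn e c m x -> bigOn e c n x.
Proof.
move=> e0 e1 nm h; apply: (le_trans h).
have : 0 <= c * e ^+ m by apply: le_trans h; exact: normc_ge0.
rewrite pmulr_lge0 ?exprn_gt0 // => c0.
by apply: ler_wpM2l => //; apply: ler_wiXn2l => //; exact: ltW.
Qed.

Lemma bigOn0 e c x : normc x <= c -> bigOn e c 0 x.
Proof. by rewrite /bigOn expr0 mulr1. Qed.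

End BigO.

(** * Normalized sums and the action of a real kernel on complex vectors *)

Section Mean.
Context {R : realType} {N : nat}.
Implicit Types u v : 'I_N -> R[i].

Definition cmean u : R[i] := N%:R^-1 * \sum_j u j.

Lemma cmeanD u v : cmean (fun j => u j + v j) = cmean u + cmean v.
Proof. by rewrite /cmean big_split mulrDr. Qed.

Lemma cmeanZ (a : R[i]) u : cmean (fun j => a * u j) = a * cmean u.
Proof. by rewrite /cmean -mulr_sumr mulrCA. Qed.

Lemma cmeanN u : cmean (fun j => - u j) = - cmean u.
Proof. by rewrite /cmean sumrN mulrN. Qed.

Lemma cmeanB u v : cmean (fun j => u j - v j) = cmean u - cmean v.
Proof. by rewrite cmeanD cmeanN. Qed.

Lemma eq_cmean u v : u =1 v -> cmean u = cmean v.
Proof. by move=> uv; rewrite /cmean; congr (_ * _); apply: eq_bigr. Qed.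

Lemma normc_natV : normc (N%:R^-1 : R[i]) = N%:R^-1.
Proof.
rewrite normcV; congr (_^-1).
by rewrite -[N%:R in LHS](rmorph_nat (real_complex R)) normc_real ger0_norm ?ler0n.
Qed.

Lemma bigOn_cmean e c n u : (0 < N)%N ->
  (forall j, bigOn e c n (u j)) -> bigOn e c n (cmean u).
Proof.
move=> N0 h; rewrite /bigOn /cmean normcM normc_natV.
rewrite ler_pdivrMl ?ltr0n //; apply: (le_trans (normc_sum _ _ _)).
have -> : N%:R * (c * e ^+ n) = \sum_(j < N) c * e ^+ n.
  by rewrite sumr_const card_ord mulr_natl.
by apply: ler_sum => j _; exact: h.
Qed.

Variable F : 'M[R]_N.

Lemma apply_cmxZ (a : R[i]) u j :
  apply_cmx F (fun k => a * u k) j = a * apply_cmx F u j.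
Proof. by rewrite /apply_cmx mulr_sumr; apply: eq_bigr => k _; rewrite mulrCA. Qed.

Lemma apply_cmxB u v j :
  apply_cmx F (fun k => u k - v k) j = apply_cmx F u j - apply_cmx F v j.
Proof. by rewrite /apply_cmx -sumrB; apply: eq_bigr => k _; rewrite mulrBr. Qed.

Lemma eq_apply_cmx u v : u =1 v -> apply_cmx F u =1 apply_cmx F v.
Proof. by move=> uv j; apply: eq_bigr => k _; rewrite uv. Qed.

Lemma bigOn_apply b e c n u j : (0 < N)%N -> (forall j k, `|F j k| <= b / N%:R) ->
  (forall k, bigOn e c n (u k)) -> bigOn e (b * c) n (apply_cmx F u j).
Proof.
move=> N0 hF h; apply: (le_trans (normc_sum _ _ _)).
have -> : b * c * e ^+ n = \sum_(k < N) (b / N%:R) * (c * e ^+ n).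
  by rewrite sumr_const card_ord -mulr_natl; field; rewrite pnatr_eq0 -lt0n.
apply: ler_sum => k _; rewrite normcM normc_real.
by apply: ler_pM => //; [exact: normc_ge0 | exact: h].
Qed.

Lemma cmean_apply_sym u v : (forall j k, F j k = F k j) ->
  cmean (fun j => u j * apply_cmx F v j) = cmean (fun j => apply_cmx F u j * v j).
Proof.
move=> symF; rewrite /cmean; congr (_ * _); rewrite /apply_cmx.
under eq_bigr do rewrite mulr_sumr.
rewrite exchange_big; apply: eq_bigr => k _ /=.
rewrite mulr_suml; apply: eq_bigr => j _.
by rewrite (symF j k) mulrCA mulrA.
Qed.

End Mean.

Section Expansion.
Context {R : realType}.

(** What the perturbation theory uses of the edge: [sd_gap] bounds the reduced resolvent in supremum
    norm, and [q] is that resolvent applied to the part of [p f^2] orthogonal to [f]. *)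
Record spectral_data (hi Cg b B : R) (N : nat) (F : 'M[R]_N)
    (f p q : 'I_N -> R[i]) (n2 sg : R[i]) : Prop := {
  sd_N : (0 < N)%N ;
  sd_sym : forall j k, F j k = F k j ;
  sd_F : forall j k, `|F j k| <= b / N%:R ;
  sd_f : forall j, normc (f j) <= hi ;
  sd_p : forall j, p j ^+ 2 = 1 ;
  sd_Ff : forall j, apply_cmx F f j = f j ;
  sd_n2 : cmean (fun j => f j * f j) = n2 ;
  sd_n2_neq0 : n2 != 0 ;
  sd_n2V : normc n2^-1 <= B ;
  sd_gap : forall (y : 'I_N -> R[i]) (r : R), cmean (fun j => f j * y j) = 0 ->
    (forall j, normc (y j - apply_cmx F y j) <= r) ->
    forall j, normc (y j) <= Cg * r ;
  sd_sg : cmean (fun j => p j * f j ^+ 3) = sg ;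
  sd_q_perp : cmean (fun j => f j * q j) = 0 ;
  sd_q : forall j, q j - apply_cmx F q j = p j * f j ^+ 2 - sg / n2 * f j }.

Variables (hi Cg b B : R).

Section Fixed.
Context {N : nat} {F : 'M[R]_N} {f p q : 'I_N -> R[i]} {n2 sg : R[i]}.
Hypothesis sd : spectral_data hi Cg b B F f p q n2 sg.

Lemma normc_p j : normc (p j) <= 1.
Proof.
have : normc (p j) ^+ 2 = 1 by rewrite -normcX (sd_p sd) normc1.
by move=> h; rewrite -(@ler_pXn2r _ 2) ?nnegrE ?normc_ge0 // h expr1n.
Qed.

Lemma cmean_f_range u : cmean (fun j => f j * (u j - apply_cmx F u j)) = 0.
Proof.
under eq_fun do rewrite mulrBr.
rewrite cmeanB cmean_apply_sym; last exact: sd_sym sd.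
by under [X in _ - cmean X]eq_fun do rewrite (sd_Ff sd); rewrite subrr.
Qed.

Lemma gap_bigOn e c n y : cmean (fun j => f j * y j) = 0 ->
  (forall j, bigOn e c n (y j - apply_cmx F y j)) -> forall j, bigOn e (Cg * c) n (y j).
Proof. by move=> y0 h j; rewrite /bigOn -mulrA; exact: (sd_gap sd). Qed.

Lemma q_bigOn e j :
  bigOn e (Cg * (1 * (hi * hi) + 1 * (hi * (hi * hi)) * B * hi)) 0 (q j).
Proof.
have f0 i : bigOn e hi 0 (f i) by apply: bigOn0; exact: sd_f sd i.
have p0 i : bigOn e 1 0 (p i) by apply: bigOn0; exact: normc_p i.
have n0 : bigOn e B 0 n2^-1 by apply: bigOn0; exact: sd_n2V sd.
have sg0 : bigOn e (1 * (hi * (hi * hi))) 0 sg.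
  rewrite -(sd_sg sd); apply: bigOn_cmean; first exact: sd_N sd.
  by move=> i; exact: (bigOnM (p0 i) (bigOnM (f0 i) (bigOnM (f0 i) (f0 i)))).
apply: gap_bigOn; first exact: sd_q_perp sd.
move=> i; rewrite (sd_q sd).
exact: (bigOnB (bigOnM (p0 i) (bigOnM (f0 i) (f0 i))) (bigOnM (bigOnM sg0 n0) (f0 i))).
Qed.

(** The coefficient [d] is not free: the right side must be orthogonal to [f], which determines [d]
    from [c] and [r]. Hence [y - c q] solves an equation with only the projection of [r] on its
    right side, whatever the size of [d]. *)
Lemma perp_solve e cr n (y r : 'I_N -> R[i]) (c d : R[i]) :
  cmean (fun j => f j * y j) = 0 ->
  (forall j, y j - apply_cmx F y j = c * (p j * f j ^+ 2) + d * f j + r j) ->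
  (forall j, bigOn e cr n (r j)) ->
  forall j, bigOn e (Cg * (cr + hi * cr * B * hi)) n (y j - c * q j).
Proof.
move=> y0 yE hr.
have id : c * sg + d * n2 + cmean (fun j => f j * r j) = 0.
  rewrite -[RHS](cmean_f_range y) -(sd_sg sd) -(sd_n2 sd) -!cmeanZ -!cmeanD.
  by apply: eq_cmean => j; rewrite yE; ring.
apply: gap_bigOn.
  under eq_fun do rewrite mulrBr mulrCA.
  by rewrite cmeanB cmeanZ y0 (sd_q_perp sd) mulr0 subrr.
move=> j; rewrite apply_cmxB apply_cmxZ.
have -> : y j - c * q j - (apply_cmx F y j - c * apply_cmx F q j) =
   r j - cmean (fun j => f j * r j) * n2^-1 * f j.
  transitivity ((y j - apply_cmx F y j) - c * (q j - apply_cmx F q j)); first by ring.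
  rewrite yE (sd_q sd).
  have -> : cmean (fun j => f j * r j) = - (c * sg + d * n2).
    by apply/eqP; rewrite -subr_eq0 opprK addrC id.
  by field; exact: sd_n2_neq0 sd.
have f0 i : bigOn e hi 0 (f i) by apply: bigOn0; exact: sd_f sd i.
have n0 : bigOn e B 0 n2^-1 by apply: bigOn0; exact: sd_n2V sd.
have m0 : bigOn e (hi * cr) n (cmean (fun j => f j * r j)).
  by apply: bigOn_cmean; [exact: sd_N sd | move=> i; exact: (bigOnM (f0 i) (hr i))].
have := bigOnM (bigOnM m0 n0) (f0 j); rewrite !addn0; exact: bigOnB.
Qed.

Lemma perp_part (h : 'I_N -> R[i]) (xi : R[i]) :
  xi = cmean (fun j => f j * h j) / n2 ->
  cmean (fun j => f j * (h j - xi * f j)) = 0.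
Proof.
move=> ->; have n20 := sd_n2_neq0 sd.
under eq_fun do rewrite mulrBr mulrCA.
by rewrite cmeanB cmeanZ (sd_n2 sd) divfK // subrr.
Qed.

End Fixed.

(** Bootstrap: [xi] has order 1, so by the gap the orthogonal part has order 2; hence [p h F h]
    equals [xi^2 p f^2] up to order 3 and [perp_solve] applies with [c = xi^2]. *)
Lemma solution_expansion (c1 : R) : exists C1 C2 C3 C4 : R,
  forall (N : nat) (F : 'M[R]_N) f p q n2 sg,
  spectral_data hi Cg b B F f p q n2 sg ->
  forall (e : R) (h s : 'I_N -> R[i]) (xi : R[i]), 0 < e -> e <= 1 ->
  (forall j, normc (h j) <= e) -> (forall j, bigOn e c1 3 (s j)) ->
  (forall j, h j - apply_cmx F h j = p j * (h j * apply_cmx F h j) + s j) ->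
  xi = cmean (fun j => f j * h j) / n2 ->
  [/\ bigOn e C1 1 xi,
      forall j, bigOn e C2 2 (h j - xi * f j),
      forall j, bigOn e C3 3 (h j - xi * f j - xi ^+ 2 * q j) &
      forall j, bigOn e C4 0 (q j)].
Proof.
do 4 eexists; move=> N F f p q n2 sg sd e h s xi e0 e1 hh hs hE xiE.
have N0 := sd_N sd.
have f0 j : bigOn e hi 0 (f j) by apply: bigOn0; exact: sd_f sd j.
have p0 j : bigOn e 1 0 (p j) by apply: bigOn0; exact: normc_p sd j.
have n0 : bigOn e B 0 n2^-1 by apply: bigOn0; exact: sd_n2V sd.
have h1 j : bigOn e 1 1 (h j) by rewrite /bigOn mul1r expr1.
have Fh1 j : bigOn e (b * 1) 1 (apply_cmx F h j) by apply: bigOn_apply => //; exact: sd_F sd.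
have xi1 : bigOn e (hi * 1 * B) 1 xi.
  rewrite xiE; apply: (bigOnM (n := 1) (n' := 0)) => //; apply: bigOn_cmean => // j.
  exact: (bigOnM (n := 0) (n' := 1)).
pose y j := h j - xi * f j.
have y_perp : cmean (fun j => f j * y j) = 0 := perp_part sd xiE.
have yE j : y j - apply_cmx F y j = p j * (h j * apply_cmx F h j) + s j.
  rewrite /y apply_cmxB apply_cmxZ (sd_Ff sd) -hE; ring.
have y2 j : bigOn e (Cg * (1 * (1 * (b * 1)) + c1)) 2 (y j).
  apply: (gap_bigOn sd) => // i; rewrite yE; apply: bigOnD.
    exact: (bigOnM (p0 i) (bigOnM (h1 i) (Fh1 i))).
  exact: bigOnW (hs i).
have Fy2 j := bigOn_apply j N0 (sd_F sd) y2.
have q0 := q_bigOn sd e.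
split.
- exact: xi1.
- exact: y2.
- pose r i := p i * (xi * f i * apply_cmx F y i + y i * (xi * f i)
      + y i * apply_cmx F y i) + s i.
  have r3 i : bigOn e _ 3 (r i) :=
    bigOnD (bigOnM (p0 i) (bigOnD (bigOnD (bigOnM (bigOnM xi1 (f0 i)) (Fy2 i))
      (bigOnM (y2 i) (bigOnM xi1 (f0 i))))
      (bigOnW e0 e1 (isT : (3 <= 4)%N) (bigOnM (y2 i) (Fy2 i))))) (hs i).
  apply: (perp_solve sd (d := 0) y_perp _ r3) => i.
  rewrite yE /r.
  have hy : h i = xi * f i + y i by rewrite /y; ring.
  have Fhy : apply_cmx F h i = xi * f i + apply_cmx F y i.
    by rewrite /y apply_cmxB apply_cmxZ (sd_Ff sd); ring.
  by rewrite Fhy {1}hy; ring.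
- exact: q0.
Qed.

(* An eigenvector for a small eigenvalue is [f] up to scaling and an [O(t)]
   correction: its component along [f] cannot vanish, since the gap bounds the
   orthogonal component by the component along [f]. *)
Lemma small_eigenvector (eps0 : R) : exists C, forall (N : nat) (F : 'M[R]_N) f p q n2 sg,
  spectral_data hi Cg b B F f p q n2 sg ->
  forall (t : R) (tau x : 'I_N -> R[i]) (be : R[i]),
  0 <= t -> t <= 1 ->
  Cg * (t * (1 + hi * hi * B) * b + eps0) <= 1 / 2 ->
  (forall j, normc (tau j) <= t) -> normc be <= eps0 ->
  (exists j, x j != 0) ->
  (forall j, x j - (1 + tau j) * apply_cmx F x j = be * x j) ->
  exists y : 'I_N -> R[i],
  [/\ cmean (fun j => f j * y j) = 0,
      forall j, (f j + y j) - (1 + tau j) * (f j + apply_cmx F y j) = be * (f j + y j),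
      be * n2 = - cmean (fun j => f j * (tau j * (f j + apply_cmx F y j))),
      forall j, normc (y j) <= C * t &
      normc be <= C * t].
Proof.
(* [C1 * t] will bound the correction [y]; the 2 comes from absorbing half of its norm. The
   remaining summand of the witness bounds [be] through its projection formula. *)
pose C1 := 2 * Cg * (1 + hi * hi * B) * hi.
exists (C1 + B * (hi * (hi + b * C1))).
move=> N F f p q n2 sg sd t tau x be t0 t1 small htau hbe [k xk] xE.
have N0 := sd_N sd; have n20 := sd_n2_neq0 sd.
pose j0 : 'I_N := Ordinal N0.
have hi0 : 0 <= hi := le_trans (normc_ge0 _) (sd_f sd j0).
have B0 : 0 <= B := le_trans (normc_ge0 _) (sd_n2V sd).
have b0 : 0 <= b.
  have := le_trans (normr_ge0 _) (sd_F sd j0 j0).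
  by rewrite pmulr_lge0 // invr_gt0 ltr0n.
have Cg0 : 0 <= Cg.
  have := sd_gap sd (y := fun=> 0) (r := 1).
  have -> : cmean (fun j => f j * 0) = 0 by under eq_fun do rewrite mulr0; rewrite /cmean big1 ?mulr0.
  move=> /(_ erefl) h; have := h _ j0; rewrite normc0 mulr1; apply => j.
  by rewrite /apply_cmx big1 ?subr0 ?normc0 // => i _; rewrite mulr0.
have M0 : 0 <= 1 + hi * hi * B by rewrite addr_ge0 // !mulr_ge0.
have C10 : 0 <= C1 by rewrite /C1 !mulr_ge0.
pose al := cmean (fun j => f j * x j) / n2.
pose y j := x j - al * f j.
have y_perp : cmean (fun j => f j * y j) = 0 := perp_part sd (erefl al).
have xy j : x j = al * f j + y j by rewrite /y; ring.
have Fx j : apply_cmx F x j = al * f j + apply_cmx F y j.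
  by rewrite /y apply_cmxB apply_cmxZ (sd_Ff sd); ring.
have beal : be * al * n2 = - cmean (fun j => f j * (tau j * apply_cmx F x j)).
  have -> : be * al * n2 = cmean (fun j => f j * (be * x j)).
    under eq_fun do rewrite mulrCA.
    by rewrite cmeanZ /al -mulrA divfK.
  rewrite -[RHS]add0r -(cmean_f_range sd x) -cmeanB; apply: eq_cmean => j.
  by rewrite -xE; ring.
have [jm _ hY] := arg_maxP (fun j => normc (y j)) (erefl true : xpredT j0).
set Y := normc (y jm) in hY.
have {}hY j : normc (y j) <= Y by exact: hY.
have Y0 : 0 <= Y := normc_ge0 _.
set na := normc al.
have na0 : 0 <= na := normc_ge0 _.
have Fy j : normc (apply_cmx F y j) <= b * Y.
  have := @bigOn_apply _ _ F b 1 Y 0 y j N0 (sd_F sd).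
  by rewrite /bigOn expr0 !mulr1; exact.
have Fxb j : normc (apply_cmx F x j) <= na * hi + b * Y.
  rewrite Fx; apply: (le_trans (normcD _ _)); apply: lerD => //.
  by rewrite normcM; apply: ler_wpM2l => //; exact: sd_f sd j.
have tFx j : normc (tau j * apply_cmx F x j) <= t * (na * hi + b * Y).
  by rewrite normcM; apply: ler_pM; rewrite ?normc_ge0.
have beal_le : normc (be * al) <= B * (hi * (t * (na * hi + b * Y))).
  have -> : be * al = - (n2^-1 * cmean (fun j => f j * (tau j * apply_cmx F x j))).
    by rewrite -mulrN -beal [RHS]mulrC mulfK.
  rewrite normcN normcM; apply: ler_pM; rewrite ?normc_ge0 //; first exact: sd_n2V sd.
  have := @bigOn_cmean _ _ 1 (hi * (t * (na * hi + b * Y))) 0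
     (fun j => f j * (tau j * apply_cmx F x j)) N0.
  rewrite /bigOn expr0 !mulr1; apply => j.
  by rewrite normcM ?mulr1; apply: ler_pM; rewrite ?normc_ge0 //; exact: sd_f sd j.
have yE j : y j - apply_cmx F y j = tau j * apply_cmx F x j + be * al * f j + be * y j.
  transitivity (x j - apply_cmx F x j); first by rewrite Fx /y; ring.
  have -> : x j - apply_cmx F x j =
     tau j * apply_cmx F x j + (x j - (1 + tau j) * apply_cmx F x j) by ring.
  by rewrite xE xy; ring.
have Yb : Y <= C1 * t * na.
  have h : Y <= Cg * (t * (na * hi + b * Y) + B * (hi * (t * (na * hi + b * Y))) * hi + eps0 * Y).
    apply: (sd_gap sd y_perp) => j; rewrite yE.
    apply: (le_trans (normcD _ _)); apply: lerD; last first.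
      by rewrite normcM; apply: ler_pM; rewrite ?normc_ge0.
    apply: (le_trans (normcD _ _)); apply: lerD => //.
    by rewrite (normcM (be * al)); apply: ler_pM; rewrite ?normc_ge0 //; exact: sd_f sd j.
  have e : Cg * (t * (na * hi + b * Y) + B * (hi * (t * (na * hi + b * Y))) * hi + eps0 * Y) =
     Cg * (t * (1 + hi * hi * B) * b + eps0) * Y + C1 / 2 * t * na.
    by rewrite /C1; field.
  rewrite e in h.
  have := ler_wpM2r Y0 small; lra.
have al0 : al != 0.
  apply/eqP => al0; move: xk; rewrite xy al0 mul0r add0r.
  have : Y <= 0 by apply: le_trans Yb _; rewrite /na al0 normc0 mulr0.
  move=> Yle; have := le_trans (hY k) Yle.
  rewrite le_eqVlt ltNge normc_ge0 orbF => /eqP/eq0_normc ->.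
  by rewrite eqxx.
have na_gt0 : 0 < na by rewrite normc_gt0.
pose y1 j := al^-1 * y j.
have y1b j : normc (y1 j) <= C1 * t.
  by rewrite normcM normcV -/na ler_pdivrMl // mulrC; apply: (le_trans (hY j)).
have Fy1 j : apply_cmx F y1 j = al^-1 * apply_cmx F y j by rewrite apply_cmxZ.
have x1 j : x j = al * (f j + y1 j) by rewrite xy /y1; field.
have Fx1 j : apply_cmx F x j = al * (f j + apply_cmx F y1 j) by rewrite Fx Fy1; field.
have beE : be * n2 = - cmean (fun j => f j * (tau j * (f j + apply_cmx F y1 j))).
  apply: (mulfI al0); rewrite mulrN -cmeanZ.
  transitivity (be * al * n2); first by ring.
  by rewrite beal; congr (- _); apply: eq_cmean => j; rewrite Fx1; ring.
have BB : 0 <= B * (hi * (hi + b * C1)) by rewrite !mulr_ge0 // addr_ge0 // mulr_ge0.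
exists y1; split => //.
- by under eq_fun do rewrite /y1 mulrCA; rewrite cmeanZ y_perp mulr0.
- move=> j; apply: (mulfI al0); transitivity (be * x j); last by rewrite x1; ring.
  by rewrite -xE Fx1 x1; ring.
- move=> j; apply: (le_trans (y1b j)); rewrite mulrDl lerDl mulr_ge0 //.
have -> : be = - (n2^-1 * cmean (fun j => f j * (tau j * (f j + apply_cmx F y1 j)))).
  by rewrite -mulrN -beE [RHS]mulrC mulfK.
rewrite normcN normcM; apply: (@le_trans _ _ (B * (hi * (t * (hi + b * C1))))); last first.
  have -> : B * (hi * (t * (hi + b * C1))) = B * (hi * (hi + b * C1)) * t by ring.
  by rewrite mulrDl lerDr mulr_ge0.
apply: ler_pM; rewrite ?normc_ge0 //; first exact: sd_n2V sd.
have := @bigOn_cmean _ _ 1 (hi * (t * (hi + b * C1))) 0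
   (fun j => f j * (tau j * (f j + apply_cmx F y1 j))) N0.
rewrite /bigOn expr0 !mulr1; apply => j.
rewrite !normcM ?mulr1; apply: ler_pM; rewrite ?mulr_ge0 ?normc_ge0 //; first exact: sd_f sd j.
apply: ler_pM; rewrite ?normc_ge0 //; apply: (le_trans (normcD _ _)).
apply: lerD; first exact: sd_f sd j.
have := @bigOn_apply _ _ F b 1 (C1 * t) 0 y1 j N0 (sd_F sd).
rewrite /bigOn expr0 !mulr1 => h; apply: (le_trans (h _)) => [i|]; first by rewrite ?mulr1.
by apply: ler_wpM2l => //; rewrite ler_piMr.
Qed.

(** Valid for every eigenvalue of modulus at most [eps0]. The formula for [be * n2] is expanded with
    [y = (xi + xi') q] up to order 2; [w] collects exactly what is left over, and each of its terms
    has order 3. *)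
Lemma eigenvalue_expansion (c1 eps0 : R) : exists C, forall (N : nat) (F : 'M[R]_N) f p q n2 sg,
  spectral_data hi Cg b B F f p q n2 sg ->
  forall (e : R) (h k s s' x : 'I_N -> R[i]) (xi xi' be : R[i]),
  0 < e -> 3 * e <= 1 ->
  Cg * (3 * e * (1 + hi * hi * B) * b + eps0) <= 1 / 2 ->
  (forall j, normc (h j) <= e) -> (forall j, bigOn e c1 3 (s j)) ->
  (forall j, h j - apply_cmx F h j = p j * (h j * apply_cmx F h j) + s j) ->
  xi = cmean (fun j => f j * h j) / n2 ->
  (forall j, normc (k j) <= e) -> (forall j, bigOn e c1 3 (s' j)) ->
  (forall j, k j - apply_cmx F k j = p j * (k j * apply_cmx F k j) + s' j) ->
  xi' = cmean (fun j => f j * k j) / n2 ->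
  normc be <= eps0 -> (exists j, x j != 0) ->
  (forall j, x j - (1 + p j * h j) * (1 + p j * k j) * apply_cmx F x j = be * x j) ->
  bigOn e C 3 (be + sg / n2 * (xi + xi')
    + cmean (fun j => p j * f j ^+ 2 * (q j + apply_cmx F q j)) / n2
        * (xi ^+ 2 + xi * xi' + xi' ^+ 2)
    + (sg / n2) ^+ 2 * (xi * xi')).
Proof.
have [C1 [C2 [C3 [C4 SE]]]] := solution_expansion c1.
have [C5 SV] := small_eigenvector eps0.
eexists; move=> N F f p q n2 sg sd e h k s s' x xi xi' be e0 e3 small.
move=> hh hs hE xiE hk hs' kE xi'E hbe xn0 xE.
have e1 : e <= 1 by lra.
have N0 := sd_N sd; have n20 := sd_n2_neq0 sd.
have [xi1 h2 h3 q0] := SE _ _ _ _ _ _ _ sd _ _ _ _ e0 e1 hh hs hE xiE.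
have [xi'1 k2 k3 _] := SE _ _ _ _ _ _ _ sd _ _ _ _ e0 e1 hk hs' kE xi'E.
pose tau j := p j * h j + p j * k j + h j * k j.
have f0 j : bigOn e hi 0 (f j) by apply: bigOn0; exact: sd_f sd j.
have p0 j : bigOn e 1 0 (p j) by apply: bigOn0; exact: normc_p sd j.
have n0 : bigOn e B 0 n2^-1 by apply: bigOn0; exact: sd_n2V sd.
have h1 j : bigOn e 1 1 (h j) by rewrite /bigOn mul1r expr1.
have k1 j : bigOn e 1 1 (k j) by rewrite /bigOn mul1r expr1.
have tau1 j : bigOn e 3 1 (tau j).
  have := bigOnD (bigOnD (bigOnM (p0 j) (h1 j)) (bigOnM (p0 j) (k1 j)))
    (bigOnW e0 e1 (isT : (1 <= 2)%N) (bigOnM (h1 j) (k1 j))).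
  by rewrite !mul1r; have -> : 1 + 1 + 1 = 3 :> R by ring.
have taub j : normc (tau j) <= 3 * e by have := tau1 j; rewrite /bigOn expr1.
have xE' j : x j - (1 + tau j) * apply_cmx F x j = be * x j.
  rewrite -xE /tau; congr (_ - _ * _).
  transitivity (1 + p j * h j + p j * k j + p j ^+ 2 * (h j * k j)); last by ring.
  by rewrite (sd_p sd); ring.
have t0 : 0 <= 3 * e by lra.
have [y [y_perp yE beE y1' be1']] :=
  SV _ _ _ _ _ _ _ sd _ _ _ _ t0 e3 small taub hbe xn0 xE'.
have y1 j : bigOn e (C5 * 3) 1 (y j) by rewrite /bigOn expr1 -mulrA.
have be1 : bigOn e (C5 * 3) 1 be by rewrite /bigOn expr1 -mulrA.
have Fy1 j := bigOn_apply j N0 (sd_F sd) y1.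
have Fq0 j := bigOn_apply j N0 (sd_F sd) q0.
pose th := xi + xi'.
have th1 := bigOnD xi1 xi'1; rewrite -/th in th1.
have tau2 j : bigOn e (1 * C2 + 1 * C2 + 1 * 1) 2 (tau j - th * (p j * f j)).
  have -> : tau j - th * (p j * f j) =
     p j * (h j - xi * f j) + p j * (k j - xi' * f j) + h j * k j by rewrite /tau /th; ring.
  exact: (bigOnD (bigOnD (bigOnM (p0 j) (h2 j)) (bigOnM (p0 j) (k2 j))) (bigOnM (h1 j) (k1 j))).
pose r j := (tau j - th * (p j * f j)) * f j + tau j * apply_cmx F y j + be * y j.
have r2 j : bigOn e _ 2 (r j) :=
  bigOnD (bigOnD (bigOnM (tau2 j) (f0 j)) (bigOnM (tau1 j) (Fy1 j))) (bigOnM be1 (y1 j)).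
(* [be * f] has only order 1 and must stay out of [r]; [perp_solve] eliminates it as a multiple of
   [f]. *)
have yr i : y i - apply_cmx F y i = th * (p i * f i ^+ 2) + be * f i + r i.
  transitivity (((f i + y i) - (1 + tau i) * (f i + apply_cmx F y i))
     + tau i * (f i + apply_cmx F y i)); first by ring.
  by rewrite yE /r; ring.
have yq := perp_solve sd y_perp yr r2.
have Fyq j := bigOn_apply j N0 (sd_F sd) yq.
pose w j := f j * f j * (p j * (h j - xi * f j - xi ^+ 2 * q j)
      + p j * (k j - xi' * f j - xi' ^+ 2 * q j)
      + ((h j - xi * f j) * k j + xi * f j * (k j - xi' * f j)))
   + f j * tau j * apply_cmx F (fun i => y i - th * q i) j
   + th * apply_cmx F q j * f j * (tau j - th * (p j * f j)).
have w3 j : bigOn e _ 3 (w j) :=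
  bigOnD (bigOnD
    (bigOnM (bigOnM (f0 j) (f0 j))
      (bigOnD (bigOnD (bigOnM (p0 j) (h3 j)) (bigOnM (p0 j) (k3 j)))
        (bigOnD (bigOnM (h2 j) (k1 j)) (bigOnM (bigOnM xi1 (f0 j)) (k2 j)))))
    (bigOnM (bigOnM (f0 j) (tau1 j)) (Fyq j)))
    (bigOnM (bigOnM (bigOnM th1 (Fq0 j)) (f0 j)) (tau2 j)).
pose A := cmean (fun j => p j * f j ^+ 2 * q j).
pose Bq := cmean (fun j => p j * f j ^+ 2 * apply_cmx F q j).
pose M4 := cmean (fun j => f j ^+ 4).
have psE : cmean (fun j => p j * f j ^+ 2 * (q j + apply_cmx F q j)) = A + Bq.
  by rewrite -cmeanD; apply: eq_cmean => j; rewrite mulrDr.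
(* As p^2 = 1, the mean of f^4 is that of p f^2 against (1 - F) q + (sg / n2) f. This relation
   merges the coefficients into [A + Bq], the form with (1 + F) / (1 - F), and produces the separate
   sg^2 term. *)
have M4E : M4 = A - Bq + sg ^+ 2 / n2.
  have -> : A - Bq = cmean (fun j => p j ^+ 2 * f j ^+ 4 - sg / n2 * (p j * f j ^+ 3)).
    rewrite -cmeanB; apply: eq_cmean => j; rewrite -mulrBr (sd_q sd); ring.
  rewrite cmeanB cmeanZ (sd_sg sd).
  have -> : cmean (fun j => p j ^+ 2 * f j ^+ 4) = M4.
    by apply: eq_cmean => j; rewrite (sd_p sd) mul1r.
  by field.
have wE : cmean w = - (be * n2) - (th * sg + (xi ^+ 2 + xi' ^+ 2) * A
     + xi * xi' * M4 + th ^+ 2 * Bq).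
  rewrite beE opprK -(sd_sg sd) -!cmeanZ -!cmeanD -cmeanB; apply: eq_cmean => j.
  rewrite /w apply_cmxB apply_cmxZ.
  by rewrite /tau /th; ring.
rewrite psE.
have -> : be + sg / n2 * (xi + xi') +
    (A + Bq) / n2 * (xi ^+ 2 + xi * xi' + xi' ^+ 2) + (sg / n2) ^+ 2 * (xi * xi') =
    - (n2^-1 * cmean w).
  by rewrite wE M4E /th; field.
apply: bigOnN; apply: (bigOnM (n := 0) (n' := 3) n0).
exact: bigOn_cmean N0 w3.
Qed.

End Expansion.
(** * Existence of a small eigenvalue *)

Section Homotopy.
Context {R : realType}.

Lemma prod_diff_bound (I : Type) (s : seq I) (u v : I -> R[i]) (M d : R) :
  1 <= M -> 0 <= d -> (forall i, normc (u i) <= M) -> (forall i, normc (v i) <= M) ->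
  (forall i, normc (u i - v i) <= d) ->
  normc (\prod_(i <- s) u i - \prod_(i <- s) v i) <= (size s)%:R * M ^+ size s * d.
Proof.
move=> M1 d0 hu hv huv.
have M0 : 0 <= M by apply: le_trans M1.
have hp : normc (\prod_(i <- s) u i) <= M ^+ size s.
  elim: s => [|i s IH]; first by rewrite big_nil normc1.
  by rewrite big_cons normcM exprS; apply: ler_pM; rewrite ?normc_ge0.
elim: s hp => [|i s IH] _.
  by rewrite !big_nil subrr normc0 mul0r mul0r.
have hp : normc (\prod_(i <- s) u i) <= M ^+ size s.
  elim: s {IH} => [|k s IH]; first by rewrite big_nil normc1.
  by rewrite big_cons normcM exprS; apply: ler_pM; rewrite ?normc_ge0.
rewrite !big_cons.
set a := \prod_(k <- s) u k in hp *; set c := \prod_(k <- s) v k.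
have -> : u i * a - v i * c = (u i - v i) * a + v i * (a - c) by ring.
have Ms : 0 <= M ^+ size s by exact: exprn_ge0.
apply: (le_trans (normcD _ _)); rewrite !normcM /=.
have -> : (size s).+1%:R * M ^+ (size s).+1 * d =
   d * (M * M ^+ size s) + M * ((size s)%:R * M ^+ size s * d).
  by rewrite -[(size s).+1]addn1 natrD exprD expr1; ring.
apply: lerD; apply: ler_pM; rewrite ?normc_ge0 //; last exact: IH.
by apply: (le_trans hp); exact: ler_peMl.
Qed.

(** [L] depends on [N], which is harmless: it only fixes the number of homotopy steps and enters no
    final constant. *)
Lemma det_lipschitz (N : nat) (M : R) : 1 <= M -> exists L : R, 0 <= L /\
  forall (A B : 'M[R[i]]_N) (d : R), 0 <= d ->
  (forall i j, normc (A i j) <= M) -> (forall i j, normc (B i j) <= M) ->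
  (forall i j, normc (A i j - B i j) <= d) ->
  normc (\det A - \det B) <= L * d.
Proof.
move=> M1; exists (\sum_(s : {perm 'I_N}) N%:R * M ^+ N); split.
  by apply: sumr_ge0 => s _; rewrite mulr_ge0 ?ler0n // exprn_ge0 // (le_trans _ M1).
move=> A B d d0 hA hB hAB.
rewrite /determinant -sumrB; apply: (le_trans (normc_sum _ _ _)).
rewrite mulr_suml.
apply: ler_sum => s _; rewrite -mulrBr normcM normcX normcN normc1 expr1n mul1r.
have := @prod_diff_bound _ (index_enum 'I_N) (fun i => A i (s i)) (fun i => B i (s i))
  M d M1 d0.
have -> : size (index_enum 'I_N) = N by rewrite -[RHS]card_ord cardE enumT.
by apply.
Qed.

(** The modulus of P(la) is the product of the distances from la to the roots, so they cannot all be
    at least [th]. *)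
Lemma monic_root_near (P : {poly R[i]}) (la : R[i]) (th : R) : 0 < th ->
  P \is monic -> normc P.[la] < th ^+ (size P).-1 ->
  exists mu, root P mu /\ normc (la - mu) < th.
Proof.
move=> th0 Pm Pla.
have [r Pr] := closed_field_poly_normal P.
have {}Pr : P = \prod_(z <- r) ('X - z%:P).
  by rewrite Pr (monicP Pm) scale1r.
have szP : (size P).-1 = size r by rewrite Pr size_prod_XsubC.
apply: contrapT => H.
have far z : z \in r -> th <= normc (la - z).
  move=> zr; rewrite leNgt; apply/negP => h; apply: H; exists z; split => //.
  by rewrite Pr root_prod_XsubC.
move: Pla; rewrite szP {1}Pr horner_prod ltNge => /negP; apply.
elim: r far {Pr szP H} => [|z r IH] far; first by rewrite big_nil normc1.
rewrite big_cons normcM exprS; apply: ler_pM; rewrite ?exprn_ge0 ?(ltW th0) //.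
  by rewrite hornerXsubC far // mem_head.
by apply: IH => y yr; apply: far; rewrite in_cons yr orbT.
Qed.

Lemma char_poly_eval (N : nat) (A : 'M[R[i]]_N) (la : R[i]) :
  (char_poly A).[la] = \det (la%:M - A).
Proof.
rewrite /char_poly -[_.[_]]/(horner_eval la _) -det_map_mx; congr (\det _).
apply/matrixP => i j; rewrite !mxE /= /horner_eval.
by rewrite hornerD hornerN hornerC hornerMn hornerX.
Qed.

(* Between consecutive times [k / n] an eigenvalue in the disk of radius
   [delta] moves by less than [eps - delta] (a monic polynomial of degree [N]
   has a root within [|P(la)|^(1/N)] of [la]), so it never leaves that disk. *)
Lemma eigenvalue_homotopy (N : nat) (A0 A1 : 'M[R[i]]_N) (eps delta : R) :
  0 <= delta -> delta < eps -> eps <= 1 ->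
  (exists la, eigenvalue A0 la /\ normc la <= delta) ->
  (forall (t : R) la, 0 <= t <= 1 -> eigenvalue (A0 + t%:C *: A1) la ->
     normc la <= eps -> normc la <= delta) ->
  exists la, eigenvalue (A0 + A1) la /\ normc la <= delta.
Proof.
move=> de0 de_eps eps1 start gap.
pose At (t : R) := A0 + t%:C *: A1.
(* Leaves room for an entry of [la%:M], of modulus at most 1, next to those of [A0] and [A1]. *)
pose M : R := 2 + \sum_i \sum_j (normc (A0 i j) + normc (A1 i j)).
have sum0 : 0 <= \sum_i \sum_j (normc (A0 i j) + normc (A1 i j)).
  by apply: sumr_ge0 => i _; apply: sumr_ge0 => j _; rewrite addr_ge0 ?normc_ge0.
have M1 : 1 <= M by rewrite /M; lra.
have entry i j : normc (A0 i j) + normc (A1 i j) <= M - 2.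
  rewrite /M [2 + _]addrC addrK (bigD1 i) //= (bigD1 j) //=.
  rewrite -addrA lerDl addr_ge0 //.
    by apply: sumr_ge0 => l _; rewrite addr_ge0 ?normc_ge0.
  by apply: sumr_ge0 => l _; apply: sumr_ge0 => l' _; rewrite addr_ge0 ?normc_ge0.
have [L [L0 HL]] := det_lipschitz N M1.
have bnd (t : R) la i j : 0 <= t <= 1 -> normc la <= 1 -> normc ((la%:M - At t) i j) <= M.
  move=> /andP[t0 t1] la1; rewrite !mxE.
  apply: (le_trans (normcB _ _)).
  have h1 : normc (la *+ (i == j)) <= 1.
    by case: (i == j); rewrite ?mulr1n // mulr0n normc0.
  have h2 : normc (A0 i j + t%:C * A1 i j) <= M - 2.
    apply: le_trans (entry i j); apply: (le_trans (normcD _ _)); rewrite lerD2l.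
    by rewrite normcM normc_real ger0_norm // ler_piMl // normc_ge0.
  lra.
have [P PE] : exists P : R -> {poly R[i]}, forall t, P t = char_poly (At t).
  by exists (fun t => char_poly (At t)).
have step (t t' : R) la : 0 <= t <= 1 -> 0 <= t' <= 1 -> normc la <= 1 ->
   normc ((P t).[la] - (P t').[la]) <= L * (M * `|t - t'|).
  move=> ht ht' la1.
  have cE u : (P u).[la] = \det (la%:M - At u) by rewrite PE char_poly_eval.
  rewrite (cE t) (cE t').
  have Mt : 0 <= M * `|t - t'| by rewrite mulr_ge0 // (le_trans _ M1).
  apply: (HL (la%:M - At t) (la%:M - At t') _ Mt).
  - by move=> i j; exact: bnd.
  - by move=> i j; exact: bnd.
  move=> i j.
  have AE u : (la%:M - At u) i j = la *+ (i == j) - (A0 i j + u%:C * A1 i j) by rewrite !mxE.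
  have -> : (la%:M - At t) i j - (la%:M - At t') i j = (t' - t)%:C * A1 i j.
    transitivity ((la *+ (i == j) - (A0 i j + t%:C * A1 i j)) -
        (la *+ (i == j) - (A0 i j + t'%:C * A1 i j))).
      by congr (_ - _); exact: AE.
    by rewrite rmorphB /=; ring.
  rewrite normcM normc_real mulrC distrC; apply: ler_wpM2r => //.
  have := entry i j; have := normc_ge0 (A0 i j); lra.
pose th := eps - delta.
have th0 : 0 < th by rewrite subr_gt0.
have thN : 0 < th ^+ N by rewrite exprn_gt0.
have [n hn] : exists n : nat, L * M < n.+1%:R * th ^+ N.
  exists (Num.bound (L * M / th ^+ N)).
  rewrite -ltr_pdivrMr //; apply: (@lt_le_trans _ _ (Num.bound (L * M / th ^+ N))%:R).
    by apply: archi_boundP; rewrite divr_ge0 ?(ltW thN) // mulr_ge0 // (le_trans _ M1).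
  by rewrite ler_nat.
have n0 : 0 < n.+1%:R :> R by rewrite ltr0n.
have walk k : (k <= n.+1)%N ->
   exists la, eigenvalue (At (k%:R / n.+1%:R)) la /\ normc la <= delta.
  elim: k => [|k IH] kn; first by rewrite mul0r /At scale0r addr0.
  have [la [ev la_de]] := IH (ltnW kn).
  have in01 l : (l <= n.+1)%N -> 0 <= (l%:R / n.+1%:R : R) <= 1.
    by move=> ln; rewrite divr_ge0 ?ler0n //= ler_pdivrMr // mul1r ler_nat.
  have la1 : normc la <= 1 by apply: (le_trans la_de); apply: ltW; apply: lt_le_trans eps1.
  have := step _ _ la (in01 _ kn) (in01 _ (ltnW kn)) la1.
  have -> : (P (k%:R / n.+1%:R)).[la] = 0.
    by apply/eqP; move: ev; rewrite eigenvalue_root_char -PE.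
  have -> : `|k.+1%:R / n.+1%:R - k%:R / n.+1%:R| = n.+1%:R^-1 :> R.
    rewrite -mulrBl -natrB // subSnn mul1r ger0_norm // invr_ge0 ltW //.
  rewrite subr0 => small.
  have small' : normc (P (k.+1%:R / n.+1%:R)).[la] < th ^+ N.
    apply: (le_lt_trans small); rewrite mulrA ltr_pdivrMr //.
    by rewrite [ltRHS]mulrC.
  have Pm : P (k.+1%:R / n.+1%:R) \is monic by rewrite PE char_poly_monic.
  have sP : (size (P (k.+1%:R / n.+1%:R))).-1 = N by rewrite PE size_char_poly.
  have := @monic_root_near _ la th th0 Pm; rewrite sP => /(_ small')[mu [mu_root mu_near]].
  have mu_ev : eigenvalue (At (k.+1%:R / n.+1%:R)) mu by rewrite eigenvalue_root_char -PE.
  exists mu; split => //; apply: (gap _ _ (in01 _ kn) mu_ev).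
  have -> : mu = la - (la - mu) by ring.
  apply: (le_trans (normcB _ _)).
  by have := ltW mu_near; rewrite /th; lra.
have [la [ev la_de]] := walk n.+1 (leqnn _).
have e : At (n.+1%:R / n.+1%:R) = A0 + A1 by rewrite mulfV ?gt_eqF // /At scale1r.
by rewrite e in ev; exists la.
Qed.

End Homotopy.
(** * The solution near a point of vanishing density *)

Section QveSolution.
Context {R : realType} {N : nat}.
Variables (cinf Csup Cm : R) (S : 'M[R]_N) (m : R[i] -> 'cV[R[i]]_N).
Hypotheses (cinf_gt0 : 0 < cinf) (Csup_gt0 : 0 < Csup) (Cm_gt0 : 0 < Cm).
Hypotheses (N_gt0 : (0 < N)%N) (symS : forall j k, S j k = S k j).
Hypothesis S_cC : forall j k, cinf / N%:R <= S j k <= Csup / N%:R.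
Hypotheses (qm : qve_solution S m) (Cm_m : assumptionC Cm m).

Let mz (z : R[i]) (j : 'I_N) : R[i] := m z j 0.
Let nN : 0 < N%:R :> R. Proof. by rewrite ltr0n. Qed.

(** Beyond this |E| the equation forces |m_j| <= 1 / (Csup + 1), which is incompatible with positive
    density; see [rho_support]. *)
Definition edge_bound : R := Csup * Cm + Csup + 1.
(** A sum of all quantities [D] has to dominate; the last two summands bound |z + S m| for |z| <=
    edge_bound + 4, a disk that contains all points used around [E0]. *)
Definition qve_const : R := 1 + cinf^-1 + Csup + Cm + (edge_bound + 4) + Csup * Cm.

Lemma normc_norm (x : R[i]) : `|x| = (normc x)%:C.
Proof. by rewrite normc_def; case: x. Qed.

Let CC : 0 < Csup * Cm. Proof. exact: mulr_gt0. Qed.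
Let ci : 0 < cinf^-1. Proof. by rewrite invr_gt0. Qed.

Lemma qve_const_ge1 : 1 <= qve_const.
Proof.
have h1 := Csup_gt0; have h2 := Cm_gt0.
rewrite /qve_const /edge_bound; move: (cinf^-1) (Csup * Cm) ci CC => c d c0 d0; lra.
Qed.

Let const_ge : [/\ cinf^-1 <= qve_const, Csup <= qve_const & Cm <= qve_const].
Proof.
have h1 := Csup_gt0; have h2 := Cm_gt0.
rewrite /qve_const /edge_bound; move: (cinf^-1) (Csup * Cm) ci CC => c d c0 d0; split; lra.
Qed.

Lemma S_bnd D : qve_const <= D -> forall j k, D^-1 / N%:R <= S j k <= D / N%:R.
Proof.
move=> hD j k; have /andP[h1 h2] := S_cC j k.
have D0 : 0 < D by apply: lt_le_trans hD; apply: lt_le_trans qve_const_ge1.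
have [hc hC _] := const_ge; move/le_trans: hc => /(_ _ hD) hc; move/le_trans: hC => /(_ _ hD) hC.
apply/andP; split.
  apply: le_trans h1; apply: ler_wpM2r; first by rewrite invr_ge0 ltW.
  by rewrite -[leRHS]invrK lef_pV2 ?posrE.
by apply: (le_trans h2); apply: ler_wpM2r => //; rewrite invr_ge0 ltW.
Qed.

Let S_ge0 j k : 0 <= S j k.
Proof.
by have /andP[h _] := S_cC j k; apply: le_trans h; rewrite divr_ge0 ?ler0n // ltW.
Qed.

Lemma normc_Sx (x : 'I_N -> R[i]) j : (forall k, normc (x k) <= Cm) ->
  normc (apply_cmx S x j) <= Csup * Cm.
Proof.
move=> hx; apply: (le_trans (normc_sum _ _ _)).
have -> : Csup * Cm = \sum_(k < N) Csup / N%:R * Cm.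
  by rewrite sumr_const card_ord -mulr_natl; field; rewrite gt_eqF.
apply: ler_sum => k _; rewrite normcM normc_real ger0_norm //.
by apply: ler_pM => //; [exact: normc_ge0 | have /andP[] := S_cC j k].
Qed.

(** The lower bound on |x_j| comes from the equation itself: |x_j| |z + (S x)_j| = 1. *)
Lemma qve_at_intro D z (x : 'I_N -> R[i]) : qve_const <= D ->
  normc z + Csup * Cm <= D ->
  (forall j, x j * (z + apply_cmx S x j) = -1) -> (forall j, normc (x j) <= Cm) ->
  (forall j, 0 <= complex.Im (x j)) -> 0 <= complex.Im z -> qve_at D S z x.
Proof.
move=> hD hz eqx xC xI zI; split => // j; apply/andP; split; last first.
  by apply: (le_trans (xC j)); apply: le_trans hD; have [] := const_ge.
have D0 : 0 < D by apply: lt_le_trans hD; apply: lt_le_trans qve_const_ge1.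
have := congr1 (@normc R) (eqx j); rewrite normcM normcN normc1 => e.
have h : normc (z + apply_cmx S x j) <= D.
  by apply: (le_trans (normcD _ _)); apply: le_trans hz; rewrite lerD2l normc_Sx.
rewrite -[D^-1]mul1r ler_pdivrMr // -e; apply: ler_wpM2l => //; exact: normc_ge0.
Qed.

Lemma m_eq z j : complex.Im z != 0 -> mz z j * (z + apply_cmx S (mz z) j) = -1.
Proof.
move=> z0; have := qve_sign qm z0 j.
have := qve_eq qm z0 j; rewrite -/(mz z j) -[X in _ = z + X]/(apply_cmx S (mz z) j) => <-.
move=> sgn; rewrite mulrN mulfV //; apply/eqP => e.
by move: sgn; rewrite -/(mz z j) e /= mul0r ltxx.
Qed.

Lemma qve_at_upper D z : qve_const <= D -> normc z + Csup * Cm <= D ->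
  0 < complex.Im z -> qve_at D S z (mz z).
Proof.
move=> hD hz zI; have z0 : complex.Im z != 0 by rewrite gt_eqF.
apply: qve_at_intro => //; last exact: ltW.
- by move=> j; exact: m_eq.
- by move=> j; exact: Cm_m.
by move=> j; have := qve_sign qm z0 j; rewrite pmulr_lgt0 // => /ltW.
Qed.

Lemma qve_at_lower D z : qve_const <= D -> normc z + Csup * Cm <= D ->
  complex.Im z < 0 -> qve_at D S (conjc z) (fun j => conjc (mz z j)).
Proof.
move=> hD hz zI; have z0 : complex.Im z != 0 by rewrite lt_eqF.
apply: qve_at_intro => //.
- by rewrite normc_conj.
- move=> j.
  have -> : apply_cmx S (fun k => conjc (mz z k)) j = conjc (apply_cmx S (mz z) j).
    rewrite /apply_cmx rmorph_sum; apply: eq_bigr => k _.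
    by rewrite rmorphM /= oppr0.
  by rewrite -rmorphD -rmorphM m_eq // rmorphN rmorph1.
- by move=> j; rewrite normc_conj; exact: Cm_m.
- move=> j; have := qve_sign qm z0 j; rewrite nmulr_lgt0 // -/(mz z j).
  by case: (mz z j) => a b /= /ltW; rewrite oppr_ge0.
by move: zI; case: (z) => a b /= /ltW; rewrite oppr_ge0.
Qed.

Lemma m_continuous1 (z0 : R[i]) (e : R) j : 0 <= complex.Im z0 -> 0 < e ->
  exists d : R, 0 < d /\ forall z, 0 <= complex.Im z -> normc (z - z0) < d ->
    normc (m z j 0 - m z0 j 0) <= e.
Proof.
move=> z0A e0.
have /subspace_continuousP := @qve_boundary _ _ _ _ qm j.
move=> /(_ z0 z0A) /cvgrPdist_le /(_ e%:C); rewrite ltcR => /(_ e0).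
rewrite near_withinE => /nbhs_ballP [d /= d0 h].
(* Radii in the topology of [R[i]] are complex; being positive, this one is real. *)
have dE : d = (complex.Re d)%:C.
  by move: d0; case: (d) => a b; rewrite ltcE /= => /andP[/eqP -> _].
rewrite dE ltcR in d0.
exists (complex.Re d); split => // z zA zd.
have := h z; rewrite -ball_normE /= => /(_ _ zA).
rewrite normc_norm -normcN opprB normc_norm {1}dE ltcR.
by move=> /(_ zd); rewrite lecR -normcN opprB.
Qed.

Lemma m_continuous (z0 : R[i]) (e : R) : 0 <= complex.Im z0 -> 0 < e ->
  exists d : R, 0 < d /\ forall z, 0 <= complex.Im z -> normc (z - z0) < d ->
    forall j, normc (mz z j - mz z0 j) <= e.
Proof.
move=> z0A e0.
have [dl hd] := choice (fun j => m_continuous1 j z0A e0).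
exists (\big[Num.min/1]_j dl j); split.
  by apply/bigmin_gtP; split => // j _; have [] := hd j.
move=> z zA zd j; have [_] := hd j; apply => //.
by apply: (lt_le_trans zd); exact: bigmin_le.
Qed.

Lemma normc_imag (E eta : R) : 0 <= eta -> normc ((E +i* eta) - E%:C) = eta.
Proof. by move=> h; rewrite /= subrr subr0 expr0n add0r sqrtr_sqr ger0_norm. Qed.

Lemma qve_at_real D (E : R) : qve_const <= D -> `|E| + 1 + Csup * Cm <= D ->
  qve_at D S E%:C (mz E%:C).
Proof.
move=> hD hE; apply: qve_at_closed.
- by apply: le_trans qve_const_ge1 hD.
- exact: N_gt0.
- exact: S_bnd.
move=> e e0.
have [d [d0 hd]] := @m_continuous E%:C e (lexx _) e0.
pose eta := Num.min (Num.min e (d / 2)) 1.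
have d20 : 0 < d / 2 by rewrite divr_gt0.
have eta0 : 0 < eta by rewrite !lt_min e0 d20 ltr01.
have etae : eta <= e by rewrite !ge_min lexx.
have etad : eta < d.
  apply: (@le_lt_trans _ _ (d / 2)); first by rewrite !ge_min lexx !orbT.
  by rewrite ltr_pdivrMr // ltr_pMr // ltr1n.
have eta1 : eta <= 1 by rewrite ge_min lexx orbT.
exists (E +i* eta), (mz (E +i* eta)); split.
- apply: qve_at_upper => //; apply: le_trans hE; rewrite lerD2r.
  have -> : (E +i* eta) = E%:C + ((E +i* eta) - E%:C) by ring.
  apply: (le_trans (normcD _ _)); rewrite (normc_imag _ (ltW eta0)) normc_real.
  by rewrite lerD2l.
- by rewrite -normcN opprB (normc_imag _ (ltW eta0)).
move=> j; rewrite -normcN opprB; apply: hd; first exact: ltW.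
by rewrite (normc_imag _ (ltW eta0)).
Qed.

Lemma rhoE z : rho m z = pi^-1 * Imean (mz z).
Proof. by rewrite /rho /avg /Imean; congr (_ * (_ * _)); apply: eq_bigr => j _; rewrite mxE. Qed.

(** Otherwise |m_j| (Csup + 1) <= 1, and averaging Im m = |m|^2 S Im m gives a positive mean at most
    Csup / (Csup + 1)^2 times itself. *)
Lemma rho_support (E : R) : rho m E%:C != 0 -> `|E| <= edge_bound.
Proof.
move=> rE; rewrite leNgt; apply/negP => hE.
pose D := qve_const + (`|E| + 1 + Csup * Cm).
have C1 := qve_const_ge1; have nE := normr_ge0 E; have cc := CC.
have hD1 : qve_const <= D by rewrite /D; lra.
have hD2 : `|E| + 1 + Csup * Cm <= D by rewrite /D; lra.
have D1 : 1 <= D := le_trans C1 hD1.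
have q := qve_at_real hD1 hD2.
have I0 : 0 < Imean (mz E%:C).
  rewrite lt_def; apply/andP; split.
    by apply: contraNneq rE => e; rewrite rhoE e mulr0.
  rewrite mulr_ge0 ?invr_ge0 ?ler0n //; apply: sumr_ge0 => j _; exact: qve_at_Im q j.
pose x := mz E%:C.
(* [assumptionC] speaks of nonreal points; the bound reaches [E] by continuity from above. *)
have xC j : normc (x j) <= Cm.
  apply/ler_addgt0Pr => e e0.
  have [d [d0 hd]] := @m_continuous E%:C e (lexx _) e0.
  have d20 : 0 < d / 2 by rewrite divr_gt0.
  have dd : d / 2 < d by rewrite ltr_pdivrMr // ltr_pMr // ltr1n.
  have := hd (E +i* (d / 2)) (ltW d20); rewrite (normc_imag _ (ltW d20)) => /(_ dd j).
  rewrite -normcN opprB -/(x j) => h.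
  have -> : x j = mz (E +i* (d / 2)) j + (x j - mz (E +i* (d / 2)) j) by ring.
  apply: (le_trans (normcD _ _)); apply: lerD => //; apply: Cm_m.
  by rewrite gt_eqF.
have n_le j : normc (x j) * (Csup + 1) <= 1.
  have e : normc (x j) * normc (E%:C + apply_cmx S x j) = 1.
    by rewrite -normcM (qve_at_eq q j) normcN normc1.
  rewrite -[leRHS]e; apply: ler_wpM2l; first exact: normc_ge0.
  have h : `|E| <= normc (E%:C + apply_cmx S x j) + Csup * Cm.
    rewrite -normc_real.
    have {1}-> : E%:C = (E%:C + apply_cmx S x j) - apply_cmx S x j by ring.
    by apply: (le_trans (normcB _ _)); rewrite lerD2l normc_Sx.
  rewrite -(lerD2r (Csup * Cm)); apply: le_trans h; apply: ltW.
  by have -> : Csup + 1 + Csup * Cm = edge_bound by rewrite /edge_bound; ring.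
have Cs1 : 0 < Csup + 1 by rewrite addr_gt0.
have Im_le j : complex.Im (x j) * (Csup + 1) ^+ 2 <= Csup * Imean x.
  have -> : complex.Im (x j) = normc (x j) ^+ 2 * (\sum_k S j k * complex.Im (x k)).
    by rewrite (qve_Im q) /= add0r.
  have SI : \sum_k S j k * complex.Im (x k) <= Csup * Imean x.
    rewrite /Imean mulrA mulr_sumr; apply: ler_sum => k _; apply: ler_wpM2r.
      exact: qve_at_Im q k.
    by have /andP[] := S_cC j k.
  have SI0 : 0 <= \sum_k S j k * complex.Im (x k).
    by apply: sumr_ge0 => k _; rewrite mulr_ge0 // (qve_at_Im q k).
  rewrite mulrAC -exprMn -[leRHS]mul1r; apply: ler_pM => //; first exact: sqr_ge0.
  by rewrite expr_le1 // mulr_ge0 ?normc_ge0 // ltW.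
have : Imean x * (Csup + 1) ^+ 2 <= Csup * Imean x.
  rewrite {1}/Imean -mulrA mulr_suml ler_pdivrMl //.
  have -> : N%:R * (Csup * Imean x) = \sum_(j < N) Csup * Imean x.
    by rewrite sumr_const card_ord mulr_natl.
  exact: ler_sum.
rewrite mulrC ler_pM2r // leNgt => /negP; apply.
have h1 := Csup_gt0; have := sqr_ge0 Csup; rewrite sqrrD expr1n mulr1; lra.
Qed.

End QveSolution.

(** * Construction of [f] and the Hoelder bound at a singular point *)

Section Edge.
Context {R : realType} {N : nat}.
Variables (cinf Csup Cm : R) (S : 'M[R]_N) (m : R[i] -> 'cV[R[i]]_N).
Hypotheses (cinf_gt0 : 0 < cinf) (Csup_gt0 : 0 < Csup) (Cm_gt0 : 0 < Cm).
Hypotheses (N_gt0 : (0 < N)%N) (symS : forall j k, S j k = S k j).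
Hypothesis S_cC : forall j k, cinf / N%:R <= S j k <= Csup / N%:R.
Hypotheses (qm : qve_solution S m) (Cm_m : assumptionC Cm m).
Variable E0 : R.
Hypothesis E0_sing : frakS m E0.

Let mz (z : R[i]) (j : 'I_N) : R[i] := m z j 0.
Let K1 := edge_bound Csup Cm.
Let D := qve_const cinf Csup Cm.
Let CC : 0 < Csup * Cm. Proof. exact: mulr_gt0. Qed.
Let D_ge1 : 1 <= D. Proof. exact: qve_const_ge1. Qed.
Let D_gt0 : 0 < D. Proof. exact: lt_le_trans D_ge1. Qed.
Let SD : forall j k, D^-1 / N%:R <= S j k <= D / N%:R.
Proof. exact: (S_bnd cinf_gt0 Csup_gt0 Cm_gt0 N_gt0 S_cC). Qed.

Let radius (r : R) : r <= K1 + 4 -> r + Csup * Cm <= D.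
Proof.
have h1 := Csup_gt0; have h2 := Cm_gt0.
have ci : 0 < cinf^-1 by rewrite invr_gt0.
rewrite /D /qve_const -/K1; move: K1 (cinf^-1) (Csup * Cm) ci => k c d c0; lra.
Qed.

Let D_le : qve_const cinf Csup Cm <= D. Proof. exact: lexx. Qed.

Let q_upper z : normc z <= K1 + 4 -> 0 < complex.Im z -> qve_at D S z (mz z).
Proof.
move=> hz; apply: (qve_at_upper cinf_gt0 Csup_gt0 Cm_gt0 N_gt0 S_cC qm Cm_m D_le).
exact: radius.
Qed.

Let q_lower z : normc z <= K1 + 4 -> complex.Im z < 0 ->
  qve_at D S (conjc z) (fun j => conjc (mz z j)).
Proof.
move=> hz; apply: (qve_at_lower cinf_gt0 Csup_gt0 Cm_gt0 N_gt0 S_cC qm Cm_m D_le).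
exact: radius.
Qed.

Let q_real E : `|E| <= K1 + 3 -> qve_at D S E%:C (mz E%:C).
Proof.
move=> hE; apply: (qve_at_real cinf_gt0 Csup_gt0 Cm_gt0 N_gt0 S_cC qm Cm_m D_le); apply: radius.
by move: hE; lra.
Qed.

Lemma edge_approx (e : R) : 0 < e -> exists E : R,
  [/\ rho m E%:C != 0, `|E| <= K1, `|E - E0| < e &
      forall j, normc (mz E%:C j - mz E0%:C j) <= e].
Proof.
move=> e0; have [d [d0 hd]] := m_continuous qm (z0 := E0%:C) (lexx _) e0.
have [cl _] := E0_sing.
have B0 : nbhs E0 (ball E0 (Num.min d e)).
  by apply: nbhsx_ballx; rewrite lt_min d0.
have [E [rE /=]] := cl _ B0.
rewrite -ball_normE /= lt_min distrC => /andP[Ed Ee].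
exists E; split => //; first exact: (rho_support cinf_gt0 Csup_gt0 Cm_gt0 N_gt0 S_cC qm Cm_m rE).
move=> j; apply: hd; first exact: lexx.
by rewrite -rmorphB normc_real.
Qed.

Let E0_bound : `|E0| <= K1 + 1.
Proof.
have [E [_ hE hEE _]] := edge_approx ltr01.
have -> : E0 = E - (E - E0) by ring.
by apply: (le_trans (ler_normB _ _)); apply: lerD => //; exact: ltW.
Qed.

Lemma qve_at_edge : qve_at D S E0%:C (mz E0%:C).
Proof. by apply: q_real; have := E0_bound; move: K1 => k; lra. Qed.

Lemma Im_edge j : complex.Im (mz E0%:C j) = 0.
Proof.
have [_ /= r0] := E0_sing.
have nV : (N%:R : R)^-1 != 0 by rewrite invr_eq0 pnatr_eq0 -lt0n.
have pV : (pi : R)^-1 != 0 by rewrite invr_eq0 gt_eqF // pi_gt0.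
move: r0; rewrite rhoE => /eqP; rewrite mulf_eq0 (negbTE pV) /= mulf_eq0 (negbTE nV) /=.
rewrite psumr_eq0; last by move=> k _; exact: (qve_at_Im qve_at_edge k).
by move=> /allP /(_ j); rewrite mem_index_enum => /(_ isT) /eqP.
Qed.

Let Imean_ge0 z : qve_at D S z (mz z) -> 0 <= Imean (mz z).
Proof.
move=> q; rewrite mulr_ge0 ?invr_ge0 ?ler0n //.
by apply: sumr_ge0 => j _; exact: qve_at_Im q j.
Qed.

Let Imean_real E : rho m E%:C != 0 -> `|E| <= K1 -> 0 < Imean (mz E%:C).
Proof.
move=> rE hE; rewrite lt_def Imean_ge0 ?andbT; last first.
  by apply: q_real; apply: (le_trans hE); rewrite lerDl.
by apply: contraNneq rE => e; rewrite rhoE -/mz e mulr0.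
Qed.

Let Imean_upper z : normc z <= K1 + 4 -> 0 < complex.Im z -> 0 < Imean (mz z).
Proof.
move=> hz zI; have q := q_upper hz zI.
rewrite mulr_gt0 ?invr_gt0 ?ltr0n // (bigD1 (Ordinal N_gt0)) //= ltr_wpDr //.
  by apply: sumr_ge0 => j _; exact: qve_at_Im q j.
have /andP[h _] := qve_Im_bounds D_ge1 SD q (Ordinal N_gt0).
apply: lt_le_trans h; rewrite divr_gt0 ?exprn_gt0 // ltr_wpDr //.
exact: Imean_ge0 q.
Qed.

Let lo := (D ^+ 4)^-1.
Let hi := D ^+ 7.
Let lo_gt0 : 0 < lo. Proof. by rewrite invr_gt0 exprn_gt0. Qed.
Let Cc := close_const D lo hi.

(* At a real [E] in the bulk the kernel [|m| S |m|] has the exact eigenvector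
   [gvec]; comparing with it gives the Cauchy criterion for the limit that
   defines [fvec]. *)
Lemma gvec_close z E e : normc z <= K1 + 4 -> 0 < complex.Im z ->
  rho m E%:C != 0 -> `|E| <= K1 -> (forall j, normc (mz z j - mz E%:C j) <= e) ->
  forall j, `|gvec (mz z) j - gvec (mz E%:C) j| <= Cc * e.
Proof.
move=> hz zI rE hE he j.
have hE3 : `|E| <= K1 + 3 by apply: (le_trans hE); rewrite lerDl.
have q := q_upper hz zI; have qE := q_real hE3.
have I0 := Imean_upper hz zI; have IE := Imean_real rE hE.
have gb k := gvec_bounds D_ge1 N_gt0 SD q I0 k.
have gbE k := gvec_bounds D_ge1 N_gt0 SD qE IE k.
apply: (@eigenvector_close _ _ D S D_ge1 N_gt0 symS SD lo hi e
  (complex.Im z / Imean (mz z)) N%:R (mz E%:C) (mz z)) => //.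
- by rewrite divr_ge0 // ltW.
- exact: qve_at_bnd qE.
- exact: qve_at_bnd q.
- move=> k; have /andP[g1 g2] := gb k; rewrite ger0_norm //.
  by apply: le_trans g1; exact: ltW.
- move=> k; rewrite (mS_gvec D_ge1 qE IE) /= mul0r mul0r subr0 //.
- by move=> k; exact: (mS_gvec D_ge1 q I0).
- exact: (gvec_avg D_ge1 N_gt0 qE IE).
exact: (gvec_avg D_ge1 N_gt0 q I0).
Qed.

Let G (j : 'I_N) (eta : R) : R := (rho m (E0 +i* eta))^-1 *
    (complex.Im (m (E0 +i* eta) j 0) / normc (m (E0 +i* eta) j 0)).

Let GE j eta : G j eta = pi * gvec (mz (E0 +i* eta)) j.
Proof. by rewrite /G rhoE /gvec -/mz /mz !invfM invrK; ring. Qed.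

Let pi0 : 0 < (pi : R). Proof. exact: pi_gt0. Qed.

(** One point [E] of positive density serves all small [eta], so the values of [G] lie close to a
    common number, as [cauchyP] requires. *)
Lemma G_near e : 0 < e -> exists E : R,
  [/\ rho m E%:C != 0, `|E| <= K1,
      forall j, normc (mz E%:C j - mz E0%:C j) <= e &
      forall j, \forall eta \near 0^'+, `|G j eta - pi * gvec (mz E%:C) j| <= e].
Proof.
move=> e0.
pose C' := `|Cc| + 1; have C'0 : 0 < C' by rewrite ltr_pwDr.
(* The 2 accounts for comparing m(E0 + i eta) with m(E) through m(E0). *)
pose e1 := Num.min e (e / (pi * C' * 2)).
have e10 : 0 < e1 by rewrite lt_min e0 divr_gt0 // !mulr_gt0.
have e1e : e1 <= e by rewrite ge_min lexx.
have e1C : pi * (C' * (2 * e1)) <= e.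
  have : e1 <= e / (pi * C' * 2) by rewrite ge_min lexx orbT.
  rewrite ler_pdivlMr ?mulr_gt0 // => h; apply: le_trans h.
  by rewrite le_eqVlt; apply/orP; left; apply/eqP; ring.
have [E [rE hE _ hEE]] := edge_approx e10.
exists E; split => // [j|j]; first exact: le_trans e1e.
have [d [d0 hd]] := m_continuous qm (z0 := E0%:C) (lexx _) e10.
near=> eta.
have eta0 : 0 < eta by near: eta; exact: nbhs_right_gt.
have etad : eta < d by near: eta; exact: nbhs_right_lt.
have eta1 : eta <= 1 by near: eta; exact: nbhs_right_ltW.
have hz : normc (E0 +i* eta) <= K1 + 4.
  have -> : (E0 +i* eta) = E0%:C + ((E0 +i* eta) - E0%:C) by ring.
  apply: (le_trans (normcD _ _)); rewrite (normc_imag _ (ltW eta0)) normc_real.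
  by have := E0_bound; move: eta1; lra.
have near2 k : normc (mz (E0 +i* eta) k - mz E%:C k) <= 2 * e1.
  have h1 := hd (E0 +i* eta) (ltW eta0); rewrite (normc_imag _ (ltW eta0)) in h1.
  apply: (le_trans (normc_triangle _ (mz E0%:C k) _)).
  have -> : 2 * e1 = e1 + e1 by ring.
  by apply: lerD; [exact: h1 | rewrite -normcN opprB].
rewrite GE -mulrBr normrM ger0_norm ?(ltW pi0) //.
apply: le_trans e1C; apply: ler_wpM2l; first exact: ltW.
apply: (le_trans (gvec_close hz eta0 rE hE near2 j)).
apply: ler_wpM2r; first by rewrite mulr_ge0 // ltW.
by rewrite /C'; apply: (le_trans (ler_norm _)); rewrite lerDl.
Unshelve. all: by end_near.
Qed.

Let G_cvg j : cvg (G j eta @[eta --> 0^'+]).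
Proof.
apply/cauchy_cvgP/cauchyP => e e0.
have e20 : 0 < e / 2 by rewrite divr_gt0.
have [E [_ _ _ /(_ j) hG]] := G_near e20.
exists (pi * gvec (mz E%:C) j); near=> eta.
rewrite -ball_normE /= distrC; apply: (@le_lt_trans _ _ (e / 2)).
  by near: eta.
by rewrite ltr_pdivrMr // ltr_pMr // ltr1n.
Unshelve. all: by end_near.
Qed.

(** Transfers exact facts from real points of positive density to [f]: there Im z = 0, so [gvec] is
    an eigenvector without defect and has the sharper bounds of [gvec_bounds_real]. *)
Lemma fvec_approx e : 0 < e -> exists E : R,
  [/\ rho m E%:C != 0, `|E| <= K1,
      forall j, normc (mz E%:C j - mz E0%:C j) <= e &
      forall j, `|fvec m E0 j 0 - pi * gvec (mz E%:C) j| <= e].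
Proof.
move=> e0; have e20 : 0 < e / 2 by rewrite divr_gt0.
have ee : e / 2 <= e by rewrite ler_pdivrMr // ler_pMr // ler1n.
have [E [rE hE hEE hG]] := G_near e20; exists E; split => // j.
  exact: le_trans ee.
rewrite mxE -/(G j).
have /cvgrPdist_le := @G_cvg j; move=> /(_ _ e20) hl.
have FF : ProperFilter (0 : R)^'+ by exact: at_right_proper_filter.
have [eta [h1 h2]] := @filter_ex _ _ FF _ (filterI hl (hG j)).
have -> : lim (G j @ 0^'+) - pi * gvec (mz E%:C) j =
   (lim (G j @ 0^'+) - G j eta) + (G j eta - pi * gvec (mz E%:C) j) by ring.
by apply: (le_trans (ler_normD _ _)); rewrite [leRHS]splitr; exact: lerD.
Qed.

Lemma fvec_bounds j : pi * lo <= fvec m E0 j 0 <= pi * D ^+ 4.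
Proof.
apply/andP; split; apply/ler_addgt0Pr => e e0;
have [E [rE hE _ /(_ j)]] := fvec_approx e0; rewrite ler_norml => /andP[h1 h2];
have hE3 : `|E| <= K1 + 3 by [apply: (le_trans hE); rewrite lerDl];
have /andP[g1 g2] := gvec_bounds_real D_ge1 SD (q_real hE3) (Imean_real rE hE) j erefl.
  have : pi * lo <= pi * gvec (mz E%:C) j by apply: ler_wpM2l => //; exact: ltW.
  by move: h1; lra.
have : pi * gvec (mz E%:C) j <= pi * D ^+ 4 by apply: ler_wpM2l => //; exact: ltW.
by move: h2; lra.
Qed.

Lemma mS_fvec j : apply_mx (mS S (mz E0%:C)) (fun k => fvec m E0 k 0) j = fvec m E0 j 0.
Proof.
set f := fun k => fvec m E0 k 0; set M := mS S (mz E0%:C).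
apply/eqP; rewrite -subr_eq0 -normr_le0; apply/ler_addgt0Pr => e' e'0.
rewrite add0r.
pose C := D ^+ 3 + 2 * D ^+ 2 * (pi * D ^+ 4) + 1.
have C0 : 0 < C by rewrite ltr_pwDr // addr_ge0 // !(mulr_ge0, exprn_ge0) // ltW.
have e0 : 0 < e' / C by rewrite divr_gt0.
set e := e' / C in e0.
have e'E : e' = D ^+ 3 * e + 2 * D ^+ 2 * (pi * D ^+ 4) * e + e.
  transitivity (C * e); first by rewrite /e mulrCA mulfV ?mulr1 // gt_eqF.
  by rewrite /C; ring.
have [E [rE hE hEE hf]] := fvec_approx e0.
have hE3 : `|E| <= K1 + 3 by apply: (le_trans hE); rewrite lerDl.
have qE := q_real hE3; have IE := Imean_real rE hE.
pose g k := pi * gvec (mz E%:C) k.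
have Mg k : apply_mx (mS S (mz E%:C)) g k = g k.
  by rewrite apply_mxZ (mS_gvec D_ge1 qE IE) /= mul0r mul0r subr0.
have -> : apply_mx M f j - f j = apply_mx M (fun k => f k - g k) j +
   (apply_mx M g j - apply_mx (mS S (mz E%:C)) g j) + (g j - f j).
  by rewrite apply_mxB Mg; ring.
rewrite e'E; apply: (le_trans (ler_normD _ _)); apply: lerD; last by rewrite distrC; exact: hf.
apply: (le_trans (ler_normD _ _)); apply: lerD.
  have -> : D ^+ 3 * e = N%:R * (D ^+ 3 / N%:R * e).
    by field; rewrite pnatr_eq0 -lt0n.
  apply: norm_sum_le => k; rewrite normrM.
  have /andP[b1 b2] := mS_bounds D_ge1 N_gt0 SD (qve_at_bnd qve_at_edge) j k.
  apply: ler_pM => //; last exact: hf.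
  rewrite ger0_norm //; apply: le_trans b1.
  by rewrite divr_ge0 ?invr_ge0 ?ler0n // exprn_ge0 // ltW.
apply: (mS_diff_bound D_ge1 N_gt0 SD).
- exact: qve_at_bnd qve_at_edge.
- exact: qve_at_bnd qE.
- exact: hEE.
move=> k; have /andP[g1 g2] := gvec_bounds_real D_ge1 SD qE IE k erefl.
have g0 : 0 <= gvec (mz E%:C) k by apply: le_trans g1; exact: ltW.
rewrite /g (ger0_norm (mulr_ge0 (ltW pi0) g0)); apply: ler_wpM2l => //; exact: ltW.
Qed.

Lemma edge_holder z : complex.Im z != 0 -> normc (z - E0%:C) <= 1 ->
  forall j, normc (mz z j - mz E0%:C j) ^+ 3
    <= 36 * two_point_const D ^+ 3 * normc (z - E0%:C).
Proof.
move=> z0 t1 j; set t := normc (z - E0%:C).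
have t0 : 0 < t.
  rewrite normc_gt0; apply: contraNneq z0 => /eqP; rewrite subr_eq0 => /eqP ->.
  by rewrite eqxx.
(* At [E0] the [phase] degenerates, so [f] itself, rescaled, is the subsolution. *)
pose g k := pi^-1 * fvec m E0 k 0.
have g_bnd k : (D ^+ 4)^-1 <= g k <= D ^+ 4.
  by rewrite /g ler_pdivlMl // ler_pdivrMl //; exact: fvec_bounds.
have mSg k : apply_mx (mS S (mz E0%:C)) g k <= g k by rewrite apply_mxZ mS_fvec.
have key z' (x : 'I_N -> R[i]) : normc (z' - E0%:C) = t -> 0 < complex.Im z' ->
   qve_at D S z' x -> normc (x j - mz E0%:C j) ^+ 3 <= 36 * two_point_const D ^+ 3 * t.
  move=> tz' z'0 q.
  apply: (holder_third D_ge1 N_gt0 symS SD t0 tz' erefl z'0 q _ qve_at_edge g_bnd mSg).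
  apply: q_upper; last by rewrite cImD /= addr_gt0.
  have -> : z' + (0 +i* t) = E0%:C + ((z' - E0%:C) + (0 +i* t)) by ring.
  apply: (le_trans (normcD _ _)); rewrite normc_real.
  have h : normc ((z' - E0%:C) + (0 +i* t)) <= 2.
    apply: (le_trans (normcD _ _)); rewrite tz' /= expr0n /= add0r sqrtr_sqr gtr0_norm //.
    by move: t1; rewrite -/t; lra.
  by have := E0_bound; lra.
have hz : normc z <= K1 + 4.
  have -> : z = E0%:C + (z - E0%:C) by ring.
  apply: (le_trans (normcD _ _)); rewrite normc_real.
  by have := E0_bound; move: t1; lra.
have [zI|zI] := ltP 0 (complex.Im z).
  by apply: key => //; exact: q_upper.
have {}zI : complex.Im z < 0 by rewrite lt_def eq_sym z0.
(* Since m(E0) is real, conjugating m(z) keeps its distance to m(E0) and moves [z] to the upper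
   half-plane. *)
have real_edge : conjc (mz E0%:C j) = mz E0%:C j.
  by have := Im_edge j; case: (mz _ j) => a b /= ->; rewrite oppr0.
have -> : normc (mz z j - mz E0%:C j) = normc (conjc (mz z j) - mz E0%:C j).
  by rewrite -{2}real_edge -rmorphB normc_conj.
apply: (key (conjc z) (fun k => conjc (mz z k))).
- by rewrite -[E0%:C](conjc_real E0) -rmorphB normc_conj.
- by move: zI; case: (z) => a b /=; rewrite oppr_gt0.
exact: q_lower.
Qed.

End Edge.
(** * The spectral data at the singular point *)

Section Embedding.
Context {R : realType} {N : nat}.
Implicit Types (F : 'M[R]_N) (u : 'I_N -> R).

Lemma apply_cmx_real F u j : apply_cmx F (fun k => (u k)%:C) j = (apply_mx F u j)%:C.
Proof. by rewrite /apply_cmx /apply_mx rmorph_sum; apply: eq_bigr => k _; rewrite rmorphM. Qed.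

Lemma cmean_real u : cmean (fun j => (u j)%:C) = (N%:R^-1 * \sum_j u j)%:C.
Proof.
rewrite /cmean rmorphM rmorph_sum fmorphV rmorph_nat; congr (_ * _).
Qed.

Lemma dotE (x y : 'cV[R]_N) : dot x y = N%:R^-1 * \sum_j x j 0 * y j 0.
Proof. by rewrite /dot /avg; congr (_ * _); apply: eq_bigr => j _; rewrite mxE. Qed.

Lemma cdotE (x y : 'cV[R[i]]_N) : cdot x y = cmean (fun j => conjc (x j 0) * y j 0).
Proof. by rewrite /cdot /avg /cmean; congr (_ * _); apply: eq_bigr => j _; rewrite mxE. Qed.

Lemma eigenvalue_col (A : 'M[R[i]]_N) (la : R[i]) : eigenvalue A^T la <->
  exists x : 'I_N -> R[i], (exists j, x j != 0) /\
    forall j, \sum_k A j k * x k = la * x j.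
Proof.
split.
  move=> /eigenvalueP [v vA v0]; exists (fun j => v 0 j); split.
    apply: contrapT => H; move: v0; apply/negP; rewrite negbK; apply/eqP/rowP => j.
    by rewrite mxE; apply: contrapT => h; apply: H; exists j; apply/eqP.
  move=> j; have := congr1 (fun B : 'rV_N => B 0 j) vA; rewrite !mxE => <-.
  by apply: eq_bigr => k _; rewrite mxE mulrC.
move=> [x [[j xj] xA]]; apply/eigenvalueP; exists (\row_k x k).
  apply/rowP => k; rewrite !mxE -xA; apply: eq_bigr => l _.
  by rewrite !mxE mulrC.
by apply: contraNneq xj => /rowP /(_ j); rewrite !mxE => ->.
Qed.

End Embedding.

(** * The gap and solvability orthogonally to [f] *)

Section PerpSolve.
Context {R : realType} {N : nat}.
Variables (a lo hi b : R) (F : 'M[R]_N) (f : 'I_N -> R).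
Hypotheses (a_gt0 : 0 < a) (lo_gt0 : 0 < lo) (N_gt0 : (0 < N)%N).
Hypothesis symF : forall j k, F j k = F k j.
Hypothesis F_bnd : forall j k, a / N%:R <= F j k <= b / N%:R.
Hypothesis f_bnd : forall j, lo <= f j <= hi.
Hypothesis Ff : forall j, apply_mx F f j = f j.

Definition gap_const : R := 1 + b / (a * lo ^+ 2 / hi ^+ 2).

Lemma real_gap (r : R) y : \sum_j f j * y j = 0 ->
  (forall j, `|y j - apply_mx F y j| <= r) -> forall j, `|y j| <= gap_const * r.
Proof.
apply: (perp_sup_bound (kappa := 1) a_gt0 lo_gt0 N_gt0 symF) => //.
- by move=> j k; have /andP[] := F_bnd j k.
- by move=> j; rewrite Ff mul1r.
by move=> j k; have /andP[] := F_bnd j k.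
Qed.

(** The kernel is real, so real and imaginary parts decouple; adding their bounds gives the 2. *)
Lemma complex_gap (r : R) (y : 'I_N -> R[i]) : cmean (fun j => (f j)%:C * y j) = 0 ->
  (forall j, normc (y j - apply_cmx F y j) <= r) ->
  forall j, normc (y j) <= 2 * gap_const * r.
Proof.
move=> y0 hy j.
have nV : (N%:R : R[i])^-1 != 0 by rewrite invr_eq0 pnatr_eq0 -lt0n.
have S0 : \sum_j (f j)%:C * y j = 0.
  by move/eqP: y0; rewrite /cmean mulf_eq0 (negbTE nV) => /eqP.
apply: (le_trans (normc_le_ReIm _)).
have -> : 2 * gap_const * r = gap_const * r + gap_const * r by ring.
apply: lerD.
  apply: (real_gap (y := fun j => complex.Re (y j))) => [|k].
    have := congr1 (@complex.Re R) S0; rewrite Re_sum /= => {2}<-.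
    by apply: eq_bigr => k _; rewrite cReM /= mul0r subr0.
  rewrite -Re_apply_cmx -cReN -cReD; apply: le_trans (hy k); exact: normc_Re.
apply: (real_gap (y := fun j => complex.Im (y j))) => [|k].
  have := congr1 (@complex.Im R) S0; rewrite Im_sum /= => {2}<-.
  by apply: eq_bigr => k _; rewrite cImM /= mul0r addr0.
rewrite -Im_apply_cmx -cImN -cImD; apply: le_trans (hy k); exact: normc_Im.
Qed.

Let ff_gt0 : 0 < \sum_j f j * f j.
Proof.
have f0 j : 0 < f j by have /andP[h _] := f_bnd j; apply: lt_le_trans h.
rewrite (bigD1 (Ordinal N_gt0)) //= ltr_wpDr ?mulr_gt0 //.
by apply: sumr_ge0 => j _; rewrite mulr_ge0 // ltW.
Qed.

Let sum_range y : \sum_j f j * (y j - apply_mx F y j) = 0.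
Proof.
under eq_bigr do rewrite mulrBr.
rewrite sumrB apply_mx_sym //.
by under [X in _ - X]eq_bigr do rewrite Ff; rewrite subrr.
Qed.

(* [1 - F + f f^T] is injective by the gap, hence invertible. *)
Lemma perp_solvable (x : 'I_N -> R) : \sum_j f j * x j = 0 ->
  exists y : 'I_N -> R, \sum_j f j * y j = 0 /\
    forall j, y j - apply_mx F y j = x j.
Proof.
move=> fx0.
pose M : 'M[R]_N := \matrix_(j, k) ((j == k)%:R - F j k + f j * f k).
have ME (v : 'I_N -> R) j : \sum_k M j k * v k = (v j - apply_mx F v j) + f j * \sum_k f k * v k.
  have -> : v j = \sum_k (j == k)%:R * v k.
    by rewrite (bigD1 j) //= eqxx mul1r big1 ?addr0 // => k /negbTE; rewrite eq_sym => ->; rewrite mul0r.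
  rewrite /apply_mx mulr_sumr -sumrB -big_split; apply: eq_bigr => k _ /=.
  by rewrite mxE; ring.
have fM (v w : 'I_N -> R) : (forall j, \sum_k M j k * v k = w j) -> \sum_j f j * w j = 0 ->
    \sum_j f j * v j = 0.
  move=> Mv fw.
  have : \sum_j f j * w j = (\sum_j f j * f j) * \sum_k f k * v k.
    under eq_bigr do rewrite -Mv ME mulrDr.
    rewrite big_split /= sum_range add0r mulr_suml; apply: eq_bigr => j _; ring.
  by rewrite fw => /esym/eqP; rewrite mulf_eq0 gt_eqF // => /eqP.
have Msym : M^T = M by apply/matrixP => j k; rewrite !mxE eq_sym symF mulrC.
have Mu : M \in unitmx.
  rewrite -row_free_unit; apply: inj_row_free => v vM.
  have Mv j : \sum_k M j k * v 0 k = 0.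
    have := congr1 (fun B : 'rV_N => B 0 j) vM; rewrite !mxE => {2}<-.
    by apply: eq_bigr => k _; rewrite -{1}Msym mxE mulrC.
  have fv : \sum_j f j * v 0 j = 0.
    by apply: (fM _ (fun=> 0) Mv); rewrite big1 // => j _; rewrite mulr0.
  apply/rowP => j; rewrite [RHS]mxE; apply/eqP; rewrite -normr_le0.
  have := real_gap (r := 0) fv; rewrite mulr0; apply => k.
  by have := Mv k; rewrite ME fv mulr0 addr0 => ->; rewrite normr0.
pose y j := (invmx M *m (\col_k x k)) j 0.
have My j : \sum_k M j k * y k = x j.
  have := congr1 (fun B : 'cV_N => B j 0) (mulKVmx Mu (\col_k x k)).
  by rewrite !mxE.
have fy := fM _ _ My fx0.
by exists y; split => // j; rewrite -My ME fy mulr0 addr0.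
Qed.

End PerpSolve.

(** * The edge in coordinates relative to |m0| *)

Section EdgeData.
Context {R : realType} {N : nat}.
Variables (cinf Csup Cm : R) (S : 'M[R]_N) (m : R[i] -> 'cV[R[i]]_N).
Hypotheses (cinf_gt0 : 0 < cinf) (Csup_gt0 : 0 < Csup) (Cm_gt0 : 0 < Cm).
Hypotheses (N_gt0 : (0 < N)%N) (symS : forall j k, S j k = S k j).
Hypothesis S_cC : forall j k, cinf / N%:R <= S j k <= Csup / N%:R.
Hypotheses (qm : qve_solution S m) (Cm_m : assumptionC Cm m).
Variable E0 : R.
Hypothesis E0_sing : frakS m E0.

Definition f_lo (D : R) : R := pi * (D ^+ 4)^-1.
Definition f_hi (D : R) : R := pi * D ^+ 4.
Definition edge_gap (D : R) : R :=
  2 * gap_const (D ^+ 3)^-1 (f_lo D) (f_hi D) (D ^+ 3).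

Let D := qve_const cinf Csup Cm.
Let D_ge1 : 1 <= D. Proof. exact: qve_const_ge1. Qed.
Let D_gt0 : 0 < D. Proof. exact: lt_le_trans D_ge1. Qed.
Let SD : forall j k, D^-1 / N%:R <= S j k <= D / N%:R.
Proof. exact: (S_bnd cinf_gt0 Csup_gt0 Cm_gt0 N_gt0 S_cC). Qed.
Let mz (z : R[i]) (j : 'I_N) : R[i] := m z j 0.
Let q0 : qve_at D S E0%:C (mz E0%:C).
Proof. exact: (qve_at_edge cinf_gt0 Csup_gt0 Cm_gt0 N_gt0 S_cC qm Cm_m E0_sing). Qed.
Let I0 j : complex.Im (mz E0%:C j) = 0.
Proof. exact: (Im_edge cinf_gt0 Csup_gt0 Cm_gt0 N_gt0 S_cC qm Cm_m E0_sing). Qed.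
Let F := Fop S m E0.
Let f j := fvec m E0 j 0.
Let p j := pvec m E0 j 0.
Let am j := abs_m0 m E0 j 0.

Lemma m_edgeE j : mz E0%:C j = (m0 m E0 j 0)%:C.
Proof. by rewrite /m0 mxE -/(mz _ j); have := I0 j; case: (mz _ j) => x y /= ->. Qed.

Lemma abs_m0E j : am j = normc (mz E0%:C j).
Proof. by rewrite m_edgeE normc_real /am mxE. Qed.

Let am_bnd j : D^-1 <= am j <= D.
Proof. rewrite abs_m0E; exact: qve_at_bnd q0 j. Qed.

Let am_gt0 j : 0 < am j.
Proof. by have /andP[h _] := am_bnd j; apply: lt_le_trans h; rewrite invr_gt0. Qed.

Lemma m0_abs j : m0 m E0 j 0 = am j * p j.
Proof. by rewrite /am /p !mxE mulrC -numEsg. Qed.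

Let p_sqr j : p j ^+ 2 = 1.
Proof.
rewrite /p mxE sqr_sg; apply/eqP; rewrite pnatr_eq1 eqb1.
by apply: contraTneq (am_gt0 j) => e; rewrite m0_abs in e *; rewrite /am mxE m0_abs e normr0 ltxx.
Qed.

Lemma FopE : F = mS S (mz E0%:C).
Proof.
apply/matrixP => j k; rewrite /F /Fop mul_mx_diag mxE mul_diag_mx !mxE.
by rewrite -!abs_m0E /am !mxE.
Qed.

Let symF j k : F j k = F k j. Proof. by rewrite FopE mS_sym. Qed.
Let F_bnd j k : (D ^+ 3)^-1 / N%:R <= F j k <= D ^+ 3 / N%:R.
Proof. by rewrite FopE; apply: (mS_bounds D_ge1 N_gt0 SD); exact: qve_at_bnd q0. Qed.
Let f_bnd j : f_lo D <= f j <= f_hi D.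
Proof. exact: (fvec_bounds cinf_gt0 Csup_gt0 Cm_gt0 N_gt0 symS S_cC qm Cm_m E0_sing). Qed.
Let Ff j : apply_mx F f j = f j.
Proof. by rewrite FopE; exact: (mS_fvec cinf_gt0 Csup_gt0 Cm_gt0 N_gt0 symS S_cC qm Cm_m E0_sing). Qed.

Let a_gt0 : 0 < (D ^+ 3)^-1. Proof. by rewrite invr_gt0 exprn_gt0. Qed.
Let lo_gt0 : 0 < f_lo D.
Proof. by rewrite /f_lo mulr_gt0 ?pi_gt0 // invr_gt0 exprn_gt0. Qed.
Let nN : 0 < N%:R :> R. Proof. by rewrite ltr0n. Qed.

Let f_gt0 j : 0 < f j.
Proof. by have /andP[h _] := f_bnd j; apply: lt_le_trans h. Qed.

Let n2 := dot (fvec m E0) (fvec m E0).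

Let n2_ge : f_lo D ^+ 2 <= n2.
Proof.
rewrite /n2 dotE ler_pdivlMl //.
have -> : N%:R * f_lo D ^+ 2 = \sum_(j < N) f_lo D ^+ 2 by rewrite sumr_const card_ord mulr_natl.
apply: ler_sum => j _; have /andP[h _] := f_bnd j.
by rewrite expr2; apply: ler_pM => //; exact: ltW.
Qed.

Let n2_gt0 : 0 < n2.
Proof. by apply: lt_le_trans n2_ge; rewrite exprn_gt0. Qed.

Let q := inverse_on_perp (1%:M - F) (vvec m E0)
  (pf2 m E0 - dot (vvec m E0) (pf2 m E0) *: vvec m E0).

Let dot_vvec y : dot (vvec m E0) y = (Num.sqrt n2)^-1 * dot (fvec m E0) y.
Proof.
rewrite !dotE mulrCA; congr (_ * _); rewrite mulr_sumr; apply: eq_bigr => j _.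
by rewrite mxE mulrA.
Qed.

Let sqrt_n2 : Num.sqrt n2 != 0.
Proof. by rewrite gt_eqF // sqrtr_gt0. Qed.

Let pf2E j : pf2 m E0 j 0 = p j * f j ^+ 2. Proof. by rewrite mxE. Qed.

Let proj_pf2 j : (pf2 m E0 - dot (vvec m E0) (pf2 m E0) *: vvec m E0) j 0 =
  p j * f j ^+ 2 - sigma m E0 / n2 * f j.
Proof.
have s2 : Num.sqrt n2 ^+ 2 = n2 by rewrite sqr_sqrtr // ltW.
have sg : sigma m E0 = dot (fvec m E0) (pf2 m E0).
  by rewrite /sigma !dotE; congr (_ * _); apply: eq_bigr => k _; rewrite mulrC.
have vE : vvec m E0 j 0 = (Num.sqrt n2)^-1 * f j by rewrite mxE.
have -> : (pf2 m E0 - dot (vvec m E0) (pf2 m E0) *: vvec m E0) j 0 =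
    pf2 m E0 j 0 - dot (vvec m E0) (pf2 m E0) * vvec m E0 j 0 by rewrite !mxE.
rewrite dot_vvec vE pf2E sg -[in RHS]s2; field; exact: sqrt_n2.
Qed.

(** Solvability from [perp_solvable] excludes the default value of [inverse_on_perp]. The projection
    removes exactly sigma / <f^2> times [f]. *)
Let q_spec : dot (vvec m E0) q = 0 /\ forall j,
  q j 0 - apply_mx F (fun k => q k 0) j = p j * f j ^+ 2 - sigma m E0 / n2 * f j.
Proof.
have [y [fy yE]] : exists y : 'I_N -> R, \sum_j f j * y j = 0 /\
    forall j, y j - apply_mx F y j = p j * f j ^+ 2 - sigma m E0 / n2 * f j.
  apply: (perp_solvable a_gt0 lo_gt0 N_gt0 symF F_bnd f_bnd Ff).
  have e1 : \sum_j f j * (p j * f j ^+ 2) = N%:R * sigma m E0.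
    rewrite /sigma dotE mulrA mulfV ?gt_eqF // mul1r; apply: eq_bigr => j _.
    by rewrite pf2E -/(f j); ring.
  have e2 : \sum_j f j * f j = N%:R * n2.
    by rewrite /n2 dotE mulrA mulfV ?gt_eqF // mul1r.
  have -> : \sum_j f j * (p j * f j ^+ 2 - sigma m E0 / n2 * f j) =
     \sum_j f j * (p j * f j ^+ 2) - sigma m E0 / n2 * \sum_j f j * f j.
    by rewrite mulr_sumr -sumrB; apply: eq_bigr => j _; ring.
  by rewrite e1 e2; field; rewrite gt_eqF.
have mulE (w : 'cV[R]_N) j : ((1%:M - F) *m w) j 0 = w j 0 - apply_mx F (fun k => w k 0) j.
  by rewrite mulmxBl mul1mx !mxE.
have : [set w | dot (vvec m E0) w = 0 /\ (1%:M - F) *m w =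
    pf2 m E0 - dot (vvec m E0) (pf2 m E0) *: vvec m E0] q.
  apply: xgetPex; exists (\col_j y j); split.
    rewrite dot_vvec dotE; under eq_bigr do rewrite mxE.
    by rewrite fy !mulr0.
  apply/colP => j; rewrite proj_pf2 mulE mxE -yE; congr (_ - _).
  by apply: eq_bigr => k _; rewrite mxE.
move=> [q1 q2]; split => // j.
by rewrite -proj_pf2 -mulE q2.
Qed.

Let B := f_lo D ^- 2.

Lemma edge_spectral_data : spectral_data (f_hi D) (edge_gap D) (D ^+ 3) B F
  (fun j => (f j)%:C) (fun j => (p j)%:C) (fun j => (q j 0)%:C) n2%:C (sigma m E0)%:C.
Proof.
have [q_perp qE] := q_spec.
split => //.
- move=> j k; have /andP[h1 h2] := F_bnd j k; rewrite ger0_norm //.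
  by apply: le_trans h1; rewrite divr_ge0 ?(ltW a_gt0) // ltW.
- by move=> j; rewrite normc_real gtr0_norm //; have /andP[] := f_bnd j.
- by move=> j; rewrite -rmorphXn /= p_sqr.
- by move=> j; rewrite apply_cmx_real Ff.
- by rewrite /n2 dotE -cmean_real; apply: eq_cmean => j; rewrite rmorphM.
- by rewrite -[0](rmorph0 (real_complex R)) (inj_eq (@complexI R)) gt_eqF.
- rewrite -fmorphV normc_real ger0_norm ?invr_ge0 ?(ltW n2_gt0) //.
  by rewrite /B lef_pV2 ?posrE ?exprn_gt0.
- move=> y r y0 hy; exact: (complex_gap a_gt0 lo_gt0 N_gt0 symF F_bnd f_bnd Ff y0 hy).
- rewrite /sigma dotE -cmean_real; apply: eq_cmean => j.
  by rewrite -rmorphXn -rmorphM /=; congr (_%:C); rewrite pf2E -/(f j); ring.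
- have : dot (fvec m E0) q = 0.
    move: q_perp; rewrite dot_vvec => /eqP; rewrite mulf_eq0 invr_eq0 (negbTE sqrt_n2) /=.
    by move/eqP.
  rewrite dotE => e; under eq_fun do rewrite -rmorphM /=.
  by rewrite cmean_real e.
move=> j; rewrite apply_cmx_real -rmorphB qE !(rmorphB, rmorphM, fmorphV, rmorphXn) //=.
Qed.

Lemma psi_cmean : (psi S m E0)%:C =
  cmean (fun j => (p j)%:C * (f j)%:C ^+ 2 * ((q j 0)%:C + apply_cmx F (fun k => (q k 0)%:C) j)).
Proof.
rewrite /psi dotE -cmean_real; apply: eq_cmean => j.
rewrite apply_cmx_real -rmorphD -rmorphXn -!rmorphM; congr (_%:C).
rewrite -/q mulmxDl mul1mx pf2E; congr (_ * _); by rewrite !mxE.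
Qed.

Definition rel_shift (z : R[i]) (j : 'I_N) : R[i] :=
  ((abs_m0 m E0 j 0)^-1)%:C * (m z j 0 - (m0 m E0 j 0)%:C).

Lemma m_shift z j : mz z j = (am j)%:C * ((p j)%:C + rel_shift z j).
Proof.
rewrite /rel_shift mulrDr mulrA -!rmorphM /= -m0_abs mulfV ?gt_eqF //.
by rewrite mul1r addrC subrK.
Qed.

(** The weights |m0| of the left and right eigenvectors cancel in these coordinates, so [xi] is the
    plain coefficient of the shift along [f]. *)
Lemma xiE z : xi m E0 z = cmean (fun j => (f j)%:C * rel_shift z j) / n2%:C.
Proof.
rewrite /xi !cdotE; congr (_ / _).
  apply: eq_cmean => j; rewrite !mxE -/(am j) conjc_real rmorphM /=.
  by rewrite /rel_shift /f /am !mxE; ring.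
rewrite /n2 dotE -cmean_real; apply: eq_cmean => j.
rewrite !mxE conjc_real -rmorphM; congr (_%:C).
rewrite /= -/(f j); have := am_gt0 j; rewrite /am mxE mxE => h.
by field; rewrite gt_eqF.
Qed.

(** Subtracting the equations at [z] and [E0] and dividing by |m0| gives h = (1 + p h) ((z - E0)
    |m0| + F h); the sign of Im z does not matter. *)
Lemma rel_shift_eq z j : complex.Im z != 0 ->
  rel_shift z j - apply_cmx F (rel_shift z) j =
  (p j)%:C * (rel_shift z j * apply_cmx F (rel_shift z) j) +
  (1 + (p j)%:C * rel_shift z j) * ((z - E0%:C) * (am j)%:C).
Proof.
move=> z0; set h := rel_shift z.
have e1 : mz z j * (z + apply_cmx S (mz z) j) = -1 := m_eq qm j z0.
have e2 : mz E0%:C j * (E0%:C + apply_cmx S (mz E0%:C) j) = -1 := qve_at_eq q0 j.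
have m0E k : mz E0%:C k = (am k)%:C * (p k)%:C by rewrite m_edgeE m0_abs rmorphM.
have Sh : (am j)%:C * (apply_cmx S (mz z) j - apply_cmx S (mz E0%:C) j) = apply_cmx F h j.
  rewrite -apply_cmxB /apply_cmx mulr_sumr; apply: eq_bigr => k _.
  by rewrite m_shift m0E FopE mxE -!abs_m0E !rmorphM /= -/h; ring.
have a0 : (am j)%:C != 0 by rewrite -[0](rmorph0 (real_complex R)) (inj_eq (@complexI R)) gt_eqF.
have pp : (p j)%:C * (p j)%:C = 1 by rewrite -rmorphM -expr2 p_sqr.
have u : mz z j - mz E0%:C j = mz z j * mz E0%:C j *
   ((z - E0%:C) + (apply_cmx S (mz z) j - apply_cmx S (mz E0%:C) j)).
  transitivity (mz E0%:C j * (mz z j * (z + apply_cmx S (mz z) j))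
     - mz z j * (mz E0%:C j * (E0%:C + apply_cmx S (mz E0%:C) j))); last by ring.
  by rewrite e1 e2; ring.
have hE : h j = (1 + (p j)%:C * h j) * ((z - E0%:C) * (am j)%:C + apply_cmx F h j).
  apply: (mulfI a0).
  transitivity (mz z j - mz E0%:C j); first by rewrite m_shift m0E -/h; ring.
  rewrite u -Sh {1}m_shift m0E -/h.
  transitivity ((am j)%:C * (((p j)%:C * (p j)%:C) + (p j)%:C * h j) * ((z - E0%:C) * (am j)%:C +
    (am j)%:C * (apply_cmx S (mz z) j - apply_cmx S (mz E0%:C) j))); first by ring.
  by rewrite pp; ring.
by rewrite {1}hE; ring.
Qed.

(** Conjugation by the diagonal of |m0|. As p^2 = 1, (p + h)(p + k) = (1 + p h)(1 + p k). *)
Lemma stability_eigen z zeta la :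
  eigenvalue (stability_op S m z zeta)^T la <->
  exists x : 'I_N -> R[i], (exists j, x j != 0) /\ forall j,
    x j - (1 + (p j)%:C * rel_shift z j) * (1 + (p j)%:C * rel_shift zeta j)
        * apply_cmx F x j = la * x j.
Proof.
have a0 j : (am j)%:C != 0.
  by rewrite -[0](rmorph0 (real_complex R)) (inj_eq (@complexI R)) gt_eqF.
have pp j : (p j)%:C * (p j)%:C = 1 by rewrite -rmorphM -expr2 p_sqr.
have opE x j : \sum_k stability_op S m z zeta j k * x k =
    x j - mz z j * mz zeta j * apply_cmx S x j.
  have -> : x j = \sum_k (j == k)%:R * x k.
    by rewrite (bigD1 j) //= eqxx mul1r big1 ?addr0 // => k /negbTE; rewrite eq_sym => ->; rewrite mul0r.
  rewrite /apply_cmx mulr_sumr -sumrB; apply: eq_bigr => k _.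
  rewrite /stability_op -mulmxA !mul_diag_mx !mxE /mz; ring.
have key x j : (x j - (1 + (p j)%:C * rel_shift z j) * (1 + (p j)%:C * rel_shift zeta j)
        * apply_cmx F x j) * (am j)%:C =
    (am j)%:C * x j - mz z j * mz zeta j * apply_cmx S (fun k => (am k)%:C * x k) j.
  have -> : apply_cmx F x j = (am j)%:C * apply_cmx S (fun k => (am k)%:C * x k) j.
    rewrite /apply_cmx mulr_sumr; apply: eq_bigr => k _.
    by rewrite FopE mxE -!abs_m0E !rmorphM /=; ring.
  rewrite !m_shift.
  have -> : (am j)%:C * ((p j)%:C + rel_shift z j) * ((am j)%:C * ((p j)%:C + rel_shift zeta j))
    = (am j)%:C * (am j)%:C * ((1 + (p j)%:C * rel_shift z j) * (1 + (p j)%:C * rel_shift zeta j)).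
    have e w : (p j)%:C + rel_shift w j = (p j)%:C * (1 + (p j)%:C * rel_shift w j).
      by rewrite mulrDr mulr1 mulrA pp mul1r.
    rewrite !e; transitivity ((am j)%:C * (am j)%:C * ((p j)%:C * (p j)%:C) *
      ((1 + (p j)%:C * rel_shift z j) * (1 + (p j)%:C * rel_shift zeta j))); first by ring.
    by rewrite pp mulr1.
  ring.
rewrite eigenvalue_col; split => -[x [[i xi0] xE]].
  exists (fun j => (am j)%:C^-1 * x j); split.
    by exists i; rewrite mulf_neq0 // invr_neq0.
  move=> j; apply: (mulIf (a0 j)); rewrite key.
  have sx k : (am k)%:C * ((am k)%:C^-1 * x k) = x k by rewrite mulrA mulfV // mul1r.
  rewrite sx (eq_apply_cmx S sx) -opE xE.
  by rewrite -mulrA [X in _ = _ * X]mulrC sx.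
exists (fun j => (am j)%:C * x j); split.
  by exists i; rewrite mulf_neq0.
by move=> j; rewrite opE -key xE; ring.
Qed.

End EdgeData.

(** * Choice of constants and conclusion *)

Lemma cube_root_exists (R : realType) (x : R) : 0 < x -> exists e : R, 0 < e /\ e ^+ 3 = x.
Proof.
move=> x0; exists (x `^ 3^-1); split; first exact: powR_gt0.
by rewrite -powR_mulrn ?powR_ge0 // -powRrM mulVf // powRr1 // ltW.
Qed.

Lemma deterministic_expansion (R : realType) (cinf Csup Cm : R) :
  0 < cinf -> 0 < Csup -> 0 < Cm ->
  exists Cerr cbar : R, [/\ 0 < Cerr, 0 < cbar &
  forall (N : nat) (S : 'M[R]_N) (m : R[i] -> 'cV[R[i]]_N), (0 < N)%N ->
  (forall j k, S j k = S k j) ->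
  (forall j k, cinf / N%:R <= S j k <= Csup / N%:R) ->
  qve_solution S m -> assumptionC Cm m ->
  forall E0 : R, frakS m E0 -> forall z zeta : R[i],
  complex.Im z != 0 -> complex.Im zeta != 0 ->
  normc (z - E0%:C) <= cbar -> normc (zeta - E0%:C) <= cbar ->
  forall be, smallest_eigenvalue (stability_op S m z zeta) be ->
  normc (be - beta_expansion S m E0 z zeta)
    <= Cerr * (normc (z - E0%:C) + normc (zeta - E0%:C))].
Proof.
move=> cinf_gt0 Csup_gt0 Cm_gt0.
pose D := qve_const cinf Csup Cm.
have D_ge1 : 1 <= D by exact: qve_const_ge1.
have D_gt0 : 0 < D := lt_le_trans ltr01 D_ge1.
pose hi := f_hi D; pose Cg := edge_gap D; pose b := D ^+ 3; pose B := f_lo D ^- 2.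
have pi0 : 0 < (pi : R) := pi_gt0 R.
have lo0 : 0 < f_lo D by rewrite /f_lo mulr_gt0 // invr_gt0 exprn_gt0.
have hi0 : 0 < hi by rewrite /hi /f_hi mulr_gt0 // exprn_gt0.
have B0 : 0 < B by rewrite /B invr_gt0 exprn_gt0.
have b0 : 0 < b by rewrite exprn_gt0.
have Cg0 : 0 < Cg.
  have g0 : 0 < (D ^+ 3)^-1 * f_lo D ^+ 2 / f_hi D ^+ 2.
    by rewrite divr_gt0 ?exprn_gt0 // mulr_gt0 ?invr_gt0 ?exprn_gt0.
  by rewrite /Cg /edge_gap /gap_const mulr_gt0 // addr_gt0 // divr_gt0.
pose T3 := 36 * two_point_const D ^+ 3.
have T30 : 0 <= T3.
  have D0 := ltW D_gt0.
  rewrite mulr_ge0 // exprn_ge0 // /two_point_const addr_ge0 //.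
    by rewrite mulr_ge0 // exprn_ge0.
  by rewrite mulr_ge0 ?addr_ge0 // mulr_ge0 // exprn_ge0.
(* [T3] is the Hoelder constant, [D ^+ 3] pays for dividing by |m0|, and 1 ensures positivity. With
   e^3 = C0 (om + om') both shifts are at most [e]. *)
pose C0 := D ^+ 3 * T3 + 1.
have C00 : 0 < C0 by rewrite ltr_pwDr // mulr_ge0 // exprn_ge0 // ltW.
pose c1 := 2 * D / C0.
pose eps0 := (4 * (Cg + 1))^-1.
have Cg1 : 0 < 4 * (Cg + 1) by rewrite mulr_gt0 // addr_gt0.
have eps0_gt0 : 0 < eps0 by rewrite invr_gt0.
have eps0_le1 : eps0 <= 1.
  have aux (c : R) : 0 < c -> 1 <= 4 * (c + 1) by move=> c0; lra.
  by rewrite invf_le1 //; exact: aux.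
have [C HC] := eigenvalue_expansion hi Cg b B c1 eps0.
have [C5 HS] := small_eigenvector hi Cg b B eps0.
pose X := Cg * (1 + hi * hi * B) * b.
have X0 : 0 <= X.
  have [h1 h2 h3 h4] : [/\ 0 <= hi, 0 <= B, 0 <= b & 0 <= Cg] by split; exact: ltW.
  apply: mulr_ge0 => //; apply: mulr_ge0 => //; apply: addr_ge0 => //.
  by apply: mulr_ge0 => //; exact: mulr_ge0.
have n5 := normr_ge0 C5.
have X1 : 0 < 12 * (X + 1) by rewrite mulr_gt0 // ltr_wpDl.
have n51 : 0 < 6 * (`|C5| + 1) by rewrite mulr_gt0 // ltr_wpDl.
(* In order: 3 e <= 1; the e-part of the smallness condition is at most 1/4, the other 1/4 being
   left to [eps0]; and the confining radius |C5| 3 e stays below [eps0]. *)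
pose e1 := Num.min (3^-1) (Num.min (12 * (X + 1))^-1 (eps0 / (6 * (`|C5| + 1)))).
have e10 : 0 < e1 by rewrite !lt_min !invr_gt0 X1 divr_gt0 // ltr0n.
pose cbar := Num.min 1 (e1 ^+ 3 / (2 * C0)).
have cbar0 : 0 < cbar by rewrite lt_min ltr01 divr_gt0 ?exprn_gt0 ?mulr_gt0.
exists (`|C| * C0 + 1), cbar; split => //.
  by rewrite ltr_pwDr // mulr_ge0 // ltW.
move=> N S m N0 symS S_cC qm Cm_m E0 E0_sing z zeta zI zetaI hz hzeta be [be_ev be_min].
set om := normc (z - E0%:C) in hz *; set om' := normc (zeta - E0%:C) in hzeta *.
have omp w : complex.Im w != 0 -> 0 < normc (w - E0%:C).
  move=> w0; rewrite normc_gt0; apply: contraNneq w0 => /eqP.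
  by rewrite subr_eq0 => /eqP ->; rewrite eqxx.
have om0 : 0 < om := omp _ zI; have om'0 : 0 < om' := omp _ zetaI.
have Om0 : 0 < om + om' by rewrite addr_gt0.
have [e [e0 e3]] := cube_root_exists (mulr_gt0 C00 Om0).
have e_le : e <= e1.
  rewrite -(@ler_pXn2r _ 3) ?nnegrE ?(ltW e0) ?(ltW e10) // e3.
  have h : cbar <= e1 ^+ 3 / (2 * C0) by rewrite ge_min lexx orbT.
  have h2 : om + om' <= 2 * (e1 ^+ 3 / (2 * C0)).
    by have := le_trans hz h; have := le_trans hzeta h; move: (_ / _) => x; lra.
  have -> : e1 ^+ 3 = C0 * (2 * (e1 ^+ 3 / (2 * C0))) by field; rewrite gt_eqF.
  by rewrite ler_pM2l.
have cbar1 : cbar <= 1 by rewrite ge_min lexx.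
have e13 : 3 * e <= 1.
  have : e <= 3^-1 by apply: (le_trans e_le); rewrite ge_min lexx.
  by rewrite -ler_pdivlMl // mulr1.
have small : Cg * (3 * e * (1 + hi * hi * B) * b + eps0) <= 1 / 2.
  have h1 : e * (12 * (X + 1)) <= 1.
    by rewrite -ler_pdivlMr // mul1r; apply: (le_trans e_le); rewrite !ge_min lexx orbT.
  have h2 : 4 * (Cg * eps0) <= 1.
    have : eps0 * (4 * (Cg + 1)) = 1 by rewrite mulVf // gt_eqF.
    by move: (eps0_gt0); lra.
  have -> : Cg * (3 * e * (1 + hi * hi * B) * b + eps0) = 3 * (e * X) + Cg * eps0.
    by rewrite /X; ring.
  by move: h1 h2 e0; rewrite mulrCA mulrDr mulr1; move: (e * X) (Cg * eps0) => u v; lra.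
have sd := edge_spectral_data cinf_gt0 Csup_gt0 Cm_gt0 N0 symS S_cC qm Cm_m E0_sing.
have p1 := normc_p sd.
have amD j : D^-1 <= abs_m0 m E0 j 0 <= D.
  rewrite (abs_m0E cinf_gt0 Csup_gt0 Cm_gt0 N0 S_cC qm Cm_m E0_sing).
  exact: (qve_at_bnd (qve_at_edge cinf_gt0 Csup_gt0 Cm_gt0 N0 S_cC qm Cm_m E0_sing)).
have am0 j : 0 < abs_m0 m E0 j 0.
  by have /andP[h _] := amD j; apply: lt_le_trans h; rewrite invr_gt0.
have shift_le w : complex.Im w != 0 -> normc (w - E0%:C) <= cbar ->
    normc (w - E0%:C) <= om + om' -> forall j, normc (rel_shift m E0 w j) <= e.
  move=> wI hw hw2 j; rewrite -(@ler_pXn2r _ 3) ?nnegrE ?normc_ge0 ?(ltW e0) // e3.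
  rewrite /rel_shift normcM exprMn normc_real.
  rewrite -(m_edgeE cinf_gt0 Csup_gt0 Cm_gt0 N0 S_cC qm Cm_m E0_sing).
  have hold := edge_holder cinf_gt0 Csup_gt0 Cm_gt0 N0 symS S_cC qm Cm_m E0_sing
     wI (le_trans hw cbar1) j.
  apply: (@le_trans _ _ (D ^+ 3 * (T3 * (om + om')))).
    apply: ler_pM; rewrite ?exprn_ge0 ?normc_ge0 //.
      rewrite ler_pXn2r ?nnegrE ?(ltW D_gt0) // ger0_norm ?invr_ge0 ?(ltW (am0 j)) //.
      by have /andP[h _] := amD j; rewrite -[leRHS]invrK lef_pV2 ?posrE ?invr_gt0.
    by apply: (le_trans hold); apply: ler_wpM2l.
  by rewrite mulrA ler_pM2r // /C0 lerDl.
have eq_le w (we : forall j, normc (rel_shift m E0 w j) <= e) :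
   normc (w - E0%:C) <= om + om' -> forall j, bigOn e c1 3
     ((1 + (pvec m E0 j 0)%:C * rel_shift m E0 w j) * ((w - E0%:C) * (abs_m0 m E0 j 0)%:C)).
  move=> hw j; rewrite /bigOn e3.
  have -> : c1 * (C0 * (om + om')) = 2 * ((om + om') * D) by rewrite /c1; field; rewrite gt_eqF.
  rewrite normcM; apply: ler_pM; rewrite ?normc_ge0 //.
    apply: (le_trans (normcD _ _)); rewrite normc1 normcM.
    have : normc (pvec m E0 j 0)%:C * normc (rel_shift m E0 w j) <= 1 * e.
      by apply: ler_pM; rewrite ?normc_ge0.
    by move: e13 e0; lra.
  rewrite normcM normc_real ger0_norm ?(ltW (am0 j)) //.
  by apply: ler_pM; rewrite ?normc_ge0 ?(ltW (am0 j)) //; have /andP[] := amD j.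
have om_le : om <= om + om' by rewrite lerDl ltW.
have om'_le : om' <= om + om' by rewrite lerDr ltW.
have h_le := shift_le z zI hz om_le.
have k_le := shift_le zeta zetaI hzeta om'_le.
have s_le := eq_le z h_le om_le.
have s'_le := eq_le zeta k_le om'_le.
have h_eq j := rel_shift_eq cinf_gt0 Csup_gt0 Cm_gt0 N0 S_cC qm Cm_m E0_sing j zI.
have k_eq j := rel_shift_eq cinf_gt0 Csup_gt0 Cm_gt0 N0 S_cC qm Cm_m E0_sing j zetaI.
have xE w := xiE cinf_gt0 Csup_gt0 Cm_gt0 N0 S_cC qm Cm_m E0_sing w.
have stab la := stability_eigen cinf_gt0 Csup_gt0 Cm_gt0 N0 S_cC qm Cm_m E0_sing z zeta la.
pose h := rel_shift m E0 z; pose k := rel_shift m E0 zeta.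
pose p j := (pvec m E0 j 0)%:C.
pose F := Fop S m E0.
pose tau j := p j * h j + p j * k j + p j * h j * (p j * k j).
have tauE j : (1 + p j * h j) * (1 + p j * k j) = 1 + tau j by rewrite /tau; ring.
have tau_le j : normc (tau j) <= 3 * e.
  have ph : normc (p j * h j) <= e.
    by rewrite normcM -[leRHS]mul1r; apply: ler_pM; rewrite ?normc_ge0 //; exact: p1.
  have pk : normc (p j * k j) <= e.
    by rewrite normcM -[leRHS]mul1r; apply: ler_pM; rewrite ?normc_ge0 //; exact: p1.
  apply: (le_trans (normcD _ _)); have := normcD (p j * h j) (p j * k j).
  rewrite (normcM (p j * h j)).
  have : normc (p j * h j) * normc (p j * k j) <= e * 1.
    by apply: ler_pM; rewrite ?normc_ge0 //; apply: (le_trans pk); move: e13 e0; lra.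
  by move: ph pk; lra.
have t0 : 0 <= 3 * e by rewrite mulr_ge0 // ltW.
pose del := `|C5| * (3 * e).
have del0 : 0 <= del by rewrite mulr_ge0.
have del_eps : del < eps0.
  have he : e * (6 * (`|C5| + 1)) <= eps0.
    by rewrite -ler_pdivlMr //; apply: (le_trans e_le); rewrite !ge_min lexx !orbT.
  have : del * 2 < eps0 * 2; last by rewrite ltr_pM2r.
  apply: (@le_lt_trans _ _ eps0); last by rewrite ltr_pMr // ltr1n.
  by apply: le_trans he; rewrite /del; move: e0; nra.
(* Transposed, since [eigenvalue] concerns row vectors; see [MtE]. *)
pose A0 : 'M[R[i]]_N := \matrix_(i, j) ((i == j)%:R - (F j i)%:C).
pose A1 : 'M[R[i]]_N := \matrix_(i, j) (- (tau j * (F j i)%:C)).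
pose Mt (t : R) : 'M[R[i]]_N := \matrix_(i, j) ((i == j)%:R - (1 + t%:C * tau i) * (F i j)%:C).
have MtE t : A0 + t%:C *: A1 = (Mt t)^T.
  by apply/matrixP => i j; rewrite !mxE (eq_sym j i); ring.
have MtA t (x : 'I_N -> R[i]) i : \sum_j Mt t i j * x j =
    x i - (1 + t%:C * tau i) * apply_cmx F x i.
  have -> : x i = \sum_j (i == j)%:R * x j.
    by rewrite (bigD1 i) //= eqxx mul1r big1 ?addr0 // => l /negbTE; rewrite eq_sym => ->; rewrite mul0r.
  rewrite /apply_cmx mulr_sumr -sumrB; apply: eq_bigr => j _; rewrite mxE.
  by rewrite mulrBl mulrA.
have start : exists la, eigenvalue A0 la /\ normc la <= del.
  exists 0; split; last by rewrite normc0.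
  have -> : A0 = (Mt 0)^T by rewrite -MtE scale0r addr0.
  apply/eigenvalue_col; exists (fun j => (fvec m E0 j 0)%:C); split.
    exists (Ordinal N0); rewrite -normc_gt0 normc_real.
    have /andP[f1 _] := fvec_bounds cinf_gt0 Csup_gt0 Cm_gt0 N0 symS S_cC qm Cm_m E0_sing (Ordinal N0).
    have f0 : 0 < fvec m E0 (Ordinal N0) 0 by apply: lt_le_trans f1.
    by rewrite ger0_norm // ltW.
  by move=> j; rewrite MtA (sd_Ff sd) mul0r addr0 mul1r subrr mul0r.
have gap (t : R) la : 0 <= t <= 1 -> eigenvalue (A0 + t%:C *: A1) la ->
     normc la <= eps0 -> normc la <= del.
  move=> /andP[tt0 tt1]; rewrite MtE => /eigenvalue_col [x [x0 xEt]] la_le.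
  have tau_t j : normc (t%:C * tau j) <= 3 * e.
    rewrite normcM normc_real ger0_norm // -[leRHS]mul1r.
    by apply: ler_pM; rewrite ?normc_ge0.
  have xEt' j : x j - (1 + t%:C * tau j) * apply_cmx F x j = la * x j by rewrite -MtA xEt.
  have [y [_ _ _ _ laC]] := HS _ _ _ _ _ _ _ sd _ _ _ _ t0 e13 small tau_t la_le x0 xEt'.
  apply: (le_trans laC); rewrite /del; apply: ler_wpM2r => //; exact: ler_norm.
have [la [la_ev la_le]] := eigenvalue_homotopy del0 del_eps eps0_le1 start gap.
have la_stab : eigenvalue (stability_op S m z zeta)^T la.
  move: la_ev; have -> : A0 + A1 = (Mt 1)^T by rewrite -MtE scale1r.
  move=> /eigenvalue_col [x [x0 xEt]]; apply/stab; exists x; split => // j.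
  by rewrite -/(p j) -/(h j) -/(k j) tauE -xEt MtA mul1r.
(* The only use of minimality: beta is no larger than the eigenvalue found by the homotopy. *)
have be_le : normc be <= eps0.
  by apply: (le_trans (be_min _ la_stab)); apply: (le_trans la_le); exact: ltW.
have [x [x0 xEb]] := (stab be).1 be_ev.
have := HC _ _ _ _ _ _ _ sd e h k _ _ x _ _ be e0 e13 small h_le s_le h_eq (xE z)
   k_le s'_le k_eq (xE zeta) be_le x0 xEb.
rewrite /bigOn e3.
rewrite -psi_cmean => fin.
have -> : be - beta_expansion S m E0 z zeta =
  be + (sigma m E0)%:C / (dot (fvec m E0) (fvec m E0))%:C * (xi m E0 z + xi m E0 zeta) +
  (psi S m E0)%:C / (dot (fvec m E0) (fvec m E0))%:C *
    (xi m E0 z ^+ 2 + xi m E0 z * xi m E0 zeta + xi m E0 zeta ^+ 2) +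
  ((sigma m E0)%:C / (dot (fvec m E0) (fvec m E0))%:C) ^+ 2 * (xi m E0 z * xi m E0 zeta).
  have cV (u v : R) : (u / v)%:C = u%:C / v%:C by rewrite rmorphM fmorphV.
  have cX (u : R) : (u ^+ 2)%:C = u%:C ^+ 2 by rewrite rmorphXn.
  rewrite /beta_expansion !cV !cX -expr_div_n.
  move: (xi m E0 z) (xi m E0 zeta) ((sigma m E0)%:C / _) ((psi S m E0)%:C / _) => u v s t.
  by ring.
apply: (le_trans fin); rewrite mulrA; apply: ler_wpM2r; first exact: ltW.
apply: (@le_trans _ _ (`|C| * C0)); last by rewrite lerDl.
by apply: ler_wpM2r; [exact: ltW | exact: ler_norm].
Qed.

Unset Implicit Arguments.

Theorem proposition6p2 (R : realType) (cinf Csup Cm : R) (Cmom : nat -> R)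
    (cinf_gt0 : 0 < cinf) (Csup_gt0 : 0 < Csup) (Cm_gt0 : 0 < Cm)
    (Cmom_gt0 : forall p, 0 < Cmom p) :
  exists Cerr : R, 0 < Cerr /\
  forall eps0 : R, 0 < eps0 ->
  exists cbar : R, 0 < cbar /\
  forall c0 : R, 0 < c0 <= cbar ->
  forall (N : nat) (d : measure_display) (T : measurableType d)
    (P : probability T R) (H : T -> 'M[R[i]]_N) (m : R[i] -> 'cV[R[i]]_N),
  (0 < N)%N ->
  wigner_type P H ->
  assumptionA P cinf Csup H ->
  assumptionB P Cmom H ->
  qve_solution (variance_mx P H) m ->
  assumptionC Cm m ->
  forall E0 : R, frakS m E0 ->
  forall z zeta : R[i],
  disk_off_real N eps0 c0 E0 z ->
  disk_off_real N eps0 c0 E0 zeta ->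
  forall beta : R[i],
  smallest_eigenvalue (stability_op (variance_mx P H) m z zeta) beta ->
  normc (beta - beta_expansion (variance_mx P H) m E0 z zeta)
    <= Cerr * (normc (z - E0%:C) + normc (zeta - E0%:C)).
Proof.
have [Cerr [cbar [Cerr0 cbar0 main]]] :=
  deterministic_expansion cinf_gt0 Csup_gt0 Cm_gt0.
exists Cerr; split => // eps0 eps00; exists cbar; split => //.
move=> c0 /andP[c00 c0_le] N d T P H m N0 wig hA hB qm Cm_m E0 E0_sing.
move=> z zeta [hz zI] [hzeta zetaI] be be_min.
(* For N >= 1 the power of N is at most 1, so the shrinking disk lies in the fixed one. *)
have disk w : normc (w - E0%:C) <= c0 * N%:R `^ (- (eps0 / 3)) ->
    normc (w - E0%:C) <= cbar.
  move=> hw; apply: (le_trans hw); apply: le_trans c0_le.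
  rewrite ler_piMr ?(ltW c00) //.
  apply: (@le_trans _ _ (N%:R `^ 0)); last by rewrite powRr0.
  apply: ler_powR; first by rewrite ler1n.
  by rewrite oppr_le0 divr_ge0 // ltW.
apply: main => //; try exact: disk.
(* The variance matrix is symmetric because Hermitian entries satisfy |H_jk| = |H_kj| pointwise. *)
move=> j k; rewrite !mxE; congr (fine _); congr expectation.
apply/funext => w /=; congr (_ ^+ 2).
have /is_hermitianmxP := @wigner_hermitian _ _ _ _ _ _ wig w.
rewrite expr0 scale1r => Hw.
by rewrite {1}Hw !mxE; exact: normc_conj.
Qed.
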